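(* Let $R$ be a commutative noetherian ring and let $S/R$ be relative Frobenius of rank $4$. Then the global dimension of $\Pi_R(S)$ is at most $$\max(\operatorname{gl.dim}(R),\operatorname{gl.dim}(S))+2.$$
   Context: Relative Frobenius pairs: let $R\to S$ be a morphism of commutative rings. $S/R$ is relative Frobenius of rank $n$ if $S$ is a free $R$-module of rank $n$ and $\operatorname{Hom}_R(S,R)\cong S$ as $S$-modules. Generalized preprojective algebra: given such a pair, let $R\oplus S$ be the product ring. Let $M={}_RS_S$, viewed as an $R\oplus S$-bimodule with $R$ acting on the left, $S$ acting on the right and the other components acting by zero. Let $N={}_SS_R$, viewed as an $R\oplus S$-bimodule with $S$ acting on the left, $R$ acting on the right and the other components acting by zero. Put $T(R,S)=T_{R\oplus S}(M\oplus N)$ (tensor algebra over $R\oplus S$, graded by tensor degree). Then $M\otimes_{R\oplus S}M=N\otimes_{R\oplus S}N=0$, $M\otimes_{R\oplus S}N=S\otimes_SS$ (an $R$-$R$-bimodule) and $N\otimes_{R\oplus S}M=S\otimes_RS$ (an $S$-$S$-bimodule). Let $\lambda$ be a generator of $\operatorname{Hom}_R(S,R)$ as an $S$-module and let $(e_i)_i,(f_j)_j$ be $R$-bases of $S$ with $\lambda(e_if_j)=\delta_{ij}$. Then $\Pi_R(S)=T(R,S)/I$, where $I$ is the two-sided ideal generated by the degree $2$ elements $1\otimes 1\in M\otimes_{R\oplus S}N$ and $\sum_ie_i\otimes f_i\in N\otimes_{R\oplus S}M$. It is an $\mathbb{N}$-graded $R$-algebra (via $r\mapsto(r,r\cdot1_S)\in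 R\oplus S$), independent of the choices up to isomorphism. *)

(* Defs.v *)
From HB Require Import structures.
From mathcomp Require Import all_boot all_order all_algebra generic_quotient.
From mathcomp Require Import boolp classical_sets constructive_ereal.

Set Implicit Arguments.
Unset Strict Implicit.
Unset Printing Implicit Defensive.

Import GRing.Theory.
Local Open Scope ring_scope.
Local Open Scope quotient_scope.

Record bimodule (B : pzRingType) := Bimodule {
  bimod_sort :> lmodType B;
  ract : bimod_sort -> B -> bimod_sort;
  ractDl : forall u v b, ract (u + v) b = ract u b + ract v b;
  ractDr : forall v b c, ract v (b + c) = ract v b + ract v c;
  ractM : forall v b c, ract v (b * c) = ract (ract v b) c;
  ract1 : forall v, ract v 1 = v;
  ractZ : forall b v c, ract (b *: v) c = b *: ract v c }.

Section BimodSum.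
Variables (B : pzRingType) (V W : bimodule B).

Definition bsum_ract (x : V * W) (b : B) : V * W := (ract x.1 b, ract x.2 b).

Lemma bsum_ractDl x y b : bsum_ract (x + y) b = bsum_ract x b + bsum_ract y b.
Proof. by rewrite /bsum_ract !ractDl. Qed.
Lemma bsum_ractDr x b c : bsum_ract x (b + c) = bsum_ract x b + bsum_ract x c.
Proof. by rewrite /bsum_ract !ractDr. Qed.
Lemma bsum_ractM x b c : bsum_ract x (b * c) = bsum_ract (bsum_ract x b) c.
Proof. by rewrite /bsum_ract !ractM. Qed.
Lemma bsum_ract1 x : bsum_ract x 1 = x.
Proof. by case: x => v w; rewrite /bsum_ract !ract1. Qed.
Lemma bsum_ractZ b x c : bsum_ract (b *: x) c = b *: bsum_ract x c.
Proof. by rewrite /bsum_ract !ractZ. Qed.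

Definition bsum : bimodule B :=
  Bimodule bsum_ractDl bsum_ractDr bsum_ractM bsum_ract1 bsum_ractZ.
End BimodSum.

Section Tensor.
Variables (B : pzRingType) (V : bimodule B) (W : lmodType B).

(* The list [:: (v1, w1); ..; (vk, wk)] stands for the finite sum of the       *)
(* vi (x) wi. Signs are absorbed in the left factors, so that lists modulo     *)
(* tens_eq already form a group.                                              *)
Inductive tens_eq : seq (V * W) -> seq (V * W) -> Prop :=
| tens_refl s : tens_eq s s
| tens_sym s t : tens_eq s t -> tens_eq t s
| tens_trans s t u : tens_eq s t -> tens_eq t u -> tens_eq s u
| tens_cat s s' t t' : tens_eq s s' -> tens_eq t t' -> tens_eq (s ++ t) (s' ++ t')
| tens_catC s t : tens_eq (s ++ t) (t ++ s)
| tens_eq0 w : tens_eq [:: (0, w)] [::]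
| tens_eqDl v v' w : tens_eq [:: (v + v', w)] [:: (v, w); (v', w)]
| tens_eqDr v w w' : tens_eq [:: (v, w + w')] [:: (v, w); (v, w')]
| tens_eqZ v b w : tens_eq [:: (ract v b, w)] [:: (v, b *: w)].

Definition tens_eqb (s t : seq (V * W)) : bool := `[< tens_eq s t >].

Lemma tens_eqb_refl : reflexive tens_eqb.
Proof. by move=> s; apply/asboolP/tens_refl. Qed.
Lemma tens_eqb_sym : symmetric tens_eqb.
Proof.
by move=> s t; apply/idP/idP => /asboolP h; apply/asboolP; exact: tens_sym.
Qed.
Lemma tens_eqb_trans : transitive tens_eqb.
Proof.
move=> s t u /asboolP h /asboolP k; apply/asboolP; exact: tens_trans h k.
Qed.
Canonical tens_equiv := EquivRel tens_eqb tens_eqb_refl tens_eqb_sym tens_eqb_trans.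

Definition tensor : Type := {eq_quot tens_equiv}.
HB.instance Definition _ := Choice.on tensor.

Definition tsum (s : seq (V * W)) : tensor := \pi_({eq_quot tens_equiv}) s.
Definition trepr (x : tensor) : seq (V * W) := @repr _ {eq_quot tens_equiv} x.

Lemma treprK x : tsum (trepr x) = x.
Proof. exact: reprK. Qed.
Lemma tsumP s t : tens_eq s t <-> tsum s = tsum t.
Proof. by split=> [h|/eqmodP/asboolP//]; apply/eqmodP/asboolP. Qed.
Lemma trepr_tsum s : tens_eq (trepr (tsum s)) s.
Proof. by apply/tsumP; rewrite treprK. Qed.

Definition tens0 : tensor := tsum [::].
Definition tens_add (x y : tensor) : tensor := tsum (trepr x ++ trepr y).
Definition tens_neg (s : seq (V * W)) := [seq (- p.1, p.2) | p <- s].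
Definition tens_opp (x : tensor) : tensor := tsum (tens_neg (trepr x)).
Definition tens_scl (b : B) (s : seq (V * W)) := [seq (b *: p.1, p.2) | p <- s].
Definition tens_scale b (x : tensor) : tensor := tsum (tens_scl b (trepr x)).

Lemma ract0l b : ract (0 : V) b = 0.
Proof. by apply: (addrI (ract (0 : V) b)); rewrite -ractDl !addr0. Qed.
Lemma ractN (v : V) b : ract (- v) b = - ract v b.
Proof. by apply/eqP; rewrite -addr_eq0 -ractDl addNr ract0l. Qed.

Lemma tens_map_compat (f : {additive V -> V}) :
    (forall v b, f (ract v b) = ract (f v) b) ->
  forall s t, tens_eq s t ->
  tens_eq [seq (f p.1, p.2) | p <- s] [seq (f p.1, p.2) | p <- t].
Proof.
move=> fr s t; elim=> {s t} /=.
- by move=> s; exact: tens_refl.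
- by move=> s t _; exact: tens_sym.
- by move=> s t u _ h _; exact: tens_trans h.
- by move=> s s' t t' _ h _ k; rewrite !map_cat; exact: tens_cat.
- by move=> s t; rewrite !map_cat; exact: tens_catC.
- by move=> w; rewrite raddf0; exact: tens_eq0.
- by move=> v v' w; rewrite raddfD; exact: tens_eqDl.
- by move=> v w w'; exact: tens_eqDr.
- by move=> v b w; rewrite fr; exact: tens_eqZ.
Qed.

Lemma tsum_cat s t : tsum (s ++ t) = tens_add (tsum s) (tsum t).
Proof. by apply/tsumP; apply: tens_sym; apply: tens_cat; apply: trepr_tsum. Qed.
Lemma tsum_neg s : tsum (tens_neg s) = tens_opp (tsum s).
Proof.
apply/tsumP; apply: tens_sym.
by apply: (@tens_map_compat (@GRing.opp V)) (trepr_tsum s) => v b; rewrite ractN.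
Qed.
Lemma tsum_scl b s : tsum (tens_scl b s) = tens_scale b (tsum s).
Proof.
apply/tsumP; apply: tens_sym.
by apply: (@tens_map_compat (GRing.scale b)) (trepr_tsum s) => v c; rewrite ractZ.
Qed.

Lemma tens_addA : associative tens_add.
Proof.
move=> x y z; rewrite -[x]treprK -[y]treprK -[z]treprK.
by rewrite -!tsum_cat catA.
Qed.
Lemma tens_addC : commutative tens_add.
Proof. by move=> x y; apply/tsumP/tens_catC. Qed.
Lemma tens_add0 : left_id tens0 tens_add.
Proof. by move=> x; rewrite -[x]treprK -tsum_cat. Qed.
Lemma tens_addN : left_inverse tens0 tens_opp tens_add.
Proof.
have ACA x y z t :
    tens_add (tens_add x y) (tens_add z t) = tens_add (tens_add x z) (tens_add y t).
  by rewrite tens_addA -[in LHS](tens_addA x) (tens_addC y) tens_addA -tens_addA.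
move=> x; rewrite -[x]treprK -tsum_neg.
elim: (trepr x) => [|[v w] s IH] /=; first by rewrite -tsum_cat.
rewrite -cat1s -[(v, w) :: s]cat1s !tsum_cat ACA IH -tsum_cat tens_addC tens_add0.
apply/tsumP; apply: tens_trans (tens_sym (tens_eqDl _ _ _)) _.
by rewrite addNr; exact: tens_eq0.
Qed.

HB.instance Definition _ :=
  GRing.isZmodule.Build tensor tens_addA tens_addC tens_add0 tens_addN.

Lemma tsumD s t : tsum (s ++ t) = tsum s + tsum t.
Proof. exact: tsum_cat. Qed.

Lemma tens_scaleA b c x : tens_scale b (tens_scale c x) = tens_scale (b * c) x.
Proof.
rewrite -[x]treprK -!tsum_scl /tens_scl -map_comp; congr tsum; apply: eq_map => p /=.
by rewrite scalerA.
Qed.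
Lemma tens_scale1 : left_id 1 tens_scale.
Proof.
move=> x; rewrite -[x in RHS]treprK; congr tsum.
by rewrite -[RHS]map_id; apply: eq_map => -[v w]; rewrite scale1r.
Qed.
Lemma tens_scaleDr : right_distributive tens_scale +%R.
Proof.
move=> b x y; rewrite -[x]treprK -[y]treprK -tsumD -!tsum_scl.
by rewrite /tens_scl map_cat tsumD.
Qed.
Lemma tens_scaleDl x : {morph tens_scale^~ x : b c / b + c}.
Proof.
move=> b c; rewrite -[x]treprK -!tsum_scl; elim: (trepr x) => [|[v w] s IH] /=.
  by rewrite -tsumD.
rewrite -cat1s tsumD IH -[_ :: tens_scl b s]cat1s -[_ :: tens_scl c s]cat1s.
rewrite !tsumD addrACA; congr (_ + _).
by rewrite -tsumD scalerDl; apply/tsumP/tens_eqDl.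
Qed.

HB.instance Definition _ := GRing.Zmodule_isLmodule.Build B tensor
  tens_scaleA tens_scale1 tens_scaleDr tens_scaleDl.

Definition tens (v : V) (w : W) : tensor := tsum [:: (v, w)].

Lemma tensDl u v w : tens (u + v) w = tens u w + tens v w.
Proof. by rewrite -tsumD; apply/tsumP/tens_eqDl. Qed.
Lemma tensDr v w w' : tens v (w + w') = tens v w + tens v w'.
Proof. by rewrite -tsumD; apply/tsumP/tens_eqDr. Qed.
Lemma tensA v b w : tens (ract v b) w = tens v (b *: w).
Proof. exact/tsumP/tens_eqZ. Qed.
Lemma tens0l w : tens 0 w = 0.
Proof. exact/tsumP/tens_eq0. Qed.
Lemma tens0r v : tens v 0 = 0.
Proof. by apply: (addrI (tens v 0)); rewrite -tensDr !addr0. Qed.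
Lemma scale_tens b v w : b *: tens v w = tens (b *: v) w.
Proof. by rewrite -[LHS]tsum_scl. Qed.

Lemma tsumE s : tsum s = \sum_(p <- s) tens p.1 p.2.
Proof.
elim: s => [|[v w] s IH]; first by rewrite big_nil.
by rewrite big_cons -cat1s tsumD IH.
Qed.

Lemma tensor_ind (P : tensor -> Prop) :
    P 0 -> (forall x y, P x -> P y -> P (x + y)) -> (forall v w, P (tens v w)) ->
  forall x, P x.
Proof.
move=> P0 PD Pt x; rewrite -[x]treprK tsumE.
by elim/big_ind: _ => // p _; exact: Pt.
Qed.

(* The map v (x) w |-> f v w; it is meaningful when f is additive in each     *)
(* argument and balanced.                                                     *)
Definition tlift (Z : zmodType) (f : V -> W -> Z) (x : tensor) : Z :=
  \sum_(p <- trepr x) f p.1 p.2.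

Section Lift.
Variables (Z : zmodType) (f : V -> W -> Z).
Hypothesis fDl : forall u v w, f (u + v) w = f u w + f v w.
Hypothesis fDr : forall v w w', f v (w + w') = f v w + f v w'.
Hypothesis fA : forall v b w, f (ract v b) w = f v (b *: w).

Lemma tlift_compat s t : tens_eq s t ->
  \sum_(p <- s) f p.1 p.2 = \sum_(p <- t) f p.1 p.2.
Proof.
elim=> {s t}.
- by [].
- by move=> s t _ ->.
- by move=> s t u _ -> _.
- by move=> s s' t t' _ h _ k; rewrite !big_cat /= h k.
- by move=> s t; rewrite !big_cat /= addrC.
- move=> w; rewrite big_seq1 big_nil /=.
  by apply: (addrI (f 0 w)); rewrite -fDl !addr0.
- by move=> u v w; rewrite big_seq1 big_cons big_seq1 /= fDl.
- by move=> v w w'; rewrite big_seq1 big_cons big_seq1 /= fDr.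
- by move=> v b w; rewrite !big_seq1 /= fA.
Qed.

Lemma tlift_tsum s : tlift f (tsum s) = \sum_(p <- s) f p.1 p.2.
Proof. exact/tlift_compat/trepr_tsum. Qed.
Lemma tlift_tens v w : tlift f (tens v w) = f v w.
Proof. by rewrite tlift_tsum big_seq1. Qed.
Lemma tliftD x y : tlift f (x + y) = tlift f x + tlift f y.
Proof.
by rewrite -[x]treprK -[y]treprK -tsumD !tlift_tsum big_cat.
Qed.
Lemma tlift0 : tlift f 0 = 0.
Proof. by rewrite [LHS]tlift_tsum big_nil. Qed.
End Lift.
End Tensor.

Section TensorAlgebra.
Variables (B : pzRingType) (V : bimodule B).

(* V (x) (V (x) .. (V (x) B)); the degree 1 component V (x) B is identified    *)
(* with V through tinj1 below.                                                *)
Fixpoint tpow (n : nat) : lmodType B :=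
  if n is m.+1 then tensor V (tpow m) else B^o.

Record talg := TAlg {
  tcomp :> forall n, tpow n;
  tcompP : exists N, forall n, (N <= n)%N -> tcomp n = 0 }.

Lemma talgP (x y : talg) : (forall n, x n = y n) -> x = y.
Proof.
case: x y => [f fP] [g gP] /= fg.
have {fg}fg : f = g by apply: functional_extensionality_dep.
by subst g; congr TAlg; exact: Prop_irrelevance.
Qed.

HB.instance Definition _ := gen_eqMixin talg.
HB.instance Definition _ := gen_choiceMixin talg.

Lemma talg0P : exists N, forall n, (N <= n)%N -> (0 : tpow n) = 0.
Proof. by exists 0%N. Qed.
Definition talg0 := TAlg talg0P.

Lemma talg_oppP (x : talg) : exists N, forall n, (N <= n)%N -> - x n = 0.
Proof. by have [N h] := tcompP x; exists N => n /h ->; rewrite oppr0. Qed.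
Definition talg_opp x := TAlg (talg_oppP x).

Lemma talg_addP (x y : talg) :
  exists N, forall n, (N <= n)%N -> x n + y n = 0.
Proof.
have [N h] := tcompP x; have [M k] := tcompP y; exists (maxn N M) => n.
by rewrite geq_max => /andP[/h-> /k->]; rewrite addr0.
Qed.
Definition talg_add x y := TAlg (talg_addP x y).

Lemma talg_addA : associative talg_add.
Proof. by move=> x y z; apply: talgP => n /=; rewrite addrA. Qed.
Lemma talg_addC : commutative talg_add.
Proof. by move=> x y; apply: talgP => n /=; rewrite addrC. Qed.
Lemma talg_add0 : left_id talg0 talg_add.
Proof. by move=> x; apply: talgP => n /=; rewrite add0r. Qed.
Lemma talg_addN : left_inverse talg0 talg_opp talg_add.
Proof. by move=> x; apply: talgP => n /=; rewrite addNr. Qed.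

HB.instance Definition _ :=
  GRing.isZmodule.Build talg talg_addA talg_addC talg_add0 talg_addN.

Lemma tcomp0 n : (0 : talg) n = 0. Proof. by []. Qed.
Lemma tcompD (x y : talg) n : (x + y) n = x n + y n. Proof. by []. Qed.
Lemma tcomp_sum I (r : seq I) (F : I -> talg) n :
  (\sum_(i <- r) F i) n = \sum_(i <- r) F i n.
Proof. exact: (big_morph (fun x : talg => x n)). Qed.

Lemma lscaleP (b : B) (x : talg) : exists N, forall n, (N <= n)%N -> b *: x n = 0.
Proof. by have [N h] := tcompP x; exists N => n /h ->; rewrite scaler0. Qed.
Definition lscale b x := TAlg (lscaleP b x).

Definition lshift_comp (v : V) (x : talg) n : tpow n :=
  if n is m.+1 then tens v (x m) else 0.
Lemma lshiftP v x : exists N, forall n, (N <= n)%N -> lshift_comp v x n = 0.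
Proof.
have [N h] := tcompP x; exists N.+1 => -[|n] //=; rewrite ltnS => /h ->.
exact: tens0r.
Qed.
Definition lshift v x := TAlg (lshiftP v x).

(* Left multiplication by an element of degree n:                             *)
(* (v (x) t) y = v (x) (t y), starting from the left action of B.             *)
Fixpoint tmul_hom (n : nat) : tpow n -> talg -> talg :=
  if n is m.+1
  then fun x y => tlift (fun v t => lshift v (tmul_hom t y)) x
  else fun b y => lscale b y.

Definition talg_deg (x : talg) : nat := sval (cid (tcompP x)).
Definition talg_mul (x y : talg) : talg :=
  \sum_(n < talg_deg x) tmul_hom (x n) y.

Definition tinj0_comp (b : B) n : tpow n := if n is 0 then b else 0.
Lemma tinj0P b : exists N, forall n, (N <= n)%N -> tinj0_comp b n = 0.
Proof. by exists 1%N => -[]. Qed.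
Definition tinj0 b := TAlg (tinj0P b).
Definition tinj1 (v : V) : talg := lshift v (tinj0 1).

Lemma lscaleDl b c x : lscale (b + c) x = lscale b x + lscale c x.
Proof. by apply: talgP => n; rewrite tcompD /= scalerDl. Qed.
Lemma lscaleDr b x y : lscale b (x + y) = lscale b x + lscale b y.
Proof. by apply: talgP => n; rewrite tcompD /= scalerDr. Qed.
Lemma lscaleM b c x : lscale (b * c) x = lscale b (lscale c x).
Proof. by apply: talgP => n /=; rewrite scalerA. Qed.
Lemma lscale1 x : lscale 1 x = x.
Proof. by apply: talgP => n /=; rewrite scale1r. Qed.
Lemma lscale0l x : lscale 0 x = 0.
Proof. by apply: talgP => n /=; rewrite scale0r. Qed.

Lemma lshiftDl u v x : lshift (u + v) x = lshift u x + lshift v x.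
Proof. by apply: talgP => -[|n]; rewrite tcompD /= ?addr0 ?tensDl. Qed.
Lemma lshiftDr v x y : lshift v (x + y) = lshift v x + lshift v y.
Proof. by apply: talgP => -[|n]; rewrite tcompD /= ?addr0 ?tensDr. Qed.
Lemma lshift_ract v b x : lshift (ract v b) x = lshift v (lscale b x).
Proof. by apply: talgP => -[|n] //=; rewrite tensA. Qed.
Lemma lscale_lshift b v x : lscale b (lshift v x) = lshift (b *: v) x.
Proof. by apply: talgP => -[|n] /=; rewrite ?scaler0 ?scale_tens. Qed.

Lemma tmul_hom_spec n :
  [/\ forall (s t : tpow n) y, tmul_hom (s + t) y = tmul_hom s y + tmul_hom t y,
      forall b (t : tpow n) y, tmul_hom (b *: t) y = lscale b (tmul_hom t y) &
      forall v (t : tpow n) y,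
        tmul_hom (tens v t : tpow n.+1) y = lshift v (tmul_hom t y)].
Proof.
have step m (hD : forall (s t : tpow m) y,
      tmul_hom (s + t) y = tmul_hom s y + tmul_hom t y)
    (hZ : forall b (t : tpow m) y, tmul_hom (b *: t) y = lscale b (tmul_hom t y)) y :
  let f v (t : tpow m) := lshift v (tmul_hom t y) in
  [/\ forall u v w, f (u + v) w = f u w + f v w,
      forall v w w', f v (w + w') = f v w + f v w' &
      forall v b w, f (ract v b) w = f v (b *: w)].
  move=> f; split=> [u v w|v w w'|v b w]; rewrite /f.
  - exact: lshiftDl.
  - by rewrite hD lshiftDr.
  - by rewrite hZ lshift_ract.
elim: n => [|n [hD hZ hT]].
  have hD (s t : tpow 0) y : tmul_hom (s + t) y = tmul_hom s y + tmul_hom t y.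
    exact: lscaleDl.
  have hZ b (t : tpow 0) y : tmul_hom (b *: t) y = lscale b (tmul_hom t y).
    exact: lscaleM.
  split=> // v t y; have [? ? ?] := step 0%N hD hZ y; exact: tlift_tens.
have hD' (s t : tpow n.+1) y : tmul_hom (s + t) y = tmul_hom s y + tmul_hom t y.
  by have [? ? ?] := step n hD hZ y; exact: tliftD.
have hZ' b (t : tpow n.+1) y : tmul_hom (b *: t) y = lscale b (tmul_hom t y).
  elim/tensor_ind: t => [|s t IHs IHt|v t].
  - have [? ? ?] := step n hD hZ y; rewrite scaler0 /= tlift0 //.
    by apply: talgP => k /=; rewrite scaler0.
  - by rewrite scalerDr !hD' lscaleDr IHs IHt.
  - by rewrite scale_tens !hT lscale_lshift.
split=> // v t y; have [? ? ?] := step n.+1 hD' hZ' y; exact: tlift_tens.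
Qed.

Lemma tmul_homDl n (s t : tpow n) y :
  tmul_hom (s + t) y = tmul_hom s y + tmul_hom t y.
Proof. by have [-> _ _] := tmul_hom_spec n. Qed.
Lemma tmul_homZ n b (t : tpow n) y : tmul_hom (b *: t) y = lscale b (tmul_hom t y).
Proof. by have [_ -> _] := tmul_hom_spec n. Qed.
Lemma tmul_hom_tens n v (t : tpow n) y :
  tmul_hom (tens v t : tpow n.+1) y = lshift v (tmul_hom t y).
Proof. by have [_ _ ->] := tmul_hom_spec n. Qed.
Lemma tmul_hom0 n y : tmul_hom (0 : tpow n) y = 0.
Proof. by apply: (addrI (tmul_hom (0 : tpow n) y)); rewrite -tmul_homDl !addr0. Qed.

Lemma tpow_ind (P : forall n, tpow n -> Prop) :
    (forall n, P n 0) ->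
    (forall n s t, P n s -> P n t -> P n (s + t)) ->
    (forall b : B, P 0 b) ->
    (forall n v t, P n t -> P n.+1 (tens v t)) ->
  forall n t, P n t.
Proof.
move=> P0 PD PB Pt; elim=> [|n IH] t; first exact: PB.
by elim/tensor_ind: t => [|s t ? ?|v t]; [exact: P0|exact: PD|exact: Pt].
Qed.

Lemma tmul_homDr n (t : tpow n) y z :
  tmul_hom t (y + z) = tmul_hom t y + tmul_hom t z.
Proof.
elim/tpow_ind: n / t => [n|n s t IHs IHt|b|n v t IH].
- by rewrite !tmul_hom0 addr0.
- by rewrite !tmul_homDl IHs IHt addrACA.
- exact: lscaleDr.
- by rewrite !tmul_hom_tens IH lshiftDr.
Qed.

Lemma talg_mulE N (x y : talg) : (forall n, (N <= n)%N -> x n = 0) ->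
  talg_mul x y = \sum_(n < N) tmul_hom (x n) y.
Proof.
have aux M M' : (M <= M')%N -> (forall n, (M <= n)%N -> x n = 0) ->
    \sum_(n < M') tmul_hom (x n) y = \sum_(n < M) tmul_hom (x n) y.
  move=> leM hM; rewrite -(subnKC leM) big_split_ord /= [X in _ + X]big1 ?addr0 //.
  by move=> i _; rewrite hM ?leq_addr // tmul_hom0.
move=> hN; rewrite /talg_mul; have hD := svalP (cid (tcompP x)).
rewrite -(aux _ (maxn N (talg_deg x)) (leq_maxr _ _) hD).
exact: aux (leq_maxl _ _) hN.
Qed.

Lemma talg_mulDl : left_distributive talg_mul +%R.
Proof.
move=> x y z; have [N h] := tcompP x; have [M k] := tcompP y.
have h' n : (maxn N M <= n)%N -> x n = 0 by rewrite geq_max => /andP[/h].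
have k' n : (maxn N M <= n)%N -> y n = 0 by rewrite geq_max => /andP[_ /k].
rewrite (talg_mulE z h') (talg_mulE z k') -big_split /=.
rewrite (@talg_mulE (maxn N M)); last by move=> n l; rewrite tcompD h' ?k' ?addr0.
by apply: eq_bigr => i _; rewrite tcompD tmul_homDl.
Qed.

Lemma talg_mulDr : right_distributive talg_mul +%R.
Proof.
move=> x y z; rewrite /talg_mul -big_split.
by apply: eq_bigr => i _; rewrite tmul_homDr.
Qed.

Lemma talg_mul0l y : talg_mul 0 y = 0.
Proof. by apply: (addrI (talg_mul 0 y)); rewrite -talg_mulDl !addr0. Qed.

Lemma lshift0r v : lshift v 0 = 0.
Proof. by apply: (addrI (lshift v 0)); rewrite -lshiftDr !addr0. Qed.

Lemma lshift_mul v y z : talg_mul (lshift v y) z = lshift v (talg_mul y z).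
Proof.
have [N h] := tcompP y; rewrite (talg_mulE z h) (@talg_mulE N.+1); last first.
  by case=> // n; rewrite ltnS /= => /h ->; exact: tens0r.
rewrite big_ord_recl tmul_hom0 add0r.
rewrite (big_morph (lshift v) (lshiftDr v) (lshift0r v)).
by apply: eq_bigr => i _; rewrite -tmul_hom_tens.
Qed.

Lemma lscale_mul b y z : talg_mul (lscale b y) z = lscale b (talg_mul y z).
Proof.
have [N h] := tcompP y; rewrite (talg_mulE z h) (@talg_mulE N); last first.
  by move=> n /h /= ->; rewrite scaler0.
have b0 : lscale b 0 = 0 by apply: talgP => n /=; rewrite scaler0.
rewrite (big_morph (lscale b) (lscaleDr b) b0).
by apply: eq_bigr => i _; rewrite -tmul_homZ.
Qed.

Lemma tmul_homA n (t : tpow n) y z :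
  tmul_hom t (talg_mul y z) = talg_mul (tmul_hom t y) z.
Proof.
elim/tpow_ind: n / t => [n|n s t IHs IHt|b|n v t IH].
- by rewrite !tmul_hom0 talg_mul0l.
- by rewrite !tmul_homDl IHs IHt talg_mulDl.
- by symmetry; exact: lscale_mul.
- by rewrite !tmul_hom_tens IH lshift_mul.
Qed.

Lemma talg_mulA : associative talg_mul.
Proof.
move=> x y z; rewrite {1}/talg_mul [talg_mul x y]/talg_mul.
rewrite (big_morph (talg_mul^~ z) (fun y y' => talg_mulDl y y' z) (talg_mul0l z)).
by apply: eq_bigr => i _; rewrite tmul_homA.
Qed.

Lemma talg_mul1l : left_id (tinj0 1) talg_mul.
Proof.
move=> y; rewrite (@talg_mulE 1); last by case.
by rewrite big_ord1; exact: lscale1.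
Qed.

Lemma tmul_hom1 n (t : tpow n) :
  tmul_hom t (tinj0 1) n = t /\
  forall k, k != n -> tmul_hom t (tinj0 1) k = 0.
Proof.
elim/tpow_ind: n / t => [n|n s t [s1 s2] [t1 t2]|b|n v t [t1 t2]].
- by rewrite tmul_hom0.
- rewrite !tmul_homDl !tcompD s1 t1; split=> // k kn.
  by rewrite tcompD s2 // t2 // addr0.
- by split=> [|[]//= k _]; [exact: mulr1|exact: scaler0].
- rewrite !tmul_hom_tens /= t1; split=> // -[|k] kn //=.
  by rewrite t2 // tens0r.
Qed.

Lemma talg_mul1r : right_id (tinj0 1) talg_mul.
Proof.
move=> x; have [N h] := tcompP x; rewrite (talg_mulE _ h); apply: talgP => k.
rewrite tcomp_sum; case: (ltnP k N) => [kN|Nk].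
  rewrite (bigD1 (Ordinal kN)) //= big1 ?addr0; first by case: (tmul_hom1 (x k)).
  by move=> i ik; apply: (tmul_hom1 (x i)).2; rewrite eq_sym.
rewrite h // big1 // => i _; apply: (tmul_hom1 (x i)).2.
by rewrite gtn_eqF // (leq_trans (ltn_ord i)).
Qed.

HB.instance Definition _ := GRing.Zmodule_isPzRing.Build talg
  talg_mulA talg_mul1l talg_mul1r talg_mulDl talg_mulDr.

End TensorAlgebra.

Local Open Scope classical_set_scope.

Definition two_sided_ideal (A : pzRingType) (I : set A) : Prop :=
  [/\ I 0, (forall x y, I x -> I y -> I (x + y)),
      (forall a x, I x -> I (a * x)) & (forall a x, I x -> I (x * a))].

Definition ideal_gen (A : pzRingType) (X : set A) : set A :=
  [set x | forall I : set A, two_sided_ideal I -> X `<=` I -> I x].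

Lemma ideal_genP (A : pzRingType) (X : set A) : two_sided_ideal (ideal_gen X).
Proof.
split=> [I [] //|x y hx hy I idI XI|a x hx I idI XI|a x hx I idI XI];
  have [_ hD hl hr] := idI.
- by apply: hD; [exact: hx|exact: hy].
- by apply: hl; exact: hx.
- by apply: hr; exact: hx.
Qed.

Section IdealQuotient.
Variables (A : pzRingType) (X : set A).

Definition cong_gen (x y : A) : bool := `[< ideal_gen X (x - y) >].

Lemma cong_gen_refl : reflexive cong_gen.
Proof. by move=> x; apply/asboolP; rewrite subrr; have [] := ideal_genP X. Qed.
Lemma cong_gen_sym : symmetric cong_gen.
Proof.
have [_ _ hl _] := ideal_genP X.
by move=> x y; apply/asboolP/asboolP => h; rewrite -opprB -[X in ideal_gen _ X]mulN1r; apply: hl.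
Qed.
Lemma cong_gen_trans : transitive cong_gen.
Proof.
have [_ hD _ _] := ideal_genP X.
move=> y x z /asboolP h /asboolP k; apply/asboolP.
by rewrite -(subrKA y); apply: hD.
Qed.
Canonical cong_gen_equiv :=
  EquivRel cong_gen cong_gen_refl cong_gen_sym cong_gen_trans.

Definition ideal_quot : Type := {eq_quot cong_gen_equiv}.
HB.instance Definition _ := Choice.on ideal_quot.

Definition qpi (x : A) : ideal_quot := \pi_({eq_quot cong_gen_equiv}) x.
Definition qrepr (x : ideal_quot) : A := @repr _ {eq_quot cong_gen_equiv} x.

Lemma qreprK x : qpi (qrepr x) = x.
Proof. exact: reprK. Qed.
Lemma qpiP x y : ideal_gen X (x - y) <-> qpi x = qpi y.
Proof. by split=> [h|/eqmodP/asboolP//]; apply/eqmodP/asboolP. Qed.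
Lemma qrepr_qpi x : ideal_gen X (qrepr (qpi x) - x).
Proof. by apply/qpiP; rewrite qreprK. Qed.

Definition quot_add (x y : ideal_quot) := qpi (qrepr x + qrepr y).
Definition quot_opp (x : ideal_quot) := qpi (- qrepr x).
Definition quot_mul (x y : ideal_quot) := qpi (qrepr x * qrepr y).

Lemma qpi_add x y : qpi (x + y) = quot_add (qpi x) (qpi y).
Proof.
have [_ hD _ _] := ideal_genP X.
apply/esym/qpiP; rewrite opprD addrACA; apply: hD; exact: qrepr_qpi.
Qed.
Lemma qpi_opp x : qpi (- x) = quot_opp (qpi x).
Proof.
have [_ _ hl _] := ideal_genP X.
by apply/esym/qpiP; rewrite -opprD -[X in ideal_gen _ X]mulN1r; apply: hl; exact: qrepr_qpi.
Qed.
Lemma qpi_mul x y : qpi (x * y) = quot_mul (qpi x) (qpi y).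
Proof.
have [_ hD hl hr] := ideal_genP X.
apply/esym/qpiP; set x' := qrepr _; set y' := qrepr _.
have -> : x' * y' - x * y = x' * (y' - y) + (x' - x) * y.
  by rewrite mulrBr mulrBl subrKA.
by apply: hD; [apply: hl|apply: hr]; exact: qrepr_qpi.
Qed.

Lemma quot_addA : associative quot_add.
Proof.
move=> x y z; rewrite -[x]qreprK -[y]qreprK -[z]qreprK -!qpi_add.
by rewrite addrA.
Qed.
Lemma quot_addC : commutative quot_add.
Proof. by move=> x y; rewrite /quot_add addrC. Qed.
Lemma quot_add0 : left_id (qpi 0) quot_add.
Proof. by move=> x; rewrite -[x]qreprK -qpi_add add0r. Qed.
Lemma quot_addN : left_inverse (qpi 0) quot_opp quot_add.
Proof. by move=> x; rewrite -[x]qreprK -qpi_opp -qpi_add addNr. Qed.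

HB.instance Definition _ :=
  GRing.isZmodule.Build ideal_quot quot_addA quot_addC quot_add0 quot_addN.

Lemma qpiD x y : qpi (x + y) = qpi x + qpi y.
Proof. exact: qpi_add. Qed.

Lemma quot_mulA : associative quot_mul.
Proof.
move=> x y z; rewrite -[x]qreprK -[y]qreprK -[z]qreprK -!qpi_mul.
by rewrite mulrA.
Qed.
Lemma quot_mul1l : left_id (qpi 1) quot_mul.
Proof. by move=> x; rewrite -[x]qreprK -qpi_mul mul1r. Qed.
Lemma quot_mul1r : right_id (qpi 1) quot_mul.
Proof. by move=> x; rewrite -[x]qreprK -qpi_mul mulr1. Qed.
Lemma quot_mulDl : left_distributive quot_mul +%R.
Proof.
move=> x y z; rewrite -[x]qreprK -[y]qreprK -[z]qreprK -qpiD -!qpi_mul.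
by rewrite mulrDl qpiD.
Qed.
Lemma quot_mulDr : right_distributive quot_mul +%R.
Proof.
move=> x y z; rewrite -[x]qreprK -[y]qreprK -[z]qreprK -qpiD -!qpi_mul.
by rewrite mulrDr qpiD.
Qed.

HB.instance Definition _ := GRing.Zmodule_isPzRing.Build ideal_quot
  quot_mulA quot_mul1l quot_mul1r quot_mulDl quot_mulDr.
End IdealQuotient.

(* Two-sided ideals are the usual ideals here, R being commutative.           *)
Definition noetherian (R : comPzRingType) : Prop :=
  forall I : set R, two_sided_ideal I -> exists s : seq R, I = ideal_gen [set` s].

Definition projective (A : pzRingType) (P : lmodType A) : Prop :=
  forall (M N : lmodType A) (g : {linear M -> N}) (f : {linear P -> N}),
    (forall y, exists x, g x = y) ->
    exists h : {linear P -> M}, forall x, g (h x) = f x.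

Record proj_resolution (A : pzRingType) (M : lmodType A) := ProjResolution {
  res_mod : nat -> lmodType A;
  res_diff : forall n, {linear res_mod n.+1 -> res_mod n};
  res_aug : {linear res_mod 0 -> M};
  res_proj : forall n, projective (res_mod n);
  res_aug_surj : forall y, exists x, res_aug x = y;
  res_exact0 : forall x, res_aug x = 0 <-> exists y, x = res_diff 0 y;
  res_exact : forall n x, res_diff n x = 0 <-> exists y, x = res_diff n.+1 y }.

Definition length_le (A : pzRingType) (M : lmodType A) (r : proj_resolution M)
    (n : nat) : Prop :=
  forall k, (n < k)%N -> forall x : res_mod r k, x = 0.

(* The least natural number satisfying P, or +oo when there is none.          *)
Definition least (P : nat -> Prop) : \bar int :=
  match pselect (exists n, `[< P n >]) with
  | left h => (ex_minn h)%:Z%:E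
  | right _ => +oo%E
  end.

(* The zero module has dimension 0 (rather than -oo).                         *)
Definition pdim (A : pzRingType) (M : lmodType A) : \bar int :=
  least (fun n => exists r : proj_resolution M, length_le r n).

(* The supremum of the projective dimensions of all left A-modules, as their  *)
(* least upper bound. The right global dimension of A is gldim A^c.           *)
Definition gldim (A : pzRingType) : \bar int :=
  least (fun n => forall M : lmodType A, (pdim M <= n%:Z%:E)%E).

Section RelativeFrobenius.
Variables (R S : comPzRingType) (iota : {rmorphism R -> S}).

Definition is_basis n (e : 'I_n -> S) : Prop :=
  forall s, exists! r : {ffun 'I_n -> R}, s = \sum_i iota (r i) * e i.

(* Elements of Hom_R(S, R); S acts on it by (s l) x = l (s * x).              *)
Definition is_hom (l : S -> R) : Prop :=
  (forall x y, l (x + y) = l x + l y) /\ (forall r x, l (iota r * x) = r * l x).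

Definition relative_frobenius n : Prop :=
  (exists e : 'I_n -> S, is_basis e) /\
  exists Phi : S -> S -> R,
    [/\ forall s, is_hom (Phi s),
        forall s t x, Phi (s + t) x = Phi s x + Phi t x,
        forall s t x, Phi (s * t) x = Phi t (s * x),
        injective Phi &
        forall l, is_hom l -> exists s, Phi s = l].

Definition is_generator (l : S -> R) : Prop :=
  is_hom l /\ forall m, is_hom m -> exists s, forall x, m x = l (s * x).

Local Notation B := (R * S)%type.

Definition bimM_sort : Type := S.
HB.instance Definition _ := GRing.Zmodule.on bimM_sort.
Definition bimM_lact (b : B) (m : bimM_sort) : bimM_sort := iota b.1 * (m : S).
Definition bimM_ract (m : bimM_sort) (b : B) : bimM_sort := (m : S) * b.2.

Lemma bimM_lactA b c m : bimM_lact b (bimM_lact c m) = bimM_lact (b * c) m.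
Proof. by rewrite /bimM_lact rmorphM mulrA. Qed.
Lemma bimM_lact1 : left_id 1 bimM_lact.
Proof. by move=> m; rewrite /bimM_lact rmorph1 mul1r. Qed.
Lemma bimM_lactDr : right_distributive bimM_lact +%R.
Proof. by move=> b m n; exact: mulrDr. Qed.
Lemma bimM_lactDl m : {morph bimM_lact^~ m : b c / b + c}.
Proof. by move=> b c; rewrite /bimM_lact rmorphD; exact: mulrDl. Qed.
HB.instance Definition _ := GRing.Zmodule_isLmodule.Build B bimM_sort
  bimM_lactA bimM_lact1 bimM_lactDr bimM_lactDl.

Lemma bimM_ractDl u v b : bimM_ract (u + v) b = bimM_ract u b + bimM_ract v b.
Proof. exact: mulrDl. Qed.
Lemma bimM_ractDr v b c : bimM_ract v (b + c) = bimM_ract v b + bimM_ract v c.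
Proof. exact: mulrDr. Qed.
Lemma bimM_ractM v b c : bimM_ract v (b * c) = bimM_ract (bimM_ract v b) c.
Proof. exact: mulrA. Qed.
Lemma bimM_ract1 v : bimM_ract v 1 = v.
Proof. exact: mulr1. Qed.
Lemma bimM_ractZ b v c : bimM_ract (b *: v) c = b *: bimM_ract v c.
Proof. by symmetry; exact: mulrA. Qed.

Definition bimM : bimodule B :=
  Bimodule bimM_ractDl bimM_ractDr bimM_ractM bimM_ract1 bimM_ractZ.

Definition bimN_sort : Type := S.
HB.instance Definition _ := GRing.Zmodule.on bimN_sort.
Definition bimN_lact (b : B) (m : bimN_sort) : bimN_sort := b.2 * (m : S).
Definition bimN_ract (m : bimN_sort) (b : B) : bimN_sort := (m : S) * iota b.1.

Lemma bimN_lactA b c m : bimN_lact b (bimN_lact c m) = bimN_lact (b * c) m.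
Proof. exact: mulrA. Qed.
Lemma bimN_lact1 : left_id 1 bimN_lact.
Proof. by move=> m; exact: mul1r. Qed.
Lemma bimN_lactDr : right_distributive bimN_lact +%R.
Proof. by move=> b m n; exact: mulrDr. Qed.
Lemma bimN_lactDl m : {morph bimN_lact^~ m : b c / b + c}.
Proof. by move=> b c; exact: mulrDl. Qed.
HB.instance Definition _ := GRing.Zmodule_isLmodule.Build B bimN_sort
  bimN_lactA bimN_lact1 bimN_lactDr bimN_lactDl.

Lemma bimN_ractDl u v b : bimN_ract (u + v) b = bimN_ract u b + bimN_ract v b.
Proof. exact: mulrDl. Qed.
Lemma bimN_ractDr v b c : bimN_ract v (b + c) = bimN_ract v b + bimN_ract v c.
Proof. by rewrite /bimN_ract rmorphD; exact: mulrDr. Qed.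
Lemma bimN_ractM v b c : bimN_ract v (b * c) = bimN_ract (bimN_ract v b) c.
Proof. by rewrite /bimN_ract rmorphM mulrA. Qed.
Lemma bimN_ract1 v : bimN_ract v 1 = v.
Proof. by rewrite /bimN_ract rmorph1 mulr1. Qed.
Lemma bimN_ractZ b v c : bimN_ract (b *: v) c = b *: bimN_ract v c.
Proof. by symmetry; exact: mulrA. Qed.

Definition bimN : bimodule B :=
  Bimodule bimN_ractDl bimN_ractDr bimN_ractM bimN_ract1 bimN_ractZ.

Definition preprojT : pzRingType := talg (bsum bimM bimN).
Definition inM (s : S) : preprojT := tinj1 (V := bsum bimM bimN) ((s : bimM), (0 : bimN)).
Definition inN (s : S) : preprojT := tinj1 (V := bsum bimM bimN) ((0 : bimM), (s : bimN)).

(* inM s * inN t is s (x) t in M (x) N, and inN s * inM t is s (x) t in       *)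
(* N (x) M.                                                                   *)
Definition preproj_rel n (e f : 'I_n -> S) : set preprojT :=
  [set inM 1 * inN 1; \sum_i inN (e i) * inM (f i)].

Definition preproj n (e f : 'I_n -> S) : pzRingType :=
  ideal_quot (preproj_rel e f).

End RelativeFrobenius.

(* Main.v *)
(* Write B = R x S. The algebra A = Pi_R(S) is the quotient of the tensor     *)
(* algebra of V = M + N over B by one central quadratic element w. Suppose    *)
(* that y |-> w y, from A to V (x) A (and, symmetrically, from A to A (x) V), *)
(* has a B-linear left inverse. Then A is projective over B, because V (x) A  *)
(* surjects onto the part of A of positive degree with a section, and for     *)
(* every A-module X the Koszul complex                                        *)
(*   0 -> A (x) X -> A (x) V (x) X -> A (x) X -> X -> 0                       *)
(* is exact. Hence pd_A X <= pd_B X + 2, and B-modules are pairs of an        *)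
(* R-module and an S-module.                                                  *)
(*   The left inverse comes from the corner e_R A e_R, generated by the       *)
(* X(s) = m(s) n(1) with X(1) = 0 and sum_i X(t e_i) X(f_i) = 0. A linear     *)
(* form on S that vanishes at 1 extends to an antiderivation of the corner,   *)
(* and the forms det(1, s, y, t y) in t yield divided powers of an operator   *)
(* that divides by X(x)^2 up to the factor det(1, x, y, x y). In rank 4 these *)
(* discriminants generate the unit ideal, so that y can be recovered from     *)
(* the family of the X(t) y. The anti-involution m(s) <-> n(s) of A transfers *)
(* this to the remaining corners.                                             *)

Require Import Defs.
From HB Require Import structures.
From mathcomp Require Import all_boot all_order all_algebra generic_quotient ring.
From mathcomp Require Import boolp classical_sets functions constructive_ereal.

Set Implicit Arguments.
Unset Strict Implicit.
Unset Printing Implicit Defensive.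

Import GRing.Theory.
Local Open Scope ring_scope.

(** * Projective resolutions *)

(** Put A = Pi_R(S), B = R x S and V = M + N ([arrows]). The two defining relations lie in different
    corners, so they amount to one element w of V (x) V ([casimir_word]). It commutes with B because
    the Casimir element sum_i e_i (x) f_i commutes with S ([casimir_shift]). [quad_alg] records what
    the homological argument uses: one central quadratic relation, a grading, and B-linear left
    inverses of y |-> w y and y |-> y w.

    Homological half. The left inverse on the left side splits the relations off V (x) A in each
    degree, which makes A projective over B ([A_left_projective]). For an A-module X the Koszul
    complex is exact ([kos0_exact], [kos1_exact], [kos2_inj], the last from the left inverse on the
    right side), so pd_A X <= 2 if X is projective over B ([koszul_pdex]). Shifting dimensions along
    A (x) P -> X, with Schanuel's lemma over B ([pdex_pdall]), gives pd_A X <= pd_B X + 2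
    ([restr_pdall_pdex]). A B-module is an R-module plus an S-module ([prod_ring_pdex]).

    Left inverses in rank 4. One has to recover e_R y from n(1) y, and e_S y from the m(f_i) y. The
    core is to recover y in e_R A e_R from the family X(t) y, where X(t) = m(t) n(1). A form on S
    that vanishes at 1 extends to an antiderivation ([contr]). For the forms t |-> det(1, s, y, t y)
    these combine into operators [dpow k] that commute with X(x)^2 up to det(1, x, y, x y) times
    [dpow] of index one less ([dpow_sq]). An alternating sum of them therefore divides by X(x)^2 up
    to a power of this discriminant ([sqdivK]), and for every exponent the powers of the
    discriminants generate the unit ideal ([discriminants_pow]).

    The reason for the last point: over a field where all det(1, x, y, x y) vanish, a rank 4 algebra
    with some det(1, x, y, z) invertible would be k + m with m^2 = 0 and dim m = 3. Its socle is too
    large for a Frobenius algebra. [chart_unit] runs this argument modulo an ideal.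

    The other corners are reached by [retE], [rhoH], [sig] and the anti-involution [tau], and
    everything is assembled in [retraction_ex]. [tau] also identifies A with its opposite, which
    settles the other side. *)

Section Homological.
Variable A : pzRingType.
Implicit Types K P Q M N : lmodType A.

Definition mklin M N (f : M -> N) (fl : linear f) : {linear M -> N} :=
  HB.pack_for {linear M -> N} f (GRing.isLinear.Build A M N *:%R f fl).

Lemma projectiveP P M N (g : {linear M -> N}) (f : {linear P -> N}) :
  projective P -> (forall y, exists x, g x = y) ->
  exists h : {linear P -> M}, forall x, g (h x) = f x.
Proof. by move=> Pp gs; exact: Pp. Qed.

Definition ses K P M : Prop :=
  exists (i : {linear K -> P}) (p : {linear P -> M}),
    [/\ injective i, forall y, exists x, p x = y &
        forall x, p x = 0 <-> exists k, x = i k].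

Definition liso M N : Prop :=
  exists (f : {linear M -> N}) (g : {linear N -> M}), cancel f g /\ cancel g f.

(** Projective dimension through syzygies: [pdex] asks for one chain of n syzygies ending in a
    projective module, [pdall] asks that every such chain does. By Schanuel the first implies the
    second. *)
Fixpoint pdex n M : Prop :=
  if n is m.+1 then exists K P, [/\ projective P, ses K P M & pdex m K]
  else projective M.

Fixpoint pdall n M : Prop :=
  if n is m.+1 then forall K P, projective P -> ses K P M -> pdall m K
  else projective M.

Lemma liso_sym M N : liso M N -> liso N M.
Proof. by move=> [f [g [fg gf]]]; exists g, f. Qed.

Lemma bij_liso M N (f : {linear M -> N}) :
  injective f -> (forall y, exists x, f x = y) -> liso M N.
Proof.
move=> fi fs; pose g y := sval (cid (fs y)).
have fg y : f (g y) = y by rewrite /g; case: cid.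
have gl : linear g by move=> a x y; apply: fi; rewrite linearP !fg.
by exists f, (mklin gl); split => // x; apply: fi; exact: fg.
Qed.

Lemma projective_retract M P (f : {linear M -> P}) (g : {linear P -> M}) :
  cancel f g -> projective P -> projective M.
Proof.
move=> fg Pp X Y q u qs.
have [h hP] := Pp X Y q (u \o g : {linear P -> Y}) qs.
by exists (h \o f : {linear M -> X}) => x; rewrite /= hP /= fg.
Qed.

Lemma projective_liso M P : liso M P -> projective P -> projective M.
Proof. by move=> [f [g [fg _]]]; exact: projective_retract fg. Qed.

Lemma pair_linear M N P (f : {linear M -> N}) (g : {linear M -> P}) :
  linear (fun x => (f x, g x)).
Proof. by move=> a x y; rewrite !linearP. Qed.

Lemma inl_linear M N : linear (fun x : M => (x, 0 : N)).
Proof. by move=> a x y; apply/eqP; rewrite xpair_eqE /= scaler0 addr0 !eqxx. Qed.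

Lemma inr_linear M N : linear (fun x : N => (0 : M, x)).
Proof. by move=> a x y; apply/eqP; rewrite xpair_eqE /= scaler0 addr0 !eqxx. Qed.

Lemma projective_prod P Q : projective P -> projective Q -> projective (P * Q)%type.
Proof.
move=> Pp Qp X Y g f gs.
have [h hP] := Pp X Y g (f \o mklin (@inl_linear P Q) : {linear P -> Y}) gs.
have [k kP] := Qp X Y g (f \o mklin (@inr_linear P Q) : {linear Q -> Y}) gs.
exists ((h \o fst) \+ (k \o snd) : {linear (P * Q)%type -> X}) => -[x y] /=.
rewrite linearD hP kP /= -linearD; congr (f _).
by apply/eqP; rewrite xpair_eqE /= addr0 add0r !eqxx.
Qed.

Lemma kernel_lift K P M (X : lmodType A) (i : {linear K -> P}) (p : {linear P -> M})
    (u : {linear X -> P}) :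
  injective i -> (forall x, p x = 0 -> exists k, x = i k) ->
  (forall x, p (u x) = 0) ->
  exists v : {linear X -> K}, forall x, i (v x) = u x.
Proof.
move=> ii ip pu; pose v x := sval (cid (ip _ (pu x))).
have iv x : i (v x) = u x by rewrite /v; case: cid.
have vl : linear v by move=> a x y; apply: ii; rewrite iv !linearP !iv.
by exists (mklin vl).
Qed.

(** Both products are the fibre product of P and P' over M. The lifts [al] and [be] of the two
    surjections through each other give mutually inverse maps. *)
Lemma schanuel K P K' P' M : projective P -> projective P' ->
  ses K P M -> ses K' P' M -> liso (K * P')%type (K' * P)%type.
Proof.
move=> Pp Pp' [i [p [ii ps pk]]] [i' [p' [ii' ps' pk']]].
have [al alP] := projectiveP p Pp ps'.
have [be beP] := projectiveP p' Pp' ps.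
have pi k : p (i k) = 0 by apply/pk; exists k.
have pi' k : p' (i' k) = 0 by apply/pk'; exists k.
pose z : {linear (K * P')%type -> P} := (i \o fst) \+ (be \o snd).
pose u : {linear (K * P')%type -> P'} := snd \- (al \o z).
have pu x : p' (u x) = 0.
  by rewrite linearB alP /= linearD pi add0r beP subrr.
have [v vP] := kernel_lift ii' (fun x => (pk' x).1) pu.
pose z' : {linear (K' * P)%type -> P'} := (i' \o fst) \+ (al \o snd).
pose u' : {linear (K' * P)%type -> P} := snd \- (be \o z').
have pu' x : p (u' x) = 0.
  by rewrite linearB beP /= linearD pi' add0r alP subrr.
have [v' vP'] := kernel_lift ii (fun x => (pk x).1) pu'.
exists (mklin (pair_linear v z)), (mklin (pair_linear v' z')).
split=> -[x y] /=.
  have e : z' (v (x, y), z (x, y)) = y by rewrite /= vP /= subrK.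
  congr (_, _); last exact: e.
  apply: ii; rewrite vP'.
  by rewrite -[LHS]/(z (x, y) - be (z' (v (x, y), z (x, y)))) e /= addrK.
have e : z (v' (x, y), z' (x, y)) = y by rewrite /= vP' /= subrK.
congr (_, _); last exact: e.
apply: ii'; rewrite vP.
by rewrite -[LHS]/(z' (x, y) - al (z (v' (x, y), z' (x, y)))) e /= addrK.
Qed.

Lemma ses_liso K P M N : liso M N -> ses K P M -> ses K P N.
Proof.
move=> [f [g [fg gf]]] [i [p [ii ps pk]]].
exists i, (f \o p : {linear P -> N}); split=> // [y|x] /=.
  by have [x xy] := ps (g y); exists x; rewrite xy gf.
rewrite -pk; split=> [h|->]; last exact: linear0.
by rewrite -[p x]fg h linear0.
Qed.

Lemma ses_prod K P M Q : ses K P M -> ses K (P * Q)%type (M * Q)%type.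
Proof.
move=> [i [p [ii ps pk]]].
have pl : linear (fun x : P * Q => (p x.1, x.2)).
  by move=> a x y; rewrite linearP.
exists (mklin (@inl_linear P Q) \o i : {linear K -> _}), (mklin pl).
split=> [x y [/ii]//|[y q]|[x q]] /=.
  by have [x <-] := ps y; exists (x, q).
split=> [[/pk[k ->] ->]|[k [-> ->]]]; first by exists k.
by congr (_, _); apply/pk; exists k.
Qed.

(** Syzygies are unique only up to projective summands; this is the relation that the induction in
    [pdex_pdall] preserves. *)
Definition stable_iso M N : Prop :=
  exists P Q, [/\ projective P, projective Q & liso (M * P)%type (N * Q)%type].

Lemma pdex_pdall n M N : stable_iso M N -> pdex n M -> pdall n N.
Proof.
elim: n M N => [|n IH] M N [P [Q [Pp Qp MN]]] /=.
  move=> Mp; have NQ := projective_liso (liso_sym MN) (projective_prod Mp Pp).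
  by apply: (@projective_retract N _ (mklin (@inl_linear N Q)) fst).
move=> [K [X [Xp sX Kn]]] K' X' Xp' sX'; apply: IH Kn.
exists (X' * Q)%type, (X * P)%type; split; try exact: projective_prod.
by apply: schanuel (ses_liso MN (ses_prod P sX)) (ses_prod Q sX');
  exact: projective_prod.
Qed.

Lemma liso_refl M : liso M M.
Proof. by exists idfun, idfun. Qed.

End Homological.

Section Kernel.
Variables (A : pzRingType) (M N : lmodType A) (f : {linear M -> N}).

Definition mker_pred : pred M := fun x => f x == 0.
Lemma mker_closed : submod_closed mker_pred.
Proof.
split=> [|a x y]; rewrite !unfold_in ?linear0 // => /eqP fx /eqP fy.
by rewrite linearP fx fy scaler0 addr0.
Qed.
HB.instance Definition _ := GRing.isSubmodClosed.Build A M mker_pred mker_closed.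

Record mker := Mker { mker_val : M; mker_valP : mker_val \in mker_pred }.
HB.instance Definition _ := [isSub for mker_val].
HB.instance Definition _ := [Choice of mker by <:].
HB.instance Definition _ := [SubChoice_isSubLmodule of mker by <:].

Lemma mker_eq0 (x : mker) : f (val x) = 0.
Proof. exact/eqP/(valP x). Qed.
Lemma mker_in x : f x = 0 -> exists k : mker, x = val k.
Proof. by move=> /eqP fx; exists (Mker fx). Qed.
Lemma ses_mker : (forall y, exists x, f x = y) -> ses mker M N.
Proof.
move=> fs; exists (val : {linear mker -> M}), f; split=> //.
by move=> x; split=> [/mker_in//|[k ->]]; exact: mker_eq0.
Qed.
End Kernel.

Section Resolutions.
Variable A : pzRingType.
Implicit Types M : lmodType A.

Lemma length_leW M (r : proj_resolution M) m n :
  (m <= n)%N -> length_le r m -> length_le r n.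
Proof. by move=> mn h k nk; apply: h; exact: leq_ltn_trans nk. Qed.

(** Deleting the term in degree 0 leaves a resolution of the kernel of the augmentation, shorter by
    one. *)
Lemma resolution_pdex n M (r : proj_resolution M) : length_le r n -> pdex n M.
Proof.
elim: n M r => [|n IH] M r rn /=.
  apply: (projective_liso _ (@res_proj _ _ r 0)); apply: liso_sym.
  apply: (bij_liso (f := res_aug r)); last exact: res_aug_surj.
  move=> x y /eqP; rewrite -subr_eq0 -linearB => /eqP/(@res_exact0 _ _ r)[z xy].
  by apply/eqP; rewrite -subr_eq0 xy (rn 1%N _ z) // linear0.
exists (mker (res_aug r)), (res_mod r 0); split; first exact: res_proj.
  exact/ses_mker/res_aug_surj.
have ra x : res_aug r (res_diff r 0 x) = 0 by apply/(@res_exact0 _ _ r); exists x.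
have [v vP] := @kernel_lift A _ _ _ _ (val : {linear mker (res_aug r) -> _})
  (res_aug r) (res_diff r 0) val_inj (@mker_in _ _ _ (res_aug r)) ra.
have r1 (y : mker (res_aug r)) : exists x, v x = y.
  have /(@res_exact0 _ _ r)[x yx] := mker_eq0 y.
  by exists x; apply: val_inj; rewrite vP.
have r2 x : v x = 0 <-> exists y, x = res_diff r 1 y.
  by rewrite -(@res_exact _ _ r 0) -vP; split=> [->|h]; [exact: linear0|exact: val_inj].
apply: (IH _ (@ProjResolution A _ (fun k => res_mod r k.+1)
  (fun k => res_diff r k.+1) v (fun k => @res_proj _ _ r k.+1) r1 r2
  (fun k => @res_exact _ _ r k.+1))) => k nk x.
exact: (rn k.+1).
Qed.

Lemma pdex_resolution n M : pdex n M ->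
  exists r : proj_resolution M, length_le r n.
Proof.
elim: n M => [|n IH] M /=.
  (* The kernel of the identity serves as the zero module that fills the resolution in positive
     degrees. *)
  move=> Mp; pose Z := mker (idfun : {linear M -> M}).
  have Z0 (x : Z) : x = 0 by apply: val_inj; exact: (mker_eq0 x).
  have Zp : projective Z.
    by move=> X Y g u _; exists \0 => x; rewrite [x]Z0 !linear0.
  pose md k : lmodType A := if k is 0 then M else Z.
  pose df k : {linear md k.+1 -> md k} := \0.
  have mp k : projective (md k) by case: k.
  have r0 (x : md 0%N) : x = 0 <-> exists y, x = df 0%N y.
    by split=> [->|[y ->] //]; exists 0.
  have re k (x : md k.+1) : df k x = 0 <-> exists y, x = df k.+1 y.
    by split=> // _; exists 0; rewrite [x]Z0.
  exists (@ProjResolution A M md df idfun mp (fun y => ex_intro _ y erefl) r0 re).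
  by case.
move=> [K [P [Pp [i [p [ii ps pk]]] /IH[r rn]]]].
pose md k : lmodType A := if k is j.+1 then res_mod r j else P.
pose df k : {linear md k.+1 -> md k} :=
  match k with 0%N => i \o res_aug r | j.+1 => res_diff r j end.
have mp k : projective (md k) by case: k => //= j; exact: res_proj.
have r0 (x : md 0%N) : p x = 0 <-> exists y, x = df 0%N y.
  rewrite pk; split=> -[y ->]; last by exists (res_aug r y).
  by have [z <-] := res_aug_surj r y; exists z.
have re k (x : md k.+1) : df k x = 0 <-> exists y, x = df k.+1 y.
  case: k x => [|k] x; last exact: res_exact.
  rewrite -(@res_exact0 _ _ r) /=; split=> [h|->]; last exact: linear0.
  by apply: ii; rewrite h linear0.
exists (@ProjResolution A M md df p mp ps r0 re) => -[|k] //.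
by rewrite ltnS; exact: rn.
Qed.

Lemma least_leP (Q : nat -> Prop) n :
  (least Q <= n%:Z%:E)%E <-> exists2 m, (m <= n)%N & Q m.
Proof.
rewrite /least; case: pselect => [h|h]; last first.
  split=> [|[m _ Qm]]; first by rewrite leye_eq.
  by case: h; exists m; apply/asboolP.
rewrite lee_fin lez_nat; case: ex_minnP => m /asboolP Qm mmin; split=> [mn|[k kn Qk]].
  by exists m.
by apply: leq_trans kn; apply: mmin; exact/asboolP.
Qed.

Lemma pdim_leP n M : (pdim M <= n%:Z%:E)%E <-> pdex n M.
Proof.
rewrite least_leP; split=> [[m mn [r rm]]|/pdex_resolution[r rn]].
  exact/resolution_pdex/(length_leW mn rm).
by exists n => //; exists r.
Qed.

Lemma gldim_leP n : (gldim A <= n%:Z%:E)%E <-> forall M, pdex n M.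
Proof.
rewrite least_leP; split=> [[m mn h] M|h]; last first.
  by exists n => // M; exact/pdim_leP.
by apply/pdim_leP; apply: Order.POrderTheory.le_trans (h M) _; rewrite lee_fin lez_nat.
Qed.

End Resolutions.

(** * Actions of tensor algebras *)

Definition restr_scalars (B A : pzRingType) (phi : {rmorphism B -> A}) (M : lmodType A) :
  Type := M.

Section RestrictionOfScalars.
Variables (B A : pzRingType) (phi : {rmorphism B -> A}) (M : lmodType A).
Local Notation rs := (restr_scalars phi M).

HB.instance Definition _ := GRing.Zmodule.on rs.
Definition rs_scale (b : B) (m : rs) : rs := phi b *: (m : M).

Lemma rs_scaleA b c m : rs_scale b (rs_scale c m) = rs_scale (b * c) m.
Proof. by rewrite /rs_scale scalerA rmorphM. Qed.
Lemma rs_scale1 : left_id 1 rs_scale.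
Proof. by move=> m; rewrite /rs_scale rmorph1 scale1r. Qed.
Lemma rs_scaleDr : right_distributive rs_scale +%R.
Proof. by move=> b m n; exact: scalerDr. Qed.
Lemma rs_scaleDl m : {morph rs_scale^~ m : b c / b + c}.
Proof. by move=> b c; rewrite /rs_scale rmorphD; exact: scalerDl. Qed.
HB.instance Definition _ := GRing.Zmodule_isLmodule.Build B rs
  rs_scaleA rs_scale1 rs_scaleDr rs_scaleDl.

Lemma rsE (b : B) (m : rs) : b *: m = (phi b *: (m : M) : M).
Proof. by []. Qed.
End RestrictionOfScalars.

Section TensorAction.
Variables (B : pzRingType) (V : bimodule B).

(** A B-linear map V (x) Z -> Z in balanced form. By the universal property of the tensor algebra it
    is the same as an action of [talg V] extending that of B; [tact] is this action. *)
Record vact (Z : lmodType B) := VAct {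
  vfun :> V -> Z -> Z;
  vactDl : forall u v z, vfun (u + v) z = vfun u z + vfun v z;
  vactDr : forall v y z, vfun v (y + z) = vfun v y + vfun v z;
  vactA : forall v b z, vfun (ract v b) z = vfun v (b *: z);
  vactZ : forall b v z, vfun (b *: v) z = b *: vfun v z }.

Section Act.
Variables (Z : lmodType B) (al : vact Z).

Lemma vact0r v : al v 0 = 0.
Proof. by apply: (addrI (al v 0)); rewrite -vactDr !addr0. Qed.
Fixpoint tpa (n : nat) : tpow V n -> Z -> Z :=
  if n is m.+1 then fun t z => tlift (fun v t' => al v (tpa t' z)) t
  else fun (b : B) z => b *: z.

Lemma tpa_spec n :
  [/\ forall (s t : tpow V n) z, tpa (s + t) z = tpa s z + tpa t z,
      forall b (t : tpow V n) z, tpa (b *: t) z = b *: tpa t z &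
      forall v (t : tpow V n) z,
        tpa (tens v t : tpow V n.+1) z = al v (tpa t z)].
Proof.
have step m (hD : forall (s t : tpow V m) z, tpa (s + t) z = tpa s z + tpa t z)
    (hZ : forall b (t : tpow V m) z, tpa (b *: t) z = b *: tpa t z) z :
  let f v (t : tpow V m) := al v (tpa t z) in
  [/\ forall u v w, f (u + v) w = f u w + f v w,
      forall v w w', f v (w + w') = f v w + f v w' &
      forall v b w, f (ract v b) w = f v (b *: w)].
  move=> f; split=> [u v w|v w w'|v b w]; rewrite /f.
  - exact: vactDl.
  - by rewrite hD vactDr.
  - by rewrite hZ vactA.
elim: n => [|n [hD hZ hT]].
  have hD (s t : tpow V 0) z : tpa (s + t) z = tpa s z + tpa t z.
    exact: scalerDl.
  have hZ b (t : tpow V 0) z : tpa (b *: t) z = b *: tpa t z.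
    by rewrite /= scalerA.
  split=> // v t z; have [? ? ?] := step 0%N hD hZ z; exact: tlift_tens.
have hD' (s t : tpow V n.+1) z : tpa (s + t) z = tpa s z + tpa t z.
  by have [? ? ?] := step n hD hZ z; exact: tliftD.
have hZ' b (t : tpow V n.+1) z : tpa (b *: t) z = b *: tpa t z.
  elim/tensor_ind: t => [|s t IHs IHt|v t].
  - by have [? ? ?] := step n hD hZ z; rewrite scaler0 /= tlift0 // scaler0.
  - by rewrite scalerDr !hD' scalerDr IHs IHt.
  - by rewrite scale_tens !hT vactZ.
split=> // v t z; have [? ? ?] := step n.+1 hD' hZ' z; exact: tlift_tens.
Qed.

Lemma tpaDl n (s t : tpow V n) z : tpa (s + t) z = tpa s z + tpa t z.
Proof. by have [-> _ _] := tpa_spec n. Qed.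
Lemma tpaZ n b (t : tpow V n) z : tpa (b *: t) z = b *: tpa t z.
Proof. by have [_ -> _] := tpa_spec n. Qed.
Lemma tpa_tens n v (t : tpow V n) z :
  tpa (tens v t : tpow V n.+1) z = al v (tpa t z).
Proof. by have [_ _ ->] := tpa_spec n. Qed.
Lemma tpa0l n z : tpa (0 : tpow V n) z = 0.
Proof. by apply: (addrI (tpa (0 : tpow V n) z)); rewrite -tpaDl !addr0. Qed.

Lemma tpaDr n (t : tpow V n) y z : tpa t (y + z) = tpa t y + tpa t z.
Proof.
elim/tpow_ind: n / t => [n|n s t IHs IHt|b|n v t IH].
- by rewrite !tpa0l addr0.
- by rewrite !tpaDl IHs IHt addrACA.
- exact: scalerDr.
- by rewrite !tpa_tens IH vactDr.
Qed.

Definition tact (x : talg V) (z : Z) : Z := \sum_(n < talg_deg x) tpa (x n) z.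

Lemma tactE N (x : talg V) z : (forall n, (N <= n)%N -> x n = 0) ->
  tact x z = \sum_(n < N) tpa (x n) z.
Proof.
have aux M M' : (M <= M')%N -> (forall n, (M <= n)%N -> x n = 0) ->
    \sum_(n < M') tpa (x n) z = \sum_(n < M) tpa (x n) z.
  move=> leM hM; rewrite -(subnKC leM) big_split_ord /= [X in _ + X]big1 ?addr0 //.
  by move=> i _; rewrite hM ?leq_addr // tpa0l.
move=> hN; rewrite /tact; have hD := svalP (cid (tcompP x)).
rewrite -(aux _ (maxn N (talg_deg x)) (leq_maxr _ _) hD).
exact: aux (leq_maxl _ _) hN.
Qed.

Lemma tactDl x y z : tact (x + y) z = tact x z + tact y z.
Proof.
have [N h] := tcompP x; have [M k] := tcompP y.
have h' n : (maxn N M <= n)%N -> x n = 0 by rewrite geq_max => /andP[/h].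
have k' n : (maxn N M <= n)%N -> y n = 0 by rewrite geq_max => /andP[_ /k].
rewrite (tactE z h') (tactE z k') -big_split /=.
rewrite (@tactE (maxn N M)); last by move=> n l; rewrite tcompD h' ?k' ?addr0.
by apply: eq_bigr => i _; rewrite tcompD tpaDl.
Qed.

Lemma tactDr x y z : tact x (y + z) = tact x y + tact x z.
Proof. by rewrite /tact -big_split; apply: eq_bigr => i _; rewrite tpaDr. Qed.

Lemma tact0l z : tact 0 z = 0.
Proof. by apply: (addrI (tact 0 z)); rewrite -tactDl !addr0. Qed.
Lemma tact0r x : tact x 0 = 0.
Proof. by apply: (addrI (tact x 0)); rewrite -tactDr !addr0. Qed.

Lemma tact_lscale b x z : tact (lscale b x) z = b *: tact x z.
Proof.
have [N h] := tcompP x; rewrite (tactE z h) (@tactE N); last first.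
  by move=> n /h /= ->; rewrite scaler0.
by rewrite scaler_sumr; apply: eq_bigr => i _; rewrite -tpaZ.
Qed.

Lemma tact_lshift v x z : tact (Defs.lshift v x) z = al v (tact x z).
Proof.
have [N h] := tcompP x; rewrite (tactE z h) (@tactE N.+1); last first.
  by case=> // n; rewrite ltnS /= => /h ->; exact: tens0r.
rewrite big_ord_recl tpa0l add0r.
rewrite (big_morph (al v) (vactDr al v) (vact0r v)).
by apply: eq_bigr => i _; rewrite -tpa_tens.
Qed.

Lemma tact_mul_hom n (t : tpow V n) y z : tact (tmul_hom t y) z = tpa t (tact y z).
Proof.
elim/tpow_ind: n / t => [n|n s t IHs IHt|b|n v t IH].
- by rewrite tmul_hom0 tpa0l tact0l.
- by rewrite tmul_homDl tactDl tpaDl IHs IHt.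
- exact: tact_lscale.
- by rewrite tmul_hom_tens tpa_tens tact_lshift IH.
Qed.

Lemma tactM x y z : tact (x * y) z = tact x (tact y z).
Proof.
rewrite /GRing.mul /= /talg_mul.
rewrite (big_morph (tact^~ z) (fun a b => tactDl a b z) (tact0l z)).
by apply: eq_bigr => i _; exact: tact_mul_hom.
Qed.

Lemma tact_tinj0 b z : tact (tinj0 V b) z = b *: z.
Proof. by rewrite (@tactE 1) ?big_ord1 //; case. Qed.
Lemma tact_tinj1 v z : tact (tinj1 v) z = al v z.
Proof. by rewrite tact_lshift tact_tinj0 scale1r. Qed.
Lemma tact1 z : tact 1 z = z.
Proof. by rewrite -[LHS]/(tact (tinj0 V 1) z) tact_tinj0 scale1r. Qed.

End Act.

Lemma lshiftE (v : V) (x : talg V) : Defs.lshift v x = tinj1 v * x.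
Proof. by rewrite [RHS]lshift_mul talg_mul1l. Qed.

(** Every element is a sum of words, and words are built by prefixing arrows to elements of B. This
    one-sided induction drives all later arguments on the quotient. *)
Lemma talg_ind (P : talg V -> Prop) :
    (forall x y, P x -> P y -> P (x + y)) -> (forall b, P (tinj0 V b)) ->
    (forall v x, P x -> P (tinj1 v * x)) ->
  forall x, P x.
Proof.
move=> PD P0 PV x.
have P00 : P 0.
  suff -> : 0 = tinj0 V 0 by exact: P0.
  by apply: talgP => -[|n].
have PT n (t : tpow V n) : P (tmul_hom t 1).
  elim/tpow_ind: n / t => [n|n s t IHs IHt|b|n v t IH].
  - by rewrite tmul_hom0.
  - by rewrite tmul_homDl; exact: PD.
  - suff -> : tmul_hom (b : tpow V 0) 1 = tinj0 V b by exact: P0.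
    by apply: talgP => -[|n] /=; [exact: mulr1|exact: scaler0].
  - by rewrite tmul_hom_tens lshiftE; exact: PV.
by rewrite -[x]mulr1 /GRing.mul /= /talg_mul; elim/big_ind: _.
Qed.

Section Quotient.
Variable X : set (talg V).
Let A : pzRingType := ideal_quot X.

Lemma qpiM (x y : talg V) : qpi X (x * y) = qpi X x * qpi X y.
Proof. exact: qpi_mul. Qed.
Lemma qpi1 : qpi X 1 = 1.
Proof. by []. Qed.
Lemma qpi0 : qpi X 0 = 0.
Proof. by []. Qed.
Lemma qpi_rel x : X x -> qpi X x = 0.
Proof.
move=> Xx; rewrite -qpi0; apply/qpiP; rewrite subr0 => I _; exact.
Qed.

Definition jb (b : B) : A := qpi X (tinj0 V b).
Definition jv (v : V) : A := qpi X (tinj1 v).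

Lemma jb_zmod_morphism : zmod_morphism jb.
Proof.
move=> b c; rewrite /jb -[- qpi _ _]qpi_opp -qpiD.
by congr qpi; apply: talgP => -[|n] //; rewrite tcompD /= subr0.
Qed.
Lemma jb_monoid_morphism : monoid_morphism jb.
Proof.
split=> // b c; rewrite /jb -qpiM; congr qpi; apply: talgP => n.
rewrite -[RHS]/(talg_mul _ _ n) (@talg_mulE _ _ 1); last by case.
by rewrite big_ord1; case: n => [|n] //=; rewrite scaler0.
Qed.
HB.instance Definition _ := GRing.isZmodMorphism.Build B A jb jb_zmod_morphism.
HB.instance Definition _ := GRing.isMonoidMorphism.Build B A jb jb_monoid_morphism.

Lemma jvD u v : jv (u + v) = jv u + jv v.
Proof. by rewrite /jv -qpiD; congr qpi; exact: lshiftDl. Qed.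
Lemma jv_ract v b : jv (ract v b) = jv v * jb b.
Proof.
rewrite /jv /jb -qpiM; congr qpi; rewrite /tinj1 lshift_ract [RHS]lshift_mul.
rewrite talg_mul1l; congr Defs.lshift.
by apply: talgP => -[|n] /=; rewrite ?scaler0 //; exact: mulr1.
Qed.
Lemma jvZ b v : jv (b *: v) = jb b * jv v.
Proof.
rewrite /jv /jb -qpiM; congr qpi; rewrite /tinj1 -lscale_lshift.
rewrite -[RHS]/(talg_mul (tinj0 V b) _) (@talg_mulE _ _ 1); last by case.
by rewrite big_ord1.
Qed.

Lemma quot_ind (P : A -> Prop) :
    (forall x y, P x -> P y -> P (x + y)) -> (forall b, P (jb b)) ->
    (forall v x, P x -> P (jv v * x)) ->
  forall x, P x.
Proof.
move=> PD P0 PV x; rewrite -[x]qreprK; move: (qrepr x); apply: talg_ind => //.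
- by move=> y z; rewrite qpiD; exact: PD.
- by move=> v y; rewrite qpiM; exact: PV.
Qed.

Record qmod (Z : lmodType B) := QMod {
  qvact :> vact Z;
  qmod_rel : forall x, X x -> forall z, tact qvact x z = 0 }.

Section QAct.
Variables (Z : lmodType B) (al : qmod Z).

Definition qact (a : A) (z : Z) : Z := tact al (qrepr a) z.

Lemma tact_ideal x z : ideal_gen X x -> tact al x z = 0.
Proof.
pose I : set (talg V) := fun y => forall z, tact al y z = 0.
suff idI : two_sided_ideal I.
  by move=> /(_ I idI); apply => y Xy u; exact: qmod_rel.
split=> [u|y y' Iy Iy' u|a y Iy u|a y Iy u]; rewrite ?tact0l ?tactM //.
- by rewrite tactDl Iy Iy' addr0.
- by rewrite Iy tact0r.
Qed.

Lemma qact_qpi x z : qact (qpi X x) z = tact al x z.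
Proof.
apply/eqP; rewrite -subr_eq0; apply/eqP.
rewrite -(tact_ideal z (@qrepr_qpi _ X x)) tactDl; congr (_ + _).
by apply: (addrI (tact al x z)); rewrite -tactDl !subrr tact0l.
Qed.

Lemma qactDl a b z : qact (a + b) z = qact a z + qact b z.
Proof. by rewrite -[a]qreprK -[b]qreprK -qpiD !qact_qpi tactDl. Qed.
Lemma qactDr a y z : qact a (y + z) = qact a y + qact a z.
Proof. exact: tactDr. Qed.
Lemma qactM a b z : qact (a * b) z = qact a (qact b z).
Proof. by rewrite -[a]qreprK -[b]qreprK -qpiM !qact_qpi tactM. Qed.
Lemma qact_jb b z : qact (jb b) z = b *: z.
Proof. by rewrite qact_qpi tact_tinj0. Qed.
Lemma qact_jv v z : qact (jv v) z = al v z.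
Proof. by rewrite qact_qpi tact_tinj1. Qed.
End QAct.

End Quotient.
End TensorAction.

(** * Tensor products and quotients of modules *)

Section HomModule.
Variables (B : pzRingType) (U : bimodule B).

Section Carrier.
Variable N : lmodType B.

(** Hom_B(U, N), made a left B-module through the right action on U: the right adjoint of the
    functor U (x) -. *)
Record homB := HomB {
  hb :> U -> N;
  hbD : forall u v, hb (u + v) = hb u + hb v;
  hbZ : forall b u, hb (b *: u) = b *: hb u }.

Lemma homBP (x y : homB) : (forall u, x u = y u) -> x = y.
Proof.
case: x y => [x xD xZ] [y yD yZ] /= xy; have {}xy : x = y by apply/funext.
by subst y; congr HomB; exact: Prop_irrelevance.
Qed.

HB.instance Definition _ := gen_eqMixin homB.
HB.instance Definition _ := gen_choiceMixin homB.

Definition homB0 : homB.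
refine (@HomB (fun=> 0) _ _).
- by move=> u v; rewrite addr0.
- by move=> b u; rewrite scaler0.
Defined.
Definition homB_opp (x : homB) : homB.
refine (@HomB (fun u => - x u) _ _).
- by move=> u v; rewrite hbD opprD.
- by move=> b u; rewrite hbZ scalerN.
Defined.
Definition homB_add (x y : homB) : homB.
refine (@HomB (fun u => x u + y u) _ _).
- by move=> u v; rewrite !hbD addrACA.
- by move=> b u; rewrite !hbZ scalerDr.
Defined.
Definition homB_scale (b : B) (x : homB) : homB.
refine (@HomB (fun u => x (ract u b)) _ _).
- by move=> u v; rewrite ractDl hbD.
- by move=> c u; rewrite ractZ hbZ.
Defined.

Lemma homB_addA : associative homB_add.
Proof. by move=> x y z; apply: homBP => u /=; rewrite addrA. Qed.
Lemma homB_addC : commutative homB_add.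
Proof. by move=> x y; apply: homBP => u /=; rewrite addrC. Qed.
Lemma homB_add0 : left_id homB0 homB_add.
Proof. by move=> x; apply: homBP => u /=; rewrite add0r. Qed.
Lemma homB_addN : left_inverse homB0 homB_opp homB_add.
Proof. by move=> x; apply: homBP => u /=; rewrite addNr. Qed.
HB.instance Definition _ :=
  GRing.isZmodule.Build homB homB_addA homB_addC homB_add0 homB_addN.

Lemma homB_scaleA b c x : homB_scale b (homB_scale c x) = homB_scale (b * c) x.
Proof. by apply: homBP => u /=; rewrite ractM. Qed.
Lemma homB_scale1 : left_id 1 homB_scale.
Proof. by move=> x; apply: homBP => u /=; rewrite ract1. Qed.
Lemma homB_scaleDr : right_distributive homB_scale +%R.
Proof. by move=> b x y; apply: homBP. Qed.
Lemma homB_scaleDl x : {morph homB_scale^~ x : b c / b + c}.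
Proof. by move=> b c; apply: homBP => u /=; rewrite ractDr hbD. Qed.
HB.instance Definition _ := GRing.Zmodule_isLmodule.Build B homB
  homB_scaleA homB_scale1 homB_scaleDr homB_scaleDl.

Lemma homB_linear (x : homB) : linear x.
Proof. by move=> b u v; rewrite hbD hbZ. Qed.
End Carrier.

Hypothesis U_proj : projective U.

Lemma homB_map_ex (M N : lmodType B) (g : {linear M -> N}) :
  (forall y, exists x, g x = y) ->
  exists G : {linear homB M -> homB N},
    (forall x u, G x u = g (x u)) /\ forall y, exists x, G x = y.
Proof.
move=> gs; pose G (x : homB M) : homB N :=
  @HomB N (fun u => g (x u))
    (fun u v => etrans (congr1 g (hbD x u v)) (linearD g _ _))
    (fun b u => etrans (congr1 g (hbZ x b u)) (linearZ_LR g b _)).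
have Gl : linear G.
  by move=> b x y; apply: homBP => u; exact: (linearD g).
exists (mklin Gl); split=> // y.
have [h hE] := U_proj (mklin (homB_linear y)) gs.
exists (@HomB M h (linearD h) (linearZ_LR h)).
by apply: homBP => u; exact: hE.
Qed.

Lemma homB_lift (X M N : lmodType B) (g : {linear M -> N}) (f : {linear X -> homB N}) :
  projective X -> (forall y, exists x, g x = y) ->
  exists h : {linear X -> homB M}, forall x u, g (h x u) = f x u.
Proof.
move=> Xp /homB_map_ex[G [GE Gs]].
have [h hE] := Xp _ _ G f Gs.
by exists h => x u; rewrite -GE hE.
Qed.

(** By adjunction, lifting from U (x) X is lifting from X along Hom(U, M) -> Hom(U, N), which is
    onto because U is projective as a left module. *)
Lemma tensor_projective (X : lmodType B) : projective X -> projective (tensor U X).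
Proof.
move=> Xp M N g f gs.
pose ff (x : X) : homB N := @HomB N (fun u => f (tens u x))
  (fun u v => etrans (congr1 f (tensDl u v x)) (linearD f _ _))
  (fun b u => etrans (congr1 f (esym (scale_tens b u x))) (linearZ_LR f b _)).
have ffl : linear ff.
  move=> b x y; apply: homBP => u; rewrite -[LHS]/(f (tens u (b *: x + y))).
  by rewrite tensDr -tensA linearD.
have [h hE] := homB_lift (mklin ffl) Xp gs.
pose F (u : U) x := h x u.
have FDl u v x : F (u + v) x = F u x + F v x by exact: hbD.
have FDr u x y : F u (x + y) = F u x + F u y by rewrite /F linearD.
have FA u b x : F (ract u b) x = F u (b *: x) by rewrite /F linearZ.
have Fl : linear (tlift F).
  move=> b x y; rewrite tliftD //; congr (_ + _).
  elim/tensor_ind: x => [|x x' hx hx'|u x].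
  - by rewrite scaler0 tlift0 // scaler0.
  - by rewrite scalerDr !tliftD // hx hx' scalerDr.
  - by rewrite scale_tens !tlift_tens // /F hbZ.
exists (mklin Fl) => x; rewrite -[mklin Fl x]/(tlift F x).
elim/tensor_ind: x => [|x x' hx hx'|u x].
- by rewrite tlift0 // !linear0.
- by rewrite tliftD // !linearD hx hx'.
- by rewrite tlift_tens // hE.
Qed.
End HomModule.

Section QuotientModule.
Variables (A : pzRingType) (M N : lmodType A) (d : {linear M -> N}).

Definition im_rel (x y : N) : bool := `[< exists z, x - y = d z >].
Lemma im_rel_refl : reflexive im_rel.
Proof. by move=> x; apply/asboolP; exists 0; rewrite subrr linear0. Qed.
Lemma im_rel_sym : symmetric im_rel.
Proof.
by move=> x y; apply/asboolP/asboolP => -[z h]; exists (- z); rewrite linearN -h opprB.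
Qed.
Lemma im_rel_trans : transitive im_rel.
Proof.
move=> y x z /asboolP[u hu] /asboolP[v hv]; apply/asboolP; exists (u + v).
by rewrite linearD -hu -hv addrA subrK.
Qed.
Canonical im_equiv := EquivRel im_rel im_rel_refl im_rel_sym im_rel_trans.

Definition coker : Type := {eq_quot im_equiv}%qT.
HB.instance Definition _ := Choice.on coker.

Definition cpi (x : N) : coker := (\pi_({eq_quot im_equiv}) x)%qT.
Definition crepr (x : coker) : N := @repr _ {eq_quot im_equiv}%qT x.
Lemma creprK x : cpi (crepr x) = x. Proof. exact: reprK. Qed.
Lemma cpiP x y : (exists z, x - y = d z) <-> cpi x = cpi y.
Proof. by split=> [h|/eqmodP/asboolP//]; apply/eqmodP/asboolP. Qed.
Lemma crepr_cpi x : exists z, crepr (cpi x) - x = d z.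
Proof. by apply/cpiP; rewrite creprK. Qed.

Definition coker_add x y := cpi (crepr x + crepr y).
Definition coker_opp x := cpi (- crepr x).
Definition coker_scale a x := cpi (a *: crepr x).

Lemma cpi_add x y : cpi (x + y) = coker_add (cpi x) (cpi y).
Proof.
have [[u hu] [v hv]] := (crepr_cpi x, crepr_cpi y).
by apply/esym/cpiP; exists (u + v); rewrite linearD -hu -hv opprD addrACA.
Qed.
Lemma cpi_opp x : cpi (- x) = coker_opp (cpi x).
Proof.
have [u hu] := crepr_cpi x.
by apply/esym/cpiP; exists (- u); rewrite (linearN d) -hu opprB opprK addrC.
Qed.
Lemma cpi_scale a x : cpi (a *: x) = coker_scale a (cpi x).
Proof.
have [u hu] := crepr_cpi x.
by apply/esym/cpiP; exists (a *: u); rewrite (linearZ_LR d) -hu scalerBr.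
Qed.

Lemma coker_addA : associative coker_add.
Proof.
by move=> x y z; rewrite -[x]creprK -[y]creprK -[z]creprK -!cpi_add addrA.
Qed.
Lemma coker_addC : commutative coker_add.
Proof. by move=> x y; rewrite /coker_add addrC. Qed.
Lemma coker_add0 : left_id (cpi 0) coker_add.
Proof. by move=> x; rewrite -[x]creprK -cpi_add add0r. Qed.
Lemma coker_addN : left_inverse (cpi 0) coker_opp coker_add.
Proof. by move=> x; rewrite -[x]creprK -cpi_opp -cpi_add addNr. Qed.
HB.instance Definition _ :=
  GRing.isZmodule.Build coker coker_addA coker_addC coker_add0 coker_addN.

Lemma coker_scaleA a b x : coker_scale a (coker_scale b x) = coker_scale (a * b) x.
Proof. by rewrite -[x]creprK -!cpi_scale scalerA. Qed.
Lemma coker_scale1 : left_id 1 coker_scale.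
Proof. by move=> x; rewrite -[x]creprK -cpi_scale scale1r. Qed.
Lemma coker_scaleDr : right_distributive coker_scale +%R.
Proof.
move=> a x y; rewrite -[x]creprK -[y]creprK.
rewrite -[cpi _ + cpi _]/(coker_add (cpi _) (cpi _)) -cpi_add -!cpi_scale scalerDr.
exact: cpi_add.
Qed.
Lemma coker_scaleDl x : {morph coker_scale^~ x : a b / a + b}.
Proof. by move=> a b; rewrite -[x]creprK -!cpi_scale scalerDl; exact: cpi_add. Qed.
HB.instance Definition _ := GRing.Zmodule_isLmodule.Build A coker
  coker_scaleA coker_scale1 coker_scaleDr coker_scaleDl.

Lemma cpi_linear : linear cpi.
Proof. by move=> a x y; rewrite cpi_add cpi_scale. Qed.
Lemma cpi_eq0 x : cpi x = 0 -> exists z, x = d z.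
Proof. by move=> /cpiP; rewrite subr0. Qed.
Lemma cpi_im z : cpi (d z) = 0.
Proof. by apply/cpiP; exists z; rewrite subr0. Qed.
End QuotientModule.

(** * Quadratic algebras with split relation *)

Lemma sum_widen (W : nmodType) (F : nat -> W) N M : (N <= M)%N ->
  (forall k, (N <= k)%N -> F k = 0) -> \sum_(k < M) F k = \sum_(k < N) F k.
Proof.
move=> NM F0; rewrite -(subnKC NM) big_split_ord /= [X in _ + X]big1 ?addr0 //.
by move=> i _; rewrite F0 ?leq_addr.
Qed.

Lemma sum_pair (I : Type) (r : seq I) (M N : nmodType) (F : I -> M * N) :
  \sum_(i <- r) F i = (\sum_(i <- r) (F i).1, \sum_(i <- r) (F i).2).
Proof. by elim/big_rec3: _ => [|i p q u _ ->] //; case: (F i). Qed.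

(** Defines a map out of a graded group from one map per degree; on each element only finitely many
    of them contribute. *)
Lemma graded_glue (A W : zmodType) (p : nat -> A -> A) (F : nat -> A -> W) :
  (forall y, exists N, forall k, (N <= k)%N -> p k y = 0) ->
  (forall k, F k 0 = 0) ->
  exists H : A -> W, forall y N, (forall k, (N <= k)%N -> p k y = 0) ->
    H y = \sum_(k < N) F k (p k y).
Proof.
move=> pb F0; pose d y := sval (cid (pb y)).
have dP y k : (d y <= k)%N -> p k y = 0 by exact: (svalP (cid (pb y))).
exists (fun y => \sum_(k < d y) F k (p k y)) => y N h.
rewrite -(sum_widen (F := fun k => F k (p k y)) (leq_maxl N (d y))).
  by rewrite (sum_widen (F := fun k => F k (p k y)) (leq_maxr N (d y))) // => k /dP ->.
by move=> k /h ->.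
Qed.

(* An algebra on a bimodule V with the single quadratic relation kw; the maps *)
(* kl and kr are left inverses of y |-> kw (x) y and y |-> y (x) kw.          *)
Record quad_alg (B : pzRingType) (V : bimodule B) := QuadAlg {
  ka :> pzRingType;
  kj : {rmorphism B -> ka};
  kv : V -> ka;
  kw : seq (V * V);
  kvD : forall u v, kv (u + v) = kv u + kv v;
  kv_ract : forall v b, kv (ract v b) = kv v * kj b;
  kvZ : forall b v, kv (b *: v) = kj b * kv v;
  kw0 : \sum_(p <- kw) kv p.1 * kv p.2 = 0;
  kw_central : forall (T : zmodType) (F : V -> V -> T),
    (forall u u' v, F (u + u') v = F u v + F u' v) ->
    (forall u v v', F u (v + v') = F u v + F u v') ->
    (forall u b v, F (ract u b) v = F u (b *: v)) ->
    forall b, \sum_(p <- kw) F (b *: p.1) p.2 = \sum_(p <- kw) F p.1 (ract p.2 b);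
  k_ind : forall P : ka -> Prop,
    (forall x y, P x -> P y -> P (x + y)) -> (forall b, P (kj b)) ->
    (forall v x, P x -> P (kv v * x)) -> forall x, P x;
  k_act : forall (Z : lmodType B) (al : vact V Z),
    (forall z, \sum_(p <- kw) al p.1 (al p.2 z) = 0) ->
    exists act : ka -> Z -> Z,
      [/\ forall a b z, act (a + b) z = act a z + act b z,
          forall a y z, act a (y + z) = act a y + act a z,
          forall a b z, act (a * b) z = act a (act b z),
          forall b z, act (kj b) z = b *: z &
          forall v z, act (kv v) z = al v z];
  kg : nat -> ka -> ka;
  kgD : forall k x y, kg k (x + y) = kg k x + kg k y;
  kg_jM : forall k b y, kg k (kj b * y) = kj b * kg k y;
  kg_Mj : forall k y b, kg k (y * kj b) = kg k y * kj b;
  kg_j : forall k b, kg k (kj b) = if k is 0%N then kj b else 0;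
  kg0_v : forall v y, kg 0 (kv v * y) = 0;
  kgS_v : forall k v y, kg k.+1 (kv v * y) = kv v * kg k y;
  kg_bound : forall y, exists N, forall k, (N <= k)%N -> kg k y = 0;
  kg_sum : forall N y, (forall k, (N <= k)%N -> kg k y = 0) -> \sum_(k < N) kg k y = y;
  kl : V -> ka -> ka;
  klDl : forall u v y, kl (u + v) y = kl u y + kl v y;
  klDr : forall v x y, kl v (x + y) = kl v x + kl v y;
  kl_ract : forall v b y, kl (ract v b) y = kl v (kj b * y);
  klZ : forall b v y, kl (b *: v) y = kj b * kl v y;
  kl_w : forall y, \sum_(p <- kw) kl p.1 (kv p.2 * y) = y;
  kr : ka -> V -> ka;
  krDl : forall x y v, kr (x + y) v = kr x v + kr y v;
  krDr : forall y u v, kr y (u + v) = kr y u + kr y v;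
  kr_ract : forall y v b, kr y (ract v b) = kr y v * kj b;
  krZ : forall y b v, kr (y * kj b) v = kr y (b *: v);
  kr_w : forall y, \sum_(p <- kw) kr (y * kv p.1) p.2 = y;
  kr_g : forall k y v, kr (kg k.+1 y) v = kg k (kr y v) }.

Section LeftProjective.
Variables (B : pzRingType) (V : bimodule B) (A : quad_alg V).
Hypothesis V_proj : projective V.
Local Notation kj := (kj A).
Local Notation kv := (kv A).
Local Notation kw := (kw A).
Local Notation kg := (@kg B V A).
Local Notation kl := (@kl B V A).

Lemma kg0r k : kg k 0 = 0. Proof. by apply: (addrI (kg k 0)); rewrite -kgD !addr0. Qed.
Lemma kg_kg k y : kg k (kg k y) = kg k y.
Proof.
elim/(k_ind (q := A)): y k => [x y hx hy|b|v y IH] k.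
- by rewrite !kgD hx hy.
- by rewrite kg_j; case: k => [|k]; rewrite ?kg0r // kg_j.
- by case: k => [|k]; rewrite ?kg0_v ?kg0r // !kgS_v IH.
Qed.
Definition A_left : lmodType B := restr_scalars kj A^o.
Lemma A_leftE b (y : A_left) : b *: y = kj b * (y : A). Proof. by []. Qed.

Definition A_bim : bimodule B.
refine (@Bimodule B A_left (fun y b => (y : A) * kj b : A) _ _ _ _ _).
- by move=> x y b; exact: mulrDl.
- by move=> y b c; rewrite rmorphD; exact: mulrDr.
- by move=> y b c; rewrite rmorphM; exact: mulrA.
- by move=> y; rewrite rmorph1; exact: mulr1.
- by move=> b y c; rewrite !A_leftE mulrA.
Defined.

Definition zero_vact : vact V (B^o : lmodType B).
by refine (@VAct _ _ (B^o : lmodType B) (fun _ _ => 0) _ _ _ _) => *;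
  rewrite ?addr0 ?scaler0.
Defined.

(** Let the arrows act on B by zero: then y applied to 1 is the degree 0 component of y. *)
Lemma degree0_ex : exists p0 : A -> B,
  [/\ forall x y, p0 (x + y) = p0 x + p0 y,
      forall b y, p0 (kj b * y) = b * p0 y & forall y, kg 0 y = kj (p0 y)].
Proof.
have al0 z : \sum_(p <- kw) zero_vact p.1 (zero_vact p.2 z) = 0 by rewrite big1.
have [act [actDl actDr actM act_j act_v]] := k_act al0.
exists (fun y => act y 1); split=> [x y|b y|y].
- exact: actDl.
- by rewrite actM act_j.
elim/(k_ind (q := A)): y => [x y hx hy|b|v y _].
- by rewrite kgD hx hy actDl rmorphD.
- by rewrite kg_j act_j -[b *: _]/(b * 1) mulr1.
- by rewrite kg0_v actM act_v rmorph0.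
Qed.

(* The correction by kl makes the action below vanish on the relation without *)
(* changing the image under g.                                                *)
Lemma A_lift_degree k (M N : lmodType B) (g : {linear M -> N}) (f : {linear A_left -> N}) :
  (forall y, exists x, g x = y) ->
  exists h : {linear A_left -> M}, forall y, g (h y) = f (kg k y).
Proof.
elim: k M N g f => [|k IH] M N g f gs.
  have [p0 [p0D p0M p0E]] := degree0_ex; have [m hm] := gs (f 1).
  have hl : linear (fun y : A_left => p0 y *: m).
    by move=> b x y; rewrite p0D p0M scalerDl scalerA.
  exists (mklin hl) => y; rewrite -[mklin hl y]/(p0 y *: m) (linearZ_LR g) hm p0E.
  by rewrite -(linearZ_LR f); congr (f _); exact: mulr1.
have [G [GE Gs]] := homB_map_ex V_proj gs.
have fD (y : A) u v : f (kv (u + v) * y) = f (kv u * y) + f (kv v * y).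
  by rewrite kvD mulrDl (linearD f).
have fZ (y : A) b v : f (kv (b *: v) * y) = b *: f (kv v * y).
  by rewrite kvZ -mulrA; exact: (linearZ_LR f).
pose f' (y : A_left) : homB V N := HomB (fD y) (fZ y).
have fl' : linear f'.
  move=> b x y; apply: homBP => v; rewrite -[LHS]/(f (kv v * (kj b * (x : A) + y))).
  by rewrite mulrDr (linearD f) mulrA -kv_ract.
have [h' hE'] := IH _ _ G (mklin fl') Gs.
have hgE v y : g (h' y v) = f (kv v * kg k y) by rewrite -GE hE'.
(* The naive rule [v * y |-> h' y v] is consistent only if the sum of [F z] over the relation
   vanishes. This sum is the obstruction. *)
pose F z (u v : V) : M := h' (kv v * z : A) u.
have FDl z u u' v : F z (u + u') v = F z u v + F z u' v by exact: hbD.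
have FDr z u v v' : F z u (v + v') = F z u v + F z u v'.
  by rewrite /F kvD mulrDl (linearD h').
have FA z u b v : F z (ract u b) v = F z u (b *: v).
  by rewrite /F kvZ -mulrA -[kj b * _]/(b *: (kv v * z : A_left)) (linearZ_LR h').
have FDz z z' u v : F (z + z') u v = F z u v + F z' u v.
  by rewrite /F mulrDr (linearD h').
have F0 u v : F 0 u v = 0 by apply: (addrI (F 0 u v)); rewrite -FDz !addr0.
have Fc z b : \sum_(p <- kw) F (kj b * z) p.1 p.2 = b *: \sum_(p <- kw) F z p.1 p.2.
  rewrite scaler_sumr.
  transitivity (\sum_(p <- kw) F z p.1 (ract p.2 b)).
    by apply: eq_bigr => p _; rewrite /F kv_ract mulrA.
  rewrite -(kw_central A (FDl z) (FDr z) (FA z)).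
  by apply: eq_bigr => p _; rewrite /F hbZ.
(* The first component carries y itself, so that the second can use [kl v y]. By [kl_w] the
   correction terms over the relation add up to the obstruction and cancel it. *)
pose al v (z : (A_left * M)%type) : (A_left * M)%type :=
  (kv v * (z.1 : A) : A, h' z.1 v - \sum_(p <- kw) F (kl v z.1) p.1 p.2).
have alDl u v z : al (u + v) z = al u z + al v z.
  congr (_, _); first by rewrite kvD mulrDl.
  rewrite hbD -[RHS]addrACA -opprD -big_split; congr (_ - _).
  by apply: eq_bigr => p _; rewrite klDl FDz.
have alDr v y z : al v (y + z) = al v y + al v z.
  congr (_, _); first exact: mulrDr.
  rewrite (linearD h') -[RHS]addrACA -opprD -big_split; congr (_ - _).
  by apply: eq_bigr => p _; rewrite klDr FDz.
have alA v b z : al (ract v b) z = al v (b *: z).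
  congr (_, _); first by rewrite kv_ract -mulrA.
  rewrite (linearZ_LR h'); congr (_ - _).
  by apply: eq_bigr => p _; rewrite kl_ract.
have alZ b v z : al (b *: v) z = b *: al v z.
  congr (_, _); first by rewrite kvZ -mulrA.
  rewrite hbZ -[RHS]/(b *: (h' z.1 v - \sum_(p <- kw) F (kl v z.1) p.1 p.2)) scalerBr.
  rewrite -Fc; by congr (_ - _); apply: eq_bigr => p _; rewrite klZ.
have al0 z : \sum_(p <- kw) VAct alDl alDr alA alZ p.1 (VAct alDl alDr alA alZ p.2 z) = 0.
  rewrite sum_pair; congr (_, _).
    transitivity ((\sum_(p <- kw) kv p.1 * kv p.2) * (z.1 : A)); last by rewrite kw0 mul0r.
    by rewrite mulr_suml; apply: eq_bigr => p _; rewrite /= mulrA.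
  rewrite sumrB /= exchange_big /=; apply/eqP; rewrite subr_eq0; apply/eqP.
  apply: eq_bigr => p _.
  rewrite -(big_morph (fun y => F y p.1 p.2) (fun x y => FDz x y p.1 p.2) (F0 _ _)).
  by rewrite kl_w.
have [act [actDl actDr actM act_j act_v]] := k_act al0.
pose z0 : (A_left * M)%type := (1 : A, 0).
have actE y : ((act y z0).1 : A) = y /\ g (act y z0).2 = f (kg k.+1 y).
  elim/(k_ind (q := A)): y => [x y [hx1 hx2] [hy1 hy2]|b|v y [h1 h2]].
  - by rewrite actDl kgD (linearD f) (linearD g) /= hx1 hy1 hx2 hy2.
  - rewrite act_j; split; first exact: mulr1.
    rewrite kg_j (linear0 f) -[RHS](linear0 g); congr (g _); exact: scaler0.
  - rewrite actM act_v /= h1; split=> //; rewrite (linearB g) hgE kgS_v.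
    rewrite -[RHS]subr0; congr (_ - _); rewrite (linear_sum g).
    under eq_bigr => p _ do rewrite /F hgE.
    rewrite -(linear_sum f) -[RHS](linear0 f); congr (f _).
    case: k {IH h' hE' hgE F FDl FDr FA FDz F0 Fc al alDl alDr alA alZ al0 act actDl actDr
      actM act_j act_v z0 h1 h2} => [|k].
      by apply: big1 => p _; rewrite kg0_v mulr0.
    transitivity ((\sum_(p <- kw) kv p.1 * kv p.2) * kg k (kl v y)); last by rewrite kw0 mul0r.
    by rewrite mulr_suml; apply: eq_bigr => p _; rewrite kgS_v mulrA.
have hl : linear (fun y : A_left => (act y z0).2).
  by move=> b x y; rewrite actDl actM act_j.
by exists (mklin hl) => y; case: (actE y).
Qed.

Lemma A_left_projective : projective A_left.
Proof.
move=> M N g f gs.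
have H k := cid (A_lift_degree k f gs); pose h k := sval (H k).
have hE k y : g (h k y) = f (kg k y) by exact: (svalP (H k)).
have [F FE] := @graded_glue A M kg (fun k (y : A_left) => h k y)
  (kg_bound (q := A)) (fun k => linear0 (h k)).
have Fl : linear (F : A_left -> M).
  move=> b x y; have [N1 h1] := kg_bound (x : A); have [N2 h2] := kg_bound (y : A).
  have e1 k : (maxn N1 N2 <= k)%N -> kg k x = 0 by rewrite geq_max => /andP[/h1].
  have e2 k : (maxn N1 N2 <= k)%N -> kg k y = 0 by rewrite geq_max => /andP[_ /h2].
  rewrite (FE x _ e1) (FE y _ e2) (FE _ (maxn N1 N2)) => [|k hk]; last first.
    by rewrite kgD [kg k _]kg_jM e1 // e2 // mulr0 addr0.
  rewrite scaler_sumr -big_split; apply: eq_bigr => k _ /=.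
  by rewrite kgD [kg k _]kg_jM -(linearZ_LR (h k)) -(linearD (h k)).
exists (mklin Fl) => y; rewrite -[mklin Fl y]/(F y).
have [n hn] := kg_bound y; rewrite (FE _ _ hn) linear_sum.
under eq_bigr => k _ do rewrite hE.
rewrite -(linear_sum f); congr (f _).
by rewrite -[RHS](@kg_sum _ _ A n y hn); apply: eq_bigr => k _; exact: kg_kg.
Qed.
End LeftProjective.

Section RestrictedMap.
Variables (B A : pzRingType) (phi : {rmorphism B -> A}) (M N : lmodType A).
Variable g : {linear M -> N}.

Lemma restr_linear : linear (g : restr_scalars phi M -> restr_scalars phi N).
Proof. by move=> b x y; exact: (linearP g (phi b)). Qed.
Definition restr_map : {linear restr_scalars phi M -> restr_scalars phi N} :=
  mklin restr_linear.
End RestrictedMap.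

(** * Induced modules *)

Section InducedModule.
Variables (B : pzRingType) (V : bimodule B) (A : quad_alg V).
Local Notation kj := (kj A).
Local Notation A_bim := (A_bim A).

(** A (x) X under a second name, so that it can carry the A-module structure while [tensor] keeps
    that of a B-module. *)
Definition induced (X : lmodType B) : Type := tensor A_bim X.

Section Module.
Variable X : lmodType B.
HB.instance Definition _ := GRing.Zmodule.on (induced X).

Definition itens (a : A) (x : X) : induced X := tens (a : A_bim) x.

Lemma itensDl a b x : itens (a + b) x = itens a x + itens b x.
Proof. exact: tensDl. Qed.
Lemma itensDr a x y : itens a (x + y) = itens a x + itens a y.
Proof. exact: tensDr. Qed.
Lemma itensA a b x : itens (a * kj b) x = itens a (b *: x).
Proof. exact: (tensA (a : A_bim)). Qed.
Lemma itens0l x : itens 0 x = 0. Proof. exact: tens0l. Qed.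
Lemma itens0r a : itens a 0 = 0. Proof. exact: tens0r. Qed.
Lemma itens_suml I (r : seq I) (F : I -> A) x :
  itens (\sum_(i <- r) F i) x = \sum_(i <- r) itens (F i) x.
Proof. exact: (big_morph (itens^~ x) (fun a b => itensDl a b x) (itens0l x)). Qed.
Lemma itens_sumr I (r : seq I) a (F : I -> X) :
  itens a (\sum_(i <- r) F i) = \sum_(i <- r) itens a (F i).
Proof. exact: (big_morph (itens a) (itensDr a) (itens0r a)). Qed.

Lemma induced_ind (P : induced X -> Prop) : P 0 ->
  (forall x y, P x -> P y -> P (x + y)) -> (forall a x, P (itens a x)) -> forall z, P z.
Proof. exact: tensor_ind. Qed.

Section Lift.
Variables (Z : zmodType) (f : A -> X -> Z).
Hypothesis fDl : forall a b x, f (a + b) x = f a x + f b x.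
Hypothesis fDr : forall a x y, f a (x + y) = f a x + f a y.
Hypothesis fA : forall a b x, f (a * kj b) x = f a (b *: x).

Lemma itlift_ex : exists F : induced X -> Z,
  (forall x y, F (x + y) = F x + F y) /\ forall a x, F (itens a x) = f a x.
Proof.
exists (@tlift B A_bim X Z f); split=> [x y|a x].
  exact: (@tliftD B A_bim X Z f).
exact: (@tlift_tens B A_bim X Z f).
Qed.
Definition itlift := sval (cid itlift_ex).
Lemma itliftD x y : itlift (x + y) = itlift x + itlift y.
Proof. exact: (svalP (cid itlift_ex)).1. Qed.
Lemma itliftE a x : itlift (itens a x) = f a x.
Proof. exact: (svalP (cid itlift_ex)).2. Qed.
Lemma itlift0 : itlift 0 = 0.
Proof. by apply: (addrI (itlift 0)); rewrite -itliftD !addr0. Qed.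
End Lift.

Lemma iscale_fDl a b c x : itens (a * (b + c)) x = itens (a * b) x + itens (a * c) x.
Proof. by rewrite mulrDr itensDl. Qed.
Lemma iscale_fDr a b x y : itens (a * b) (x + y) = itens (a * b) x + itens (a * b) y.
Proof. exact: itensDr. Qed.
Lemma iscale_fA a b c x : itens (a * (b * kj c)) x = itens (a * b) (c *: x).
Proof. by rewrite mulrA itensA. Qed.
Definition iscale a : induced X -> induced X :=
  itlift (iscale_fDl a) (iscale_fDr a) (iscale_fA a).

Lemma iscaleE a b x : iscale a (itens b x) = itens (a * b) x.
Proof. exact: itliftE. Qed.
Lemma iscaleA a b z : iscale a (iscale b z) = iscale (a * b) z.
Proof.
elim/induced_ind: z => [|x y hx hy|c x]; first by rewrite /iscale !itlift0.
  by rewrite /iscale !itliftD -!/(iscale _ _) hx hy.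
by rewrite !iscaleE mulrA.
Qed.
Lemma iscale1 : left_id 1 iscale.
Proof.
elim/induced_ind => [|x y hx hy|c x]; first by rewrite /iscale itlift0.
  by rewrite /iscale itliftD -!/(iscale _ _) hx hy.
by rewrite iscaleE mul1r.
Qed.
Lemma iscaleDr : right_distributive iscale +%R.
Proof. by move=> a x y; exact: itliftD. Qed.
Lemma iscaleDl z : {morph iscale^~ z : a b / a + b}.
Proof.
move=> a b; elim/induced_ind: z => [|x y hx hy|c x]; first by rewrite /iscale !itlift0 addr0.
  by rewrite !iscaleDr hx hy addrACA.
by rewrite !iscaleE mulrDl itensDl.
Qed.
HB.instance Definition _ := GRing.Zmodule_isLmodule.Build A (induced X)
  iscaleA iscale1 iscaleDr iscaleDl.

Lemma itensZ a b x : a *: itens b x = itens (a * b) x.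
Proof. exact: iscaleE. Qed.
Lemma itensE a x : itens a x = a *: itens 1 x.
Proof. by rewrite itensZ mulr1. Qed.

Section LinearLift.
Variables (Y : lmodType A) (u : X -> Y).
Hypothesis uD : forall x y, u (x + y) = u x + u y.
Hypothesis uZ : forall b x, u (b *: x) = kj b *: u x.

Lemma induced_lift_ex : exists F : {linear induced X -> Y},
  forall a x, F (itens a x) = a *: u x.
Proof.
have fDl a b x : (a + b) *: u x = a *: u x + b *: u x by exact: scalerDl.
have fDr a x y : a *: u (x + y) = a *: u x + a *: u y by rewrite uD scalerDr.
have fA a b x : (a * kj b) *: u x = a *: u (b *: x) by rewrite uZ scalerA.
have Fl : linear (itlift fDl fDr fA).
  move=> a x y; rewrite itliftD; congr (_ + _).
  elim/induced_ind: x => [|x x' hx hx'|c x].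
  - by rewrite scaler0 itlift0 scaler0.
  - by rewrite scalerDr !itliftD hx hx' scalerDr.
  - by rewrite itensZ !itliftE scalerA.
by exists (mklin Fl) => a x; exact: itliftE.
Qed.
Definition induced_lift : {linear induced X -> Y} := sval (cid induced_lift_ex).
Lemma induced_liftE a x : induced_lift (itens a x) = a *: u x.
Proof. exact: svalP (cid induced_lift_ex) a x. Qed.
End LinearLift.

Lemma induced_projective : projective X -> projective (induced X).
Proof.
move=> Xp M N g f gs.
have fl : linear (fun x : X => f (itens 1 x) : restr_scalars kj N).
  by move=> b x y; rewrite itensDr (linearD f) -itensA mul1r -[kj b]mulr1 -itensZ (linearZ_LR f).
have [h hE] := Xp _ _ (restr_map kj g) (mklin fl) gs.
have hD x y : h (x + y) = h x + h y :> M by exact: linearD.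
have hZ b x : h (b *: x) = kj b *: (h x : M) :> M by exact: (linearZ_LR h).
exists (induced_lift hD hZ) => z.
elim/induced_ind: z => [|x y hx hy|c x]; first by rewrite !linear0.
  by rewrite !linearD hx hy.
rewrite induced_liftE (linearZ_LR g) itensE (linearZ_LR f); congr (_ *: _).
exact: hE.
Qed.

Lemma induced_restr_projective : projective V -> projective X ->
  projective (restr_scalars kj (induced X)).
Proof.
move=> Vp Xp; apply: (@projective_liso _ _ (tensor A_bim X)).
  have fl : linear (id : restr_scalars kj (induced X) -> tensor A_bim X).
    move=> b x y; congr (_ + _); rewrite rsE.
    elim/induced_ind: x => [|x x' hx hx'|c x]; first by rewrite !scaler0.
      by rewrite !scalerDr hx hx'.
    by rewrite itensZ; apply/esym/scale_tens.
  by apply: (bij_liso (f := mklin fl)) => [x y //|y]; exists y.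
exact: (tensor_projective (U := A_bim) (@A_left_projective B V A Vp) Xp).
Qed.
End Module.
End InducedModule.

(** * The Koszul resolution *)

Section Koszul.
Variables (B : pzRingType) (V : bimodule B) (A : quad_alg V).
Hypothesis V_proj : projective V.
Local Notation kj := (kj A).
Local Notation kv := (kv A).
Local Notation kw := (kw A).
Local Notation kg := (@kg B V A).
Local Notation kr := (@kr B V A).

Variable X : lmodType A.
Local Notation XB := (restr_scalars kj X).
Local Notation VX := (tensor V XB).
Local Notation F0 := (induced A XB).
Local Notation F1 := (induced A VX).
Local Notation it := (itens (A := A)).

Definition kos0 : {linear F0 -> X} :=
  induced_lift (Y := X) (u := fun x : XB => x) (fun _ _ => erefl) (fun _ _ => erefl).
Lemma kos0E a (x : XB) : kos0 (it a x) = a *: (x : X).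
Proof. exact: induced_liftE. Qed.

Section Kos1.
Let f (v : V) (x : XB) : F0 := it (kv v) x - it 1 (kv v *: (x : X) : XB).
Let fDl u v x : f (u + v) x = f u x + f v x.
Proof. by rewrite /f kvD itensDl scalerDl itensDr opprD addrACA. Qed.
Let fDr v x y : f v (x + y) = f v x + f v y.
Proof. by rewrite /f (scalerDr (kv v) (x : X)) !itensDr opprD addrACA. Qed.
Let fA v b x : f (ract v b) x = f v (b *: x).
Proof. by rewrite /f kv_ract itensA -scalerA. Qed.
Let u := tlift f.
Let uE v x : u (tens v x) = f v x. Proof. exact: tlift_tens. Qed.
Let uD s t : u (s + t) = u s + u t. Proof. exact: tliftD. Qed.
Let uZ b t : u (b *: t) = kj b *: u t.
Proof.
elim/tensor_ind: t => [|s t hs ht|v x].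
- by rewrite scaler0 /u tlift0 // scaler0.
- by rewrite scalerDr !uD hs ht scalerDr.
- rewrite scale_tens !uE /f kvZ scalerBr !itensZ mulr1 -scalerA; congr (_ - _).
  by rewrite -[kj b in RHS]mul1r itensA.
Qed.
Lemma kos1_ex : exists d : {linear F1 -> F0}, forall a v x,
  d (it a (tens v x)) = it (a * kv v) x - it a (kv v *: (x : X) : XB).
Proof.
exists (induced_lift uD uZ) => a v x.
by rewrite induced_liftE uE /f scalerBr !itensZ mulr1.
Qed.
End Kos1.
Definition kos1 := sval (cid kos1_ex).
Lemma kos1E a v x :
  kos1 (it a (tens v x)) = it (a * kv v) x - it a (kv v *: (x : X) : XB).
Proof. exact: svalP (cid kos1_ex) a v x. Qed.

Section Kos2.
Let u (x : XB) : F1 := \sum_(p <- kw)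
  (it (kv p.1) (tens p.2 x) + it 1 (tens p.1 (kv p.2 *: (x : X) : XB))).
Let uD x y : u (x + y) = u x + u y.
Proof.
rewrite -big_split; apply: eq_bigr => p _ /=.
by rewrite (scalerDr (kv p.2) (x : X)) !tensDr !itensDr addrACA.
Qed.
Let uZ b x : u (b *: x) = kj b *: u x.
Proof.
rewrite /u !big_split /= scalerDr; congr (_ + _).
  pose F (v v' : V) := it (kv v) (tens v' x).
  have FDl v v' w : F (v + v') w = F v w + F v' w by rewrite /F kvD itensDl.
  have FDr v w w' : F v (w + w') = F v w + F v w' by rewrite /F tensDl itensDr.
  have FA v c w : F (ract v c) w = F v (c *: w).
    by rewrite /F kv_ract itensA scale_tens.
  transitivity (\sum_(p <- kw) F p.1 (ract p.2 b)).
    by apply: eq_bigr => p _; rewrite /F tensA.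
  rewrite -(kw_central A FDl FDr FA) scaler_sumr.
  by apply: eq_bigr => p _; rewrite /F kvZ itensZ.
pose F (v v' : V) := it 1 (tens v (kv v' *: (x : X) : XB)).
have FDl v v' w : F (v + v') w = F v w + F v' w by rewrite /F tensDl itensDr.
have FDr v w w' : F v (w + w') = F v w + F v w'.
  by rewrite /F kvD scalerDl tensDr itensDr.
have FA v c w : F (ract v c) w = F v (c *: w) by rewrite /F tensA rsE scalerA kvZ.
transitivity (\sum_(p <- kw) F p.1 (ract p.2 b)).
  by apply: eq_bigr => p _; rewrite /F kv_ract -scalerA.
rewrite -(kw_central A FDl FDr FA) scaler_sumr.
by apply: eq_bigr => p _; rewrite /F -scale_tens -itensA mul1r itensZ mulr1.
Qed.
(** The source of this differential is A (x) Bw (x) X, written as A (x) X because w is central.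
    Centrality is what makes the formula balanced over B ([uZ]). *)
Lemma kos2_ex : exists d : {linear F0 -> F1}, forall a x,
  d (it a x) = \sum_(p <- kw)
    (it (a * kv p.1) (tens p.2 x) + it a (tens p.1 (kv p.2 *: (x : X) : XB))).
Proof.
exists (induced_lift uD uZ) => a x; rewrite induced_liftE scaler_sumr.
by apply: eq_bigr => p _; rewrite scalerDr !itensZ mulr1.
Qed.
End Kos2.
Definition kos2 := sval (cid kos2_ex).
Lemma kos2E a x : kos2 (it a x) = \sum_(p <- kw)
  (it (a * kv p.1) (tens p.2 x) + it a (tens p.1 (kv p.2 *: (x : X) : XB))).
Proof. exact: svalP (cid kos2_ex) a x. Qed.

Lemma kos0_kos1 t : kos0 (kos1 t) = 0.
Proof.
elim/induced_ind: t => [|s t hs ht|a t]; first by rewrite !linear0.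
  by rewrite !linearD hs ht addr0.
elim/tensor_ind: t => [|s t hs ht|v x]; first by rewrite itens0r !linear0.
  by rewrite itensDr !linearD hs ht addr0.
by rewrite kos1E linearB !kos0E scalerA subrr.
Qed.

Lemma kos1_kos2 t : kos1 (kos2 t) = 0.
Proof.
elim/induced_ind: t => [|s t hs ht|a x]; first by rewrite !linear0.
  by rewrite !linearD hs ht addr0.
rewrite kos2E linear_sum.
transitivity (it (a * \sum_(p <- kw) kv p.1 * kv p.2) x
  - it a ((\sum_(p <- kw) kv p.1 * kv p.2) *: (x : X) : XB)); last first.
  by rewrite kw0 mulr0 scale0r itens0l itens0r subrr.
rewrite mulr_sumr scaler_suml itens_suml itens_sumr -sumrB.
apply: eq_bigr => p _.
by rewrite linearD !kos1E mulrA scalerA subrKA.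
Qed.

Lemma kos0_surj x : exists z, kos0 z = x.
Proof. by exists (it 1 (x : XB)); rewrite kos0E scale1r. Qed.

(** Modulo the image of [kos1], arrows can be moved across the tensor sign one at a time, so a (x) x
    becomes 1 (x) a x and every z becomes 1 (x) [kos0 z]. *)
Lemma kos0_exact z : kos0 z = 0 -> exists t, z = kos1 t.
Proof.
have H a (x : XB) : exists t, it a x - it 1 (a *: (x : X) : XB) = kos1 t.
  elim/(k_ind (q := A)): a x => [a b ha hb|b|v a ha] x.
  - have [[s hs] [t ht]] := (ha x, hb x); exists (s + t).
    by rewrite linearD -hs -ht itensDl scalerDl itensDr opprD addrACA.
  - by exists 0; rewrite linear0 -{1}[kj b]mul1r itensA subrr.
  - have [s hs] := ha x.
    exists (kv v *: s + it 1 (tens v (a *: (x : X) : XB))).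
    rewrite linearD (linearZ_LR kos1) -hs kos1E scalerBr !itensZ mul1r mulr1 scalerA.
    by rewrite subrKA.
have K z' : exists t, z' - it 1 (kos0 z' : XB) = kos1 t.
  elim/induced_ind: z' => [|s t [s' hs] [t' ht]|a x].
  - by exists 0; rewrite !linear0 itens0r subrr.
  - by exists (s' + t'); rewrite !linearD -hs -ht itensDr opprD addrACA.
  - by rewrite kos0E; exact: H.
by move=> z0; have [t] := K z; rewrite z0 itens0r subr0 => ->; exists t.
Qed.

(* kr induces a map D with D kos2 = 1 + N, where N lowers the degree.          *)
Lemma kos2_inj : injective kos2.
Proof.
pose f a (t : VX) : F0 := tlift (fun v x => it (kr a v) x) t.
have gDl a u v (x : XB) : it (kr a (u + v)) x = it (kr a u) x + it (kr a v) x.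
  by rewrite krDr itensDl.
have gDr a v (x y : XB) : it (kr a v) (x + y) = it (kr a v) x + it (kr a v) y.
  exact: itensDr.
have gA a v b (x : XB) : it (kr a (ract v b)) x = it (kr a v) (b *: x).
  by rewrite kr_ract itensA.
have fE a v x : f a (tens v x) = it (kr a v) x.
  exact: (tlift_tens (gDl a) (gDr a) (gA a)).
have fDr a s t : f a (s + t) = f a s + f a t.
  exact: (tliftD (gDl a) (gDr a) (gA a)).
have f0 a : f a 0 = 0 by apply: (addrI (f a 0)); rewrite -fDr !addr0.
have fDl a b t : f (a + b) t = f a t + f b t.
  elim/tensor_ind: t => [|s t hs ht|v x]; first by rewrite !f0 addr0.
    by rewrite !fDr hs ht addrACA.
  by rewrite !fE krDl itensDl.
have fA a b t : f (a * kj b) t = f a (b *: t).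
  elim/tensor_ind: t => [|s t hs ht|v x]; first by rewrite scaler0 !f0.
    by rewrite scalerDr !fDr hs ht.
  by rewrite scale_tens !fE krZ.
pose D := itlift fDl fDr fA.
pose n a (x : XB) : F0 := \sum_(p <- kw) it (kr a p.1) (kv p.2 *: (x : X) : XB).
have kr0 v : kr 0 v = 0 by apply: (addrI (kr 0 v)); rewrite -krDl !addr0.
have nDl a b x : n (a + b) x = n a x + n b x.
  by rewrite -big_split; apply: eq_bigr => p _; rewrite krDl itensDl.
have nDr a x y : n a (x + y) = n a x + n a y.
  rewrite -big_split; apply: eq_bigr => p _.
  by rewrite (scalerDr (kv p.2) (x : X)) itensDr.
have nA a b x : n (a * kj b) x = n a (b *: x).
  pose F (v v' : V) := it (kr a v) (kv v' *: (x : X) : XB).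
  have FDl v v' w : F (v + v') w = F v w + F v' w by rewrite /F krDr itensDl.
  have FDr v w w' : F v (w + w') = F v w + F v w' by rewrite /F kvD scalerDl itensDr.
  have FA v c w : F (ract v c) w = F v (c *: w).
    by rewrite /F kr_ract itensA rsE scalerA kvZ.
  transitivity (\sum_(p <- kw) F (b *: p.1) p.2).
    by apply: eq_bigr => p _; rewrite /F krZ.
  rewrite (kw_central A FDl FDr FA); apply: eq_bigr => p _.
  by rewrite /F kv_ract -scalerA.
pose N := itlift nDl nDr nA.
have DE t : D (kos2 t) = t + N t.
  elim/induced_ind: t => [|s t hs ht|a x].
  - by rewrite linear0 /D /N !itlift0 addr0.
  - by rewrite linearD /D /N !itliftD -/D -/N hs ht addrACA.
  rewrite kos2E /D (big_morph _ (itliftD fDl fDr fA) (itlift0 fDl fDr fA)) /N itliftE.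
  have <- : \sum_(p <- kw) it (kr (a * kv p.1) p.2) x = it a x.
    by rewrite -itens_suml kr_w.
  rewrite -big_split; apply: eq_bigr => p _ /=.
  by rewrite itliftD !itliftE !fE.
have pDl k a b (x : XB) : it (kg k (a + b)) x = it (kg k a) x + it (kg k b) x.
  by rewrite kgD itensDl.
have pDr k a (x y : XB) : it (kg k a) (x + y) = it (kg k a) x + it (kg k a) y.
  exact: itensDr.
have pA k a b (x : XB) : it (kg k (a * kj b)) x = it (kg k a) (b *: x).
  by rewrite kg_Mj itensA.
pose P k := itlift (pDl k) (pDr k) (pA k).
have PD k s t : P k (s + t) = P k s + P k t by exact: itliftD.
have P0 k : P k 0 = 0 by exact: itlift0.
have PE k a x : P k (it a x) = it (kg k a) x by exact: itliftE.
have PN k t : P k (N t) = N (P k.+1 t).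
  elim/induced_ind: t => [|s t hs ht|a x].
  - by rewrite /N itlift0 !P0 itlift0.
  - by rewrite /N !PD !itliftD PD -/N hs ht.
  rewrite PE /N !itliftE (big_morph _ (PD k) (P0 k)); apply: eq_bigr => p _.
  by rewrite PE kr_g.
have Pb t : exists n, forall k, (n <= k)%N -> P k t = 0.
  elim/induced_ind: t => [|s t [n1 h1] [n2 h2]|a x]; first by exists 0%N => k _; exact: P0.
    exists (maxn n1 n2) => k; rewrite geq_max => /andP[/h1 e1 /h2 e2].
    by rewrite PD e1 e2 addr0.
  by have [m hm] := kg_bound a; exists m => k /hm e; rewrite PE e itens0l.
have Psum t : exists n, forall m, (n <= m)%N -> \sum_(k < m) P k t = t.
  elim/induced_ind: t => [|s t [n1 h1] [n2 h2]|a x].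
  - by exists 0%N => m _; apply: big1 => k _; exact: P0.
  - exists (maxn n1 n2) => m; rewrite geq_max => /andP[/h1 e1 /h2 e2].
    by rewrite -[RHS](congr2 +%R e1 e2) -big_split; apply: eq_bigr => k _; exact: PD.
  have [m hm] := kg_bound a; exists m => j mj.
  under eq_bigr => k _ do rewrite PE.
  by rewrite -itens_suml kg_sum // => k jk; rewrite hm // (leq_trans mj).
move=> s t /eqP; rewrite -subr_eq0 -linearB => /eqP h.
apply/eqP; rewrite -subr_eq0; apply/eqP; move: (s - t) h => {s t} z z0.
(* On the kernel of [kos2] one has z = - N z, so each component is determined by the one above it.
   As the components vanish in high degree, descending induction kills them all. *)
have Pz k : P k z = - N (P k.+1 z).
  apply/eqP; rewrite -subr_eq0 opprK -PN -PD -DE z0.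
  by rewrite /D itlift0 P0.
have [m hm] := Pb z.
have Pz0 j k : (m - j <= k)%N -> P k z = 0.
  elim: j k => [|j IH] k; first by rewrite subn0; exact: hm.
  rewrite leq_subLR => h; rewrite Pz IH /N ?itlift0 ?oppr0 //.
  by rewrite leq_subLR addnS -addSn.
have [n' hn] := Psum z; rewrite -(hn n') //; apply: big1 => k _.
by apply: (Pz0 m); rewrite subnn.
Qed.

(* On X + coker kos2, the rule v (x, u) = (v x, v u + [1 (x) v (x) x]) is an   *)
(* action of A; it yields h with h (kos1 u) = [u].                            *)
Lemma kos1_exact t : kos1 t = 0 -> exists z, t = kos2 z.
Proof.
pose Q := coker kos2; pose pi : {linear F1 -> Q} := mklin (cpi_linear kos2).
pose Z : lmodType B := (XB * restr_scalars kj Q)%type.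
pose al v (z : Z) : Z :=
  (kv v *: (z.1 : X) : X, kv v *: (z.2 : Q) + pi (it 1 (tens v z.1)) : Q).
have alDl u v z : al (u + v) z = al u z + al v z.
  congr (_, _); first by rewrite kvD scalerDl.
  by rewrite kvD scalerDl tensDl itensDr (linearD pi) addrACA.
have alDr v y z : al v (y + z) = al v y + al v z.
  congr (_, _); first exact: (scalerDr (kv v) (y.1 : X) (z.1 : X)).
  rewrite tensDr itensDr (linearD pi).
  by rewrite (scalerDr (kv v) (y.2 : Q) (z.2 : Q)) addrACA.
have alA v b z : al (ract v b) z = al v (b *: z).
  congr (_, _); first by rewrite kv_ract -scalerA.
  by rewrite kv_ract -scalerA tensA.
have alZ b v z : al (b *: v) z = b *: al v z.
  congr (_, _); first by rewrite kvZ -scalerA.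
  rewrite -[RHS]/(kj b *: (kv v *: (z.2 : Q) + pi (it 1 (tens v z.1)))) scalerDr.
  rewrite scalerA -kvZ -(linearZ_LR pi) itensZ mulr1 -scale_tens -itensA.
  by rewrite -[kj b]mul1r mul1r.
have al0 z : \sum_(p <- kw) VAct alDl alDr alA alZ p.1 (VAct alDl alDr alA alZ p.2 z) = 0.
  rewrite sum_pair; congr (_, _).
    transitivity ((\sum_(p <- kw) kv p.1 * kv p.2) *: (z.1 : X)); last by rewrite kw0 scale0r.
    by rewrite scaler_suml; apply: eq_bigr => p _; rewrite /= scalerA.
  transitivity ((\sum_(p <- kw) kv p.1 * kv p.2) *: (z.2 : Q) + pi (kos2 (it 1 z.1))); last first.
    by rewrite kw0 scale0r add0r; exact: cpi_im.
  rewrite kos2E (linear_sum pi) scaler_suml -big_split; apply: eq_bigr => p _ /=.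
  rewrite scalerDr scalerA -addrA; congr (_ + _).
  by rewrite -(linearZ_LR pi) itensZ mulr1 mul1r; exact/esym/(linearD pi).
have [act [actDl actDr actM act_j act_v]] := k_act al0.
have act0 a q : act a (0, q) = (0, a *: (q : Q)).
  elim/(k_ind (q := A)): a => [a b ha hb|b|v a ha].
  - rewrite actDl ha hb scalerDl; congr (_, _); exact: addr0.
  - by rewrite act_j; congr (_, _); exact: (scaler0 XB b).
  - rewrite actM act_v ha; congr (_, _); first exact: (scaler0 X (kv v)).
    rewrite -[LHS]/(kv v *: (a *: (q : Q)) + pi (it 1 (tens v (0 : XB)))).
    by rewrite tens0r itens0r (linear0 pi) addr0 scalerA.
pose f a (x : XB) : Q := (act a (x, 0)).2.
have pD (x y : XB) : ((x + y, 0) : Z) = ((x, 0) : Z) + (y, 0).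
  by congr (_, _); rewrite addr0.
have fDl a b x : f (a + b) x = f a x + f b x by rewrite /f actDl.
have fDr a x y : f a (x + y) = f a x + f a y by rewrite /f pD actDr.
have fA a b x : f (a * kj b) x = f a (b *: x).
  rewrite /f actM act_j; congr (act a _).2; congr (_, _); exact: (scaler0 (restr_scalars kj Q) b).
pose h := itlift fDl fDr fA.
have hE u : h (kos1 u) = pi u.
  elim/induced_ind: u => [|s u hs hu|a u]; first by rewrite !linear0 /h itlift0.
    by rewrite !linearD /h itliftD -/h hs hu.
  elim/tensor_ind: u => [|s u hs hu|v x]; first by rewrite itens0r !linear0 /h itlift0.
    by rewrite itensDr !linearD /h itliftD -/h hs hu.
  rewrite kos1E.
  have hB y z : h (y - z) = h y - h z.
    have h0 : h 0 = 0 by exact: itlift0.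
    rewrite /h itliftD -/h; congr (_ + _).
    by apply: (addrI (h z)); rewrite -(itliftD fDl fDr fA) !subrr.
  rewrite hB; have -> : h (it (a * kv v) x) = (act a (al v (x, 0))).2.
    by rewrite /h itliftE /f actM act_v.
  have -> : al v (x, 0) = ((kv v *: (x : X), 0) : Z) + ((0, pi (it 1 (tens v x))) : Z).
    congr (_, _); first by rewrite addr0.
    by rewrite (scaler0 Q (kv v)).
  rewrite actDr act0 -[h (it a _)]/(itlift fDl fDr fA (it a _)) itliftE.
  rewrite -[LHS]/(_ + a *: pi (it 1 (tens v x)) - f a (kv v *: (x : X) : XB)) addrC.
  by rewrite addKr -(linearZ_LR pi) itensZ mulr1.
move=> t0; have := hE t; rewrite t0 /h itlift0 => /esym pt0.
exact: cpi_eq0 pt0.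
Qed.

Hypothesis X_proj : projective XB.

Lemma koszul_pdex : pdex 2 X.
Proof.
have K0 t : exists k : mker kos0, val k = kos1 t.
  by have [k ->] := mker_in (kos0_kos1 t); exists k.
have [d dE] := kernel_lift (i := (val : {linear mker kos0 -> F0})) (p := kos0) (u := kos1)
  val_inj (@mker_in _ _ _ kos0) kos0_kos1.
exists (mker kos0), F0; split; first exact: induced_projective.
  exact/ses_mker/kos0_surj.
exists F0, F1; split; last exact: induced_projective.
  by apply: induced_projective; apply: tensor_projective.
exists kos2, d; split; first exact: kos2_inj.
  by move=> y; have [t yt] := kos0_exact (mker_eq0 y); exists t; apply: val_inj; rewrite dE.
move=> t; split=> [dt|[z ->]].
  by apply: kos1_exact; rewrite -dE dt.
by apply: val_inj; rewrite dE kos1_kos2.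
Qed.
End Koszul.

(** * Change of rings *)

Lemma restr_ses (B A : pzRingType) (phi : {rmorphism B -> A}) (K P M : lmodType A) :
  ses K P M -> ses (restr_scalars phi K) (restr_scalars phi P) (restr_scalars phi M).
Proof.
by move=> [i [p [ii ps pk]]]; exists (restr_map phi i), (restr_map phi p); split.
Qed.

Lemma pdex_liso (A : pzRingType) n (M N : lmodType A) : liso M N -> pdex n M -> pdex n N.
Proof.
case: n => [|n] MN /=; first exact/projective_liso/liso_sym.
by move=> [K [P [Pp sP Kn]]]; exists K, P; split=> //; exact: ses_liso sP.
Qed.

Lemma pdex_prod (A : pzRingType) n (M N : lmodType A) :
  pdex n M -> pdex n N -> pdex n (M * N)%type.
Proof.
elim: n M N => [|n IH] M N /=; first exact: projective_prod.
move=> [K [P [Pp [i [p [ii ps pk]]] Kn]]] [L [Q [Qp [j [q [ji qs qk]]] Ln]]].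
exists (K * L)%type, (P * Q)%type; split; [exact: projective_prod| |exact: IH].
have il : linear (fun x : K * L => (i x.1, j x.2)) by move=> a x y; rewrite !linearP.
have pl : linear (fun x : P * Q => (p x.1, q x.2)) by move=> a x y; rewrite !linearP.
exists (mklin il), (mklin pl); split=> [[x1 x2] [y1 y2] [/ii-> /ji->] //|[y1 y2]|[x1 x2]].
  have [[x1 <-] [x2 <-]] := (ps y1, qs y2); by exists (x1, x2).
split=> [[/pk[k1 ->] /qk[k2 ->]]|[[k1 k2] [-> ->]]]; first by exists (k1, k2).
by congr (_, _); [apply/pk; exists k1|apply/qk; exists k2].
Qed.

(** A chain of syzygies begins with a projective module onto M, so the assumed bound over B also
    supplies the projectives used in dimension shifting. *)
Lemma enough_projectives (A : pzRingType) n (M : lmodType A) : pdex n M ->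
  exists (P : lmodType A) (p : {linear P -> M}), projective P /\ forall y, exists x, p x = y.
Proof.
case: n => [|n] /=; first by exists M, idfun; split=> // y; exists y.
by move=> [K [P [Pp [i [p [_ ps _]]] _]]]; exists P, p.
Qed.

Lemma pdexW (A : pzRingType) m n (M : lmodType A) : (m <= n)%N -> pdex m M -> pdex n M.
Proof.
move=> mn /pdex_resolution[r rm]; exact: resolution_pdex (length_leW mn rm).
Qed.

Section QuadraticAlgebra.
Variables (B : pzRingType) (V : bimodule B) (A : quad_alg V).
Hypothesis V_proj : projective V.
Variable k : nat.
Hypothesis B_pdex : forall M : lmodType B, pdex k M.

(** Dimension shifting: a projective B-module P onto X induces A (x) P -> X. Since A (x) P is
    projective also over B, the kernel restricts to a syzygy of X over B. The start of the induction
    is the Koszul resolution. *)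
Lemma restr_pdall_pdex j (X : lmodType A) :
  pdall j (restr_scalars (kj A) X) -> pdex j.+2 X.
Proof.
elim: j X => [|j IH] X Xj; first exact: koszul_pdex.
have [P [p [Pp ps]]] := enough_projectives (B_pdex (restr_scalars (kj A) X)).
have pD x y : p (x + y) = p x + p y :> X by exact: linearD.
have pZ b x : p (b *: x) = kj A b *: (p x : X) :> X by exact: (linearZ_LR p).
pose q := induced_lift (Y := X) pD pZ.
have qs y : exists x, q x = y.
  by have [x <-] := ps y; exists (itens 1 x); rewrite induced_liftE scale1r.
exists (mker q), (induced A P); split; first exact: induced_projective.
  exact: ses_mker.
apply: IH; apply: Xj (restr_ses _ (ses_mker qs)).
exact: induced_restr_projective.
Qed.

Lemma quad_alg_pdex (X : lmodType A) : pdex k.+2 X.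
Proof.
apply: restr_pdall_pdex; apply: pdex_pdall (B_pdex (restr_scalars (kj A) X)).
pose M := restr_scalars (kj A) X.
have [P [p [Pp _]]] := enough_projectives (B_pdex M).
by exists P, P; split=> //; exact: liso_refl.
Qed.
End QuadraticAlgebra.

Section RingIsomorphism.
Variables (A A' : pzRingType) (phi : {rmorphism A -> A'}) (psi : {rmorphism A' -> A}).
Hypothesis phiK : cancel phi psi.
Hypothesis psiK : cancel psi phi.

Lemma restr_iso_projective (P : lmodType A) :
  projective P -> projective (restr_scalars psi P).
Proof.
move=> Pp M N g f gs.
have fl : linear (f : P -> restr_scalars phi N).
  by move=> a x y; rewrite -{1}[a]phiK; exact: (linearP f (phi a) x y).
have [h hE] := Pp _ _ (restr_map phi g) (mklin fl) gs.
have hl : linear (h : restr_scalars psi P -> M).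
  move=> a x y; rewrite -{2}[a]psiK.
  exact: (linearP h (psi a) x y).
by exists (mklin hl).
Qed.

Lemma restr_iso_pdex n (M : lmodType A) : pdex n M -> pdex n (restr_scalars psi M).
Proof.
elim: n M => [|n IH] M /=; first exact: restr_iso_projective.
move=> [K [P [Pp sP Kn]]]; exists (restr_scalars psi K), (restr_scalars psi P).
by split; [exact: restr_iso_projective|exact: restr_ses|exact: IH].
Qed.

Lemma iso_pdex n : (forall M : lmodType A, pdex n M) -> forall M : lmodType A', pdex n M.
Proof.
move=> h M; apply: pdex_liso (restr_iso_pdex (h (restr_scalars phi M))).
have il : linear (id : restr_scalars psi (restr_scalars phi M) -> M).
  by move=> a x y; rewrite -{2}[a]psiK.
by apply: (bij_liso (f := mklin il)) => [x y //|y]; exists y.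
Qed.
End RingIsomorphism.

(* A ring C split off from B by a central idempotent, the image of 1 in B.     *)
Record corner_ring (B C : pzRingType) := CornerRing {
  crp : {rmorphism B -> C};
  crj : {additive C -> B};
  crjM : forall c d, crj (c * d) = crj c * crj d;
  crjK : cancel crj crp;
  crj_l : forall b, crj 1 * b = crj (crp b);
  crj_r : forall b, b * crj 1 = crj (crp b) }.

Section Corner.
Variables (B C : pzRingType) (D : corner_ring B C).
Local Notation pi := (crp D).
Local Notation j := (crj D).

Section Module.
Variable M : lmodType B.

Definition corner_def (x : M) : M := x - j 1 *: x.
Lemma corner_def_linear : linear corner_def.
Proof.
move=> b x y; rewrite /corner_def scalerDr scalerA crj_l -crj_r -scalerA opprD addrACA.
by rewrite -scalerBr.
Qed.

Definition corner : Type := mker (mklin corner_def_linear).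
HB.instance Definition _ := GRing.Zmodule.on corner.
Definition cval (x : corner) : M := val (x : mker (mklin corner_def_linear)).

Lemma cval_fix x : j 1 *: cval x = cval x.
Proof. by have /eqP := mker_eq0 x; rewrite subr_eq0 => /eqP /esym. Qed.
Lemma cvalD x y : cval (x + y) = cval x + cval y. Proof. by []. Qed.
Lemma cval_inj : injective cval. Proof. exact: val_inj. Qed.
Lemma corner_in x : j 1 *: x = x -> exists y, cval y = x.
Proof.
move=> jx; have /mker_in[y ->] : mklin corner_def_linear x = 0.
  by rewrite -[LHS]/(x - j 1 *: x) jx subrr.
by exists y.
Qed.

Definition corner_scale (c : C) (x : corner) : corner :=
  j c *: (x : mker (mklin corner_def_linear)).
Lemma cvalZ_ c x : cval (corner_scale c x) = j c *: cval x. Proof. by []. Qed.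
Lemma corner_scaleA c d x : corner_scale c (corner_scale d x) = corner_scale (c * d) x.
Proof. by rewrite /corner_scale scalerA crjM. Qed.
Lemma corner_scale1 : left_id 1 corner_scale.
Proof. by move=> x; apply: cval_inj; rewrite cvalZ_ cval_fix. Qed.
Lemma corner_scaleDr : right_distributive corner_scale +%R.
Proof. by move=> c x y; exact: scalerDr. Qed.
Lemma corner_scaleDl x : {morph corner_scale^~ x : c d / c + d}.
Proof. by move=> c d; rewrite /corner_scale raddfD; exact: scalerDl. Qed.
HB.instance Definition _ := GRing.Zmodule_isLmodule.Build C corner
  corner_scaleA corner_scale1 corner_scaleDr corner_scaleDl.

Lemma cvalZ c x : cval (c *: x) = j c *: cval x. Proof. by []. Qed.
Lemma cval_pi b x : cval (pi b *: x) = b *: cval x.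
Proof. by rewrite cvalZ -crj_r -scalerA cval_fix. Qed.
End Module.

Lemma corner_lift (P : lmodType C) (M : lmodType B) (f : {linear restr_scalars pi P -> M}) :
  exists f' : {linear P -> corner M}, forall x, cval (f' x) = f x.
Proof.
have fx x : j 1 *: f x = f x.
  by rewrite -(linearZ_LR f) rsE crjK scale1r.
pose f' x := sval (cid (corner_in (fx x))).
have fE x : cval (f' x) = f x by exact: (svalP (cid (corner_in (fx x)))).
have fl : linear (f' : P -> corner M).
  move=> c x y; apply: cval_inj; rewrite cvalD cvalZ !fE.
  by rewrite -[j c *: _](linearZ_LR f) -(linearD f) rsE crjK.
by exists (mklin fl).
Qed.

(** Write c for the central idempotent. A B-map from a C-module to M lands in c M, and a surjection
    M -> N restricts to a surjection c M -> c N, so the lifting takes place over C. *)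
Lemma restr_corner_projective (P : lmodType C) :
  projective P -> projective (restr_scalars pi P).
Proof.
move=> Pp M N g f gs; have [f' fE] := corner_lift f.
have vl : linear (fun x : restr_scalars pi (corner M) => g (cval (x : corner M))).
  by move=> b x y; rewrite rsE cvalD cval_pi linearP.
have [g' gE] := corner_lift (mklin vl).
have gs' y : exists x, g' x = y.
  have [m hm] := gs (cval y).
  have [x xE] : exists x : corner M, cval x = j 1 *: m.
    by apply: corner_in; rewrite scalerA -crjM mulr1.
  exists x; apply: cval_inj; rewrite gE -[LHS]/(g (cval x)) xE (linearZ_LR g) hm.
  exact: cval_fix.
have [h hE] := Pp _ _ g' f' gs'.
have hl : linear (fun x : restr_scalars pi P => cval (h x)).
  by move=> b x y; rewrite linearD cvalD rsE (linearZ_LR h) cval_pi.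
by exists (mklin hl) => x; rewrite -fE -hE gE.
Qed.

Lemma restr_corner_pdex n (M : lmodType C) : pdex n M -> pdex n (restr_scalars pi M).
Proof.
elim: n M => [|n IH] M /=; first exact: restr_corner_projective.
move=> [K [P [Pp sP Kn]]]; exists (restr_scalars pi K), (restr_scalars pi P).
by split; [exact: restr_corner_projective|exact: restr_ses|exact: IH].
Qed.
End Corner.

Section ProductRing.
Variables R S : pzRingType.
Local Notation B := (R * S)%type.

Definition pair_l (r : R) : B := (r, 0).
Definition pair_r (s : S) : B := (0, s).
Lemma pair_l_zmod_morphism : zmod_morphism pair_l.
Proof. by move=> r s; apply/eqP; rewrite xpair_eqE /= subr0 !eqxx. Qed.
Lemma pair_r_zmod_morphism : zmod_morphism pair_r.
Proof. by move=> r s; apply/eqP; rewrite xpair_eqE /= subr0 !eqxx. Qed.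
HB.instance Definition _ := GRing.isZmodMorphism.Build R B pair_l pair_l_zmod_morphism.
HB.instance Definition _ := GRing.isZmodMorphism.Build S B pair_r pair_r_zmod_morphism.

Let lM r s : pair_l (r * s) = pair_l r * pair_l s.
Proof. by apply/eqP; rewrite xpair_eqE /= mulr0 !eqxx. Qed.
Let rM r s : pair_r (r * s) = pair_r r * pair_r s.
Proof. by apply/eqP; rewrite xpair_eqE /= mulr0 !eqxx. Qed.
Let l_pi_l (b : B) : pair_l 1 * b = pair_l (fst b).
Proof. by apply/eqP; rewrite xpair_eqE /= mul1r mul0r !eqxx. Qed.
Let l_pi_r (b : B) : b * pair_l 1 = pair_l (fst b).
Proof. by apply/eqP; rewrite xpair_eqE /= mulr1 mulr0 !eqxx. Qed.
Let r_pi_l (b : B) : pair_r 1 * b = pair_r (snd b).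
Proof. by apply/eqP; rewrite xpair_eqE /= mul1r mul0r !eqxx. Qed.
Let r_pi_r (b : B) : b * pair_r 1 = pair_r (snd b).
Proof. by apply/eqP; rewrite xpair_eqE /= mulr1 mulr0 !eqxx. Qed.

Definition corner_l : corner_ring B R := CornerRing (crp := fst) lM (fun=> erefl) l_pi_l l_pi_r.
Definition corner_r : corner_ring B S := CornerRing (crp := snd) rM (fun=> erefl) r_pi_l r_pi_r.

Lemma prod_ring_pdex n : (forall M : lmodType R, pdex n M) ->
  (forall M : lmodType S, pdex n M) -> forall M : lmodType B, pdex n M.
Proof.
move=> hR hS M.
have pR := restr_corner_pdex corner_l (hR (corner corner_l M)).
have pS := restr_corner_pdex corner_r (hS (corner corner_r M)).
apply: pdex_liso (pdex_prod pR pS).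
pose P : lmodType B := (restr_scalars (crp corner_l) (corner corner_l M) *
  restr_scalars (crp corner_r) (corner corner_r M))%type.
pose f (x : P) : M :=
  cval (x.1 : corner corner_l M) + cval (x.2 : corner corner_r M).
have fl : linear f.
  move=> b x y; rewrite /f.
  rewrite -[(b *: x + y).1]/(crp corner_l b *: (x.1 : corner corner_l M) + y.1).
  rewrite -[(b *: x + y).2]/(crp corner_r b *: (x.2 : corner corner_r M) + y.2).
  by rewrite !cvalD !cval_pi addrACA scalerDr.
have lr : crj corner_l 1 * crj corner_r 1 = 0.
  by apply/eqP; rewrite xpair_eqE /= mulr0 mul0r !eqxx.
have rl : crj corner_r 1 * crj corner_l 1 = 0.
  by apply/eqP; rewrite xpair_eqE /= mulr0 mul0r !eqxx.
have f1 x : crj corner_l 1 *: f x = cval (x.1 : corner corner_l M).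
  by rewrite scalerDr cval_fix -[cval (x.2 : corner corner_r M)]cval_fix scalerA lr scale0r addr0.
have f2 x : crj corner_r 1 *: f x = cval (x.2 : corner corner_r M).
  by rewrite scalerDr cval_fix -[cval (x.1 : corner corner_l M)]cval_fix scalerA rl scale0r add0r.
apply: (bij_liso (f := mklin fl)) => [x y xy|y].
  have {}xy : f x = f y by [].
  have := congr1 (GRing.scale (crj corner_l 1)) xy; rewrite !f1 => /cval_inj.
  have := congr1 (GRing.scale (crj corner_r 1)) xy; rewrite !f2 => /cval_inj.
  by case: x y {xy} => x1 x2 [y1 y2] /= -> ->.
have [x1 h1] : exists x : corner corner_l M, cval x = crj corner_l 1 *: y.
  by apply: corner_in; rewrite scalerA -crjM mulr1.
have [x2 h2] : exists x : corner corner_r M, cval x = crj corner_r 1 *: y.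
  by apply: corner_in; rewrite scalerA -crjM mulr1.
exists ((x1, x2) : P); rewrite -[LHS]/(cval x1 + cval x2) h1 h2 -scalerDl.
rewrite [X in X *: _](_ : _ = 1) ?scale1r //.
by apply/eqP; rewrite xpair_eqE /= addr0 add0r !eqxx.
Qed.
End ProductRing.

(** * Discriminants of a Frobenius extension *)

Section Casimir.
Variables (R S : comPzRingType) (iota : {rmorphism R -> S}) (n : nat).
Variables (l : S -> R) (e f : 'I_n -> S).
Hypothesis lD : forall x y, l (x + y) = l x + l y.
Hypothesis lZ : forall r x, l (iota r * x) = r * l x.
Hypothesis e_basis : is_basis iota e.
Hypothesis f_basis : is_basis iota f.
Hypothesis lef : forall i j, l (e i * f j) = (i == j)%:R.

Lemma l0 : l 0 = 0.
Proof. by apply: (addrI (l 0)); rewrite -lD !addr0. Qed.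
Lemma lN x : l (- x) = - l x.
Proof. by apply: (addrI (l x)); rewrite -lD !subrr l0. Qed.
Lemma l_sum I (r : seq I) (F : I -> S) : l (\sum_(i <- r) F i) = \sum_(i <- r) l (F i).
Proof. exact: (big_morph l lD l0). Qed.

Lemma expand_e s : s = \sum_i iota (l (s * f i)) * e i.
Proof.
have [r [sE _]] := e_basis s; rewrite {1}sE; apply: eq_bigr => j _.
congr (iota _ * _); rewrite sE mulr_suml l_sum (bigD1 j) //= big1.
  by rewrite -mulrA lZ lef eqxx mulr1 addr0.
by move=> i ij; rewrite -mulrA lZ lef (negPf ij) mulr0.
Qed.

Lemma expand_f s : s = \sum_i iota (l (s * e i)) * f i.
Proof.
have [r [sE _]] := f_basis s; rewrite {1}sE; apply: eq_bigr => j _.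
congr (iota _ * _); rewrite sE mulr_suml l_sum (bigD1 j) //= big1.
  by rewrite -mulrA lZ [f j * _]mulrC lef eqxx mulr1 addr0.
by move=> i ij; rewrite -mulrA lZ [f i * _]mulrC lef eq_sym (negPf ij) mulr0.
Qed.

Section Balanced.
Variables (Z : zmodType) (F : S -> S -> Z).
Hypothesis FDl : forall x y z, F (x + y) z = F x z + F y z.
Hypothesis FDr : forall x y z, F x (y + z) = F x y + F x z.
Hypothesis FZ : forall r x y, F (iota r * x) y = F x (iota r * y).

Let F_suml I (r : seq I) (G : I -> S) y :
  F (\sum_(i <- r) G i) y = \sum_(i <- r) F (G i) y.
Proof.
apply: (big_morph (F^~ y)) => [u v|]; first exact: FDl.
by apply: (addrI (F 0 y)); rewrite -FDl !addr0.
Qed.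
Let F_sumr I (r : seq I) (G : I -> S) x :
  F x (\sum_(i <- r) G i) = \sum_(i <- r) F x (G i).
Proof.
apply: (big_morph (F x)) => [u v|]; first exact: FDr.
by apply: (addrI (F x 0)); rewrite -FDr !addr0.
Qed.

(** Both sides expand to the sum of the l(t e_i f_j) F(e_j, f_i) over all i and j. *)
Lemma casimir_shift t : \sum_i F (t * e i) (f i) = \sum_i F (e i) (t * f i).
Proof.
transitivity (\sum_i \sum_j F (e j) (iota (l (t * e i * f j)) * f i)).
  apply: eq_bigr => i _; rewrite {1}[t * e i]expand_e F_suml.
  by apply: eq_bigr => j _; rewrite FZ.
rewrite exchange_big; apply: eq_bigr => j _ /=.
by rewrite [t * f j]expand_f F_sumr; apply: eq_bigr => i _; rewrite mulrAC.
Qed.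

(** In terms of the e_i alone, the Casimir element has the coefficients l(f_i f_j), a symmetric
    matrix because S is commutative. *)
Lemma casimir_sym : \sum_i F (e i) (f i) = \sum_i F (f i) (e i).
Proof.
apply/esym.
transitivity (\sum_i \sum_j F (e j) (iota (l (f i * f j)) * e i)).
  apply: eq_bigr => i _; rewrite {1}[f i]expand_e F_suml.
  by apply: eq_bigr => j _; rewrite FZ.
rewrite exchange_big; apply: eq_bigr => j _ /=.
by rewrite [f j in RHS]expand_e F_sumr; apply: eq_bigr => i _; rewrite [f i * _]mulrC.
Qed.

Lemma sum_antisym m (G : 'I_m -> 'I_m -> Z) :
  (forall i, G i i = 0) -> (forall i j, G i j = - G j i) ->
  \sum_i \sum_j G i j = 0.
Proof.
move=> G0 GN.
have -> : \sum_i \sum_j G i j =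
    \sum_(i < m) \sum_(j < m) (if (i < j)%N then G i j else 0) +
    \sum_(i < m) \sum_(j < m) (if (j < i)%N then G i j else 0).
  rewrite -big_split; apply: eq_bigr => i _ /=; rewrite -big_split.
  apply: eq_bigr => j _ /=; case: ltngtP => [ij|ij|/ord_inj<-].
  - by rewrite addr0.
  - by rewrite add0r.
  - by rewrite addr0 G0.
rewrite [X in _ + X]exchange_big -big_split big1 // => i _ /=.
rewrite -big_split big1 // => j _ /=.
by case: ifP; rewrite ?addr0 // => _; rewrite GN addNr.
Qed.

(* The tensor sum_i t e_i (x) f_i is symmetric with divided-power diagonal:   *)
(* its coefficients on the e_k (x) e_m are l (t f_k f_m).                      *)
Lemma casimir_alt t : (forall r x, F (iota r * x) x = 0) ->
  \sum_i F (t * e i) (f i) = 0.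
Proof.
move=> F0.
have Fxx x : F x x = 0 by rewrite -{1}[x]mul1r -(rmorph1 iota).
have FN x y : F x y = - F y x.
  apply/eqP; rewrite -addr_eq0; have := Fxx (x + y).
  by rewrite FDl !FDr !Fxx add0r addr0 => ->.
transitivity (\sum_k F (t * f k) (e k)).
  transitivity (\sum_i \sum_k F (iota (l (f k * f i)) * (t * e i)) (e k)).
    apply: eq_bigr => i _; rewrite [f i in LHS]expand_e F_sumr.
    by apply: eq_bigr => k _; rewrite FZ [f k * _]mulrC.
  rewrite exchange_big; apply: eq_bigr => k _ /=; rewrite -F_suml; congr F.
  rewrite [f k in RHS]expand_e mulr_sumr; apply: eq_bigr => i _.
  by rewrite mulrCA.
transitivity (\sum_k \sum_j F (iota (l (t * f k * f j)) * e j) (e k)).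
  by apply: eq_bigr => k _; rewrite {1}[t * f k]expand_e F_suml.
apply: sum_antisym => [k|k j]; first exact: F0.
by rewrite FN FZ; congr (- F _ (iota (l _) * _)); rewrite mulrAC.
Qed.
End Balanced.
End Casimir.

Section Determinant.
Variables (R S : comPzRingType) (iota : {rmorphism R -> S}).
Variables (l : S -> R) (e f : 'I_4 -> S).
Hypothesis lD : forall x y, l (x + y) = l x + l y.
Hypothesis lZ : forall r x, l (iota r * x) = r * l x.
Hypothesis e_basis : is_basis iota e.
Hypothesis f_basis : is_basis iota f.
Hypothesis lef : forall i j, l (e i * f j) = (i == j)%:R.

(** The rows are the coordinates of the v_i in the basis e, so [dv] is the determinant relative to
    e. *)
Definition dmx (v : 'I_4 -> S) : 'M[R]_4 := \matrix_(i, j) l (v i * f j).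
Definition dv v := \det (dmx v).

Lemma dv_lin v u w i a :
  v i = iota a * u i + w i -> (forall k, k != i -> v k = u k) ->
  (forall k, k != i -> v k = w k) -> dv v = a * dv u + dv w.
Proof.
move=> vi vu vw; rewrite /dv -[\det (dmx w)]mul1r.
apply: (@determinant_multilinear _ _ _ _ _ i).
- by apply/rowP => j; rewrite !mxE vi mulrDl -mulrA lD lZ mul1r.
- by apply/matrixP => k j; rewrite !mxE vu // eq_sym neq_lift.
- by apply/matrixP => k j; rewrite !mxE vw // eq_sym neq_lift.
Qed.

Lemma dv_alt v i j : i != j -> v i = v j -> dv v = 0.
Proof.
by move=> ij vij; apply: (determinant_alternate ij) => k; rewrite !mxE vij.
Qed.

Lemma dv_e : dv e = 1.
Proof.
rewrite /dv (_ : dmx e = 1%:M) ?det1 //.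
by apply/matrixP => i j; rewrite !mxE lef.
Qed.

Definition D4 p q r s := dv (fun i => [:: p; q; r; s]`_i).

Definition upd (v : 'I_4 -> S) i s := fun k => if k == i then s else v k.

Lemma dv_upd v i s : dv (upd v i s) = \sum_j l (s * f j) * cofactor (dmx v) i j.
Proof.
rewrite /dv (expand_det_row _ i); apply: eq_bigr => j _.
rewrite !mxE /upd eqxx; congr (_ * _); congr (_ * \det _).
by apply/matrixP => k m; rewrite !mxE eq_sym (negPf (neq_lift _ _)).
Qed.

(** Cramer's rule: the adjugate times the matrix is the determinant, applied to the coordinate row
    of s. *)
Lemma cramer v s : iota (dv v) * s = \sum_i iota (dv (upd v i s)) * v i.
Proof.
rewrite (expand_e lD lZ e_basis lef (iota _ * s)) [RHS](expand_e lD lZ e_basis lef).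
apply: eq_bigr => j _; congr (iota _ * _).
rewrite mulr_suml (l_sum lD).
transitivity (((\row_k l (s * f k)) *m (\adj (dmx v) *m dmx v)) 0 j).
  by rewrite mul_adj_mx mul_mx_scalar !mxE -mulrA lZ.
rewrite mulmxA mxE; apply: eq_bigr => i _.
rewrite -mulrA lZ dv_upd; congr (_ * _); last by rewrite mxE.
by rewrite mxE; apply: eq_bigr => k _; rewrite !mxE.
Qed.

End Determinant.

(** * The discriminants generate the unit ideal *)

Section Unimodular.
Variables (R S : comPzRingType) (iota : {rmorphism R -> S}).
Variables (l : S -> R) (e f : 'I_4 -> S).
Hypothesis lD : forall x y, l (x + y) = l x + l y.
Hypothesis lZ : forall r x, l (iota r * x) = r * l x.
Hypothesis e_basis : is_basis iota e.
Hypothesis f_basis : is_basis iota f.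
Hypothesis lef : forall i j, l (e i * f j) = (i == j)%:R.

Local Notation D4 := (D4 l f).

Let i0 : 'I_4 := @Ordinal 4 0 isT.
Let i1 : 'I_4 := @Ordinal 4 1 isT.
Let i2 : 'I_4 := @Ordinal 4 2 isT.
Let i3 : 'I_4 := @Ordinal 4 3 isT.

Let sum4 (Z : nmodType) (F : 'I_4 -> Z) : \sum_i F i = F i0 + F i1 + F i2 + F i3.
Proof.
rewrite !big_ord_recr big_ord0 /= add0r.
by congr (F _ + F _ + F _ + F _); apply: val_inj.
Qed.

Lemma D4_lin0 a p p' q r s :
  D4 (iota a * p + p') q r s = a * D4 p q r s + D4 p' q r s.
Proof. by apply: (dv_lin f lD lZ (i := i0)) => // -[[|[|[|[|]]]]]. Qed.
Lemma D4_lin1 a p q q' r s :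
  D4 p (iota a * q + q') r s = a * D4 p q r s + D4 p q' r s.
Proof. by apply: (dv_lin f lD lZ (i := i1)) => // -[[|[|[|[|]]]]]. Qed.
Lemma D4_lin2 a p q r r' s :
  D4 p q (iota a * r + r') s = a * D4 p q r s + D4 p q r' s.
Proof. by apply: (dv_lin f lD lZ (i := i2)) => // -[[|[|[|[|]]]]]. Qed.
Lemma D4_lin3 a p q r s s' :
  D4 p q r (iota a * s + s') = a * D4 p q r s + D4 p q r s'.
Proof. by apply: (dv_lin f lD lZ (i := i3)) => // -[[|[|[|[|]]]]]. Qed.

Lemma D4_alt01 p q r : D4 p p q r = 0. Proof. exact: (@dv_alt _ _ _ _ _ i0 i1). Qed.
Lemma D4_alt02 p q r : D4 p q p r = 0. Proof. exact: (@dv_alt _ _ _ _ _ i0 i2). Qed.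
Lemma D4_alt03 p q r : D4 p q r p = 0. Proof. exact: (@dv_alt _ _ _ _ _ i0 i3). Qed.
Lemma D4_alt12 p q r : D4 r p p q = 0. Proof. exact: (@dv_alt _ _ _ _ _ i1 i2). Qed.
Lemma D4_alt13 p q r : D4 r p q p = 0. Proof. exact: (@dv_alt _ _ _ _ _ i1 i3). Qed.
Lemma D4_alt23 p q r : D4 q r p p = 0. Proof. exact: (@dv_alt _ _ _ _ _ i2 i3). Qed.

Lemma D4_D0 p p' q r s : D4 (p + p') q r s = D4 p q r s + D4 p' q r s.
Proof. by have := D4_lin0 1 p p' q r s; rewrite rmorph1 !mul1r. Qed.
Lemma D4_D1 p q q' r s : D4 p (q + q') r s = D4 p q r s + D4 p q' r s.
Proof. by have := D4_lin1 1 p q q' r s; rewrite rmorph1 !mul1r. Qed.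
Lemma D4_D2 p q r r' s : D4 p q (r + r') s = D4 p q r s + D4 p q r' s.
Proof. by have := D4_lin2 1 p q r r' s; rewrite rmorph1 !mul1r. Qed.
Lemma D4_D3 p q r s s' : D4 p q r (s + s') = D4 p q r s + D4 p q r s'.
Proof. by have := D4_lin3 1 p q r s s'; rewrite rmorph1 !mul1r. Qed.

Lemma D4_Z1 a p q r s : D4 p (iota a * q) r s = a * D4 p q r s.
Proof.
have D0 : D4 p 0 r s = 0.
  by apply: (addrI (D4 p 0 r s)); rewrite -D4_D1 !addr0.
by have := D4_lin1 a p q 0 r s; rewrite D0 !addr0.
Qed.
Lemma D4_Z3 a p q r s : D4 p q r (iota a * s) = a * D4 p q r s.
Proof.
have D0 : D4 p q r 0 = 0.
  by apply: (addrI (D4 p q r 0)); rewrite -D4_D3 !addr0.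
by have := D4_lin3 a p q r s 0; rewrite D0 !addr0.
Qed.

Lemma D4_sw01 p q r s : D4 q p r s = - D4 p q r s.
Proof.
apply/eqP; rewrite -addr_eq0; have := D4_alt01 (p + q) r s.
by rewrite D4_D0 !D4_D1 !D4_alt01 add0r addr0 addrC => ->.
Qed.
Lemma D4_sw12 p q r s : D4 p r q s = - D4 p q r s.
Proof.
apply/eqP; rewrite -addr_eq0; have := D4_alt12 (q + r) s p.
by rewrite D4_D1 !D4_D2 !D4_alt12 add0r addr0 addrC => ->.
Qed.
Lemma D4_sw23 p q r s : D4 p q s r = - D4 p q r s.
Proof.
apply/eqP; rewrite -addr_eq0; have := D4_alt23 (r + s) p q.
by rewrite D4_D2 !D4_D3 !D4_alt23 add0r addr0 addrC => ->.
Qed.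

Lemma D4_cyc p q r s : D4 p r s q = D4 p q r s.
Proof. by rewrite D4_sw23 D4_sw12 opprK. Qed.

Local Notation D := (D4 1).

(** The first entry of the determinant is 1, so scalars added to the other entries do not
    contribute. *)
Lemma D4_affine1 a b q r s : D (iota a * q - iota b) r s = a * D q r s.
Proof.
rewrite D4_lin1 -[- _]addr0 -rmorphN -[iota (- b)]mulr1 D4_lin1 D4_alt01 mulr0 add0r.
by have := D4_D1 1 0 0 r s; rewrite addr0 => /eqP; rewrite -subr_eq0 opprD addrA subrr
  add0r oppr_eq0 => /eqP ->; rewrite addr0.
Qed.
Lemma D4_affine2 a b q r s : D r (iota a * q - iota b) s = a * D r q s.
Proof. by rewrite !(D4_sw12 1 _ r) D4_affine1 mulrN. Qed.
Lemma D4_affine3 a b q r s : D r s (iota a * q - iota b) = a * D r s q.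
Proof. by rewrite !(D4_sw23 1 r _ s) D4_affine2 mulrN. Qed.

Section Ideal.
Variable J : R -> Prop.
Hypothesis JD : forall a b, J a -> J b -> J (a + b).
Hypothesis JM : forall a b, J b -> J (a * b).
Hypothesis Jc : forall x y, J (D x y (x * y)).

Let J_eq a b : J a -> a = b -> J b. Proof. by move=> h <-. Qed.
Let JN a : J a -> J (- a).
Proof. by move=> Ja; apply: J_eq (JM (-1) Ja) _; rewrite mulN1r. Qed.
Let JB a b : J a -> J b -> J (a - b).
Proof. by move=> Ja Jb; apply: JD (JN _). Qed.

Let J0 : J 0.
Proof. by apply: J_eq (JM 0 (Jc 0 0)) _; rewrite mul0r. Qed.

(** This and the next three lemmas polarize the quadratic conditions [Jc], first in y and then in x,
    and specialize the results. *)
Lemma Jc2 x y z : J (D x y (x * z) + D x z (x * y)).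
Proof.
apply: J_eq (JB (Jc x (y + z)) (JD (Jc x y) (Jc x z))) _.
by rewrite mulrDr D4_D2 !D4_D3; ring.
Qed.

Lemma Jc_sq x y : J (D x y (x * x)).
Proof. by apply: J_eq (Jc2 x y x) _; rewrite D4_alt12 addr0. Qed.

Lemma Jc3 x x' y z :
  J (D x y (x' * z) + D x' y (x * z) + D x z (x' * y) + D x' z (x * y)).
Proof.
apply: J_eq (JB (Jc2 (x + x') y z) (JD (Jc2 x y z) (Jc2 x' y z))) _.
by rewrite !mulrDl !D4_D1 !D4_D3; ring.
Qed.

Lemma Jc_sq2 x x' y : J (D x' y (x * x) + D x y (x * x') *+ 2).
Proof.
apply: J_eq (JD (Jc3 x x' y x) (Jc2 x y x')) _.
by rewrite (mulrC x' x) D4_alt12 (D4_sw12 1 x x'); ring.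
Qed.

Section Chart.
Variables x y z : S.
Let c := D x y z.
Hypothesis sat : forall r, J (c * r) -> J r.

(** Membership in the ideal J S: the coordinates of s in the basis e are the l(s f_i). *)
Let JS s := forall t, J (l (s * t)).
Let JS_eq a b : JS a -> a = b -> JS b. Proof. by move=> h <-. Qed.
Let JSD a b : JS a -> JS b -> JS (a + b).
Proof. by move=> Ja Jb t; rewrite mulrDl lD; apply: JD. Qed.
Let JSM a b : JS b -> JS (a * b).
Proof. by move=> Jb t; rewrite mulrAC mulrC. Qed.
Let JSB a b : JS a -> JS b -> JS (a - b).
Proof. by move=> Ja Jb; apply: JSD => //; rewrite -mulN1r; apply: JSM. Qed.
Let JSZ j s : J j -> JS (iota j * s).
Proof. by move=> Jj t; rewrite -mulrA lZ mulrC; apply: JM. Qed.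

Let J_sum I (r : seq I) (F : I -> R) : (forall i, J (F i)) -> J (\sum_(i <- r) F i).
Proof. by move=> h; elim/big_ind: _. Qed.
Let JS_dv v i : JS (v i) -> J (dv l f v).
Proof.
move=> Jv; rewrite /dv (expand_det_row _ i); apply: J_sum => j.
by rewrite mxE mulrC; apply/JM/Jv.
Qed.

Let cram p q r s : iota (D p q r) * s =
  iota (D4 s p q r) + iota (D s q r) * p + iota (D p s r) * q + iota (D p q s) * r.
Proof.
rewrite /D4 (cramer lD lZ e_basis lef) sum4 /= mulr1.
have E v w : v =1 w -> dv l f v = dv l f w.
  by move=> vw; congr dv; apply: functional_extensionality_dep.
rewrite (E (upd _ i0 s) (fun i => [:: s; p; q; r]`_i)); last by case=> [[|[|[|[|]]]]].
rewrite (E (upd _ i1 s) (fun i => [:: 1; s; q; r]`_i)); last by case=> [[|[|[|[|]]]]].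
rewrite (E (upd _ i2 s) (fun i => [:: 1; p; s; r]`_i)); last by case=> [[|[|[|[|]]]]].
rewrite (E (upd _ i3 s) (fun i => [:: 1; p; q; s]`_i)); last by case=> [[|[|[|[|]]]]].
by [].
Qed.

(** By Cramer in the frame 1, x, y, z, modulo J the element c x y has no z-coordinate and equals a
    scalar plus py x + px y. Hence X Y, with X = c x - px and Y = c y - py, is a scalar modulo J S.
    With the analogous pz, the polarized conditions give the same for all products of X, Y, Z. *)
Let px := D x (x * y) z.
Let py := D (x * y) y z.
Let pz := D x (y * z) z.
Let X := iota c * x - iota px.
Let Y := iota c * y - iota py.
Let Z := iota c * z - iota pz.

Let scal s := exists n, JS (s - iota n).

Let XX : scal (X * X).
Proof.
exists (c * D4 (x * x) x y z + px ^+ 2).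
have := cram x y z (x * x); rewrite -/c => h.
have J1 : J (D (x * x) y z - px *+ 2).
  apply: J_eq (Jc_sq2 x y z) _; rewrite /px (D4_cyc 1 (x * x)) (D4_sw23 1 x (x * y)).
  by ring.
have J2 : J (D x (x * x) z).
  by apply: J_eq (JN (Jc_sq x z)) _; rewrite (D4_sw23 1 x (x * x)) opprK.
have := JSM (iota c) (JSD (JSD (JSZ x J1) (JSZ y J2)) (JSZ z (Jc_sq x y))).
move/JS_eq; apply; rewrite /X.
rewrite (_ : (iota c * x - iota px) * (iota c * x - iota px) =
  iota c * (iota c * (x * x)) - (iota c * x * iota px) *+ 2 + iota px ^+ 2); last by ring.
by rewrite h; ring.
Qed.

Let XY : scal (X * Y).
Proof.
exists (c * D4 (x * y) x y z + px * py).
have := cram x y z (x * y); rewrite -/c -/px -/py => h.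
have := JSM (iota c) (JSZ z (Jc x y)).
move/JS_eq; apply; rewrite /X /Y.
rewrite (_ : (iota c * x - iota px) * (iota c * y - iota py) =
  iota c * (iota c * (x * y)) - iota c * x * iota py - iota c * y * iota px
  + iota px * iota py); last by ring.
by rewrite h; ring.
Qed.

Let XZ : scal (X * Z).
Proof.
exists (c * D4 (x * z) x y z + px * pz).
have := cram x y z (x * z); rewrite -/c => h.
have J1 : J (D (x * z) y z - pz).
  apply: J_eq (JN (Jc2 z x y)) _; rewrite /pz [x * z]mulrC [y * z]mulrC.
  rewrite -(D4_cyc 1 z x (z * y)) (D4_sw23 1 z (z * x)) -(D4_cyc 1 z (z * x)).
  by ring.
have J2 : J (D x (x * z) z).
  by apply: J_eq (JN (Jc x z)) _; rewrite (D4_sw23 1 x (x * z)) opprK.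
have J3 : J (D x y (x * z) - px).
  by apply: J_eq (Jc2 x y z) _; rewrite /px (D4_sw23 1 x (x * y)).
have := JSM (iota c) (JSD (JSD (JSZ x J1) (JSZ y J2)) (JSZ z J3)).
move/JS_eq; apply; rewrite /X /Z.
rewrite (_ : (iota c * x - iota px) * (iota c * z - iota pz) =
  iota c * (iota c * (x * z)) - iota c * x * iota pz - iota c * z * iota px
  + iota px * iota pz); last by ring.
by rewrite h; ring.
Qed.

Let YY : scal (Y * Y).
Proof.
exists (c * D4 (y * y) x y z + py ^+ 2).
have := cram x y z (y * y); rewrite -/c => h.
have J1 : J (D (y * y) y z).
  by apply: J_eq (Jc_sq y z) _; rewrite (D4_cyc 1 (y * y)).
have J2 : J (D x (y * y) z - py *+ 2).
  apply: J_eq (JN (Jc_sq2 y x z)) _.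
  by rewrite /py [x * y]mulrC (D4_sw23 1 x (y * y)) (D4_cyc 1 (y * x)); ring.
have J3 : J (D x y (y * y)).
  by apply: J_eq (JN (Jc_sq y x)) _; rewrite (D4_sw12 1 x y) opprK.
have := JSM (iota c) (JSD (JSD (JSZ x J1) (JSZ y J2)) (JSZ z J3)).
move/JS_eq; apply; rewrite /Y.
rewrite (_ : (iota c * y - iota py) * (iota c * y - iota py) =
  iota c * (iota c * (y * y)) - (iota c * y * iota py) *+ 2 + iota py ^+ 2); last by ring.
by rewrite h; ring.
Qed.

Let YZ : scal (Y * Z).
Proof.
exists (c * D4 (y * z) x y z + py * pz).
have := cram x y z (y * z); rewrite -/c -/pz => h.
have J1 : J (D (y * z) y z).
  by apply: J_eq (Jc y z) _; rewrite (D4_cyc 1 (y * z)).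
have J3 : J (D x y (y * z) - py).
  apply: J_eq (JN (Jc2 y z x)) _; rewrite /py [x * y]mulrC.
  by rewrite (D4_cyc 1 (y * x)) (D4_sw12 1 x y); ring.
have := JSM (iota c) (JSD (JSZ x J1) (JSZ z J3)).
move/JS_eq; apply; rewrite /Y /Z.
rewrite (_ : (iota c * y - iota py) * (iota c * z - iota pz) =
  iota c * (iota c * (y * z)) - iota c * y * iota pz - iota c * z * iota py
  + iota py * iota pz); last by ring.
by rewrite h; ring.
Qed.

Let dXYZ : D X Y Z = c ^+ 4.
Proof. by rewrite D4_affine1 D4_affine2 D4_affine3 -/c; ring. Qed.

Let sat4 r : J (r * c ^+ 4) -> J r.
Proof. by move=> h; do 4 apply: sat; apply: J_eq h _; ring. Qed.

Let JS_D1 s q r : JS s -> J (D s q r).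
Proof. exact: (@JS_dv (fun i => [:: 1; s; q; r]`_i) i1). Qed.
Let JS_D2 s q r : JS s -> J (D q s r).
Proof. exact: (@JS_dv (fun i => [:: 1; q; s; r]`_i) i2). Qed.

(** X, Y, Z are independent modulo J: the determinant of 1, X, Y, Z is c^4, and c can be cancelled
    modulo J. *)
Let JX n : JS (iota n * X) -> J n.
Proof.
move=> h; apply: sat4; apply: J_eq (JS_D1 Y Z h) _.
by have := D4_affine1 n 0 X Y Z; rewrite rmorph0 subr0 dXYZ.
Qed.

Let JXY n m : JS (iota n * Y - iota m * X) -> J n /\ J m.
Proof.
move=> h.
have Jn : J n.
  apply: sat4; apply: J_eq (JS_D2 X Z h) _; rewrite D4_lin2 dXYZ.
  have := D4_affine2 (- m) 0 X X Z; rewrite rmorph0 subr0 rmorphN mulNr => ->.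
  by rewrite D4_alt12 mulr0 addr0.
split=> //; apply: JX; apply: JS_eq (JSB (JSZ Y Jn) h) _; ring.
Qed.

(* The products of X, Y, Z are scalars modulo J; associativity kills them.    *)
Lemma chart_unit : J 1.
Proof.
have [nxx hxx] := XX; have [nxy hxy] := XY; have [nxz hxz] := XZ.
have [nyy hyy] := YY; have [nyz hyz] := YZ.
(* Associativity X (X Y) = (X X) Y reads nxy X = nxx Y modulo J S, and X, Y are independent. The
   remaining products are treated in the same way. *)
have [Jxx Jxy] : J nxx /\ J nxy.
  by apply: JXY; apply: JS_eq (JSB (JSM X hxy) (JSM Y hxx)) _; ring.
have red s n : J n -> JS (s - iota n) -> JS s.
  by move=> Jn h; apply: JS_eq (JSD h (JSZ 1 Jn)) _; ring.
have {hxx} hxx := red _ _ Jxx hxx; have {hxy} hxy := red _ _ Jxy hxy.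
have Jxz : J nxz.
  by apply: JX; apply: JS_eq (JSB (JSM Z hxx) (JSM X hxz)) _; ring.
have Jyy : J nyy.
  by apply: JX; apply: JS_eq (JSB (JSM Y hxy) (JSM X hyy)) _; ring.
have Jyz : J nyz.
  by apply: JX; apply: JS_eq (JSB (JSM Z hxy) (JSM X hyz)) _; ring.
have {hxz} hxz := red _ _ Jxz hxz; have {hyy} hyy := red _ _ Jyy hyy.
have {hyz} hyz := red _ _ Jyz hyz.
(* With all products of X, Y, Z zero, multiplication by t only sees the 1-coordinate of t. Thus X
   and Y are eigenvectors with the same eigenvalue, that is, socle elements. *)
have hX t : JS (iota (c ^+ 4) * t * X - iota (D4 t X Y Z) * X).
  rewrite -dXYZ cram.
  apply: JS_eq (JSD (JSD (JSM (iota (D t Y Z)) hxx) (JSM (iota (D X t Z)) hxy))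
    (JSM (iota (D X Y t)) hxz)) _; ring.
have hY t : JS (iota (c ^+ 4) * t * Y - iota (D4 t X Y Z) * Y).
  rewrite -dXYZ cram.
  apply: JS_eq (JSD (JSD (JSM (iota (D t Y Z)) hxy) (JSM (iota (D X t Z)) hyy))
    (JSM (iota (D X Y t)) hyz)) _; ring.
have lX t : J (l (X * t) * c ^+ 4 - D4 t X Y Z * l X).
  apply: J_eq (hX t 1) _; rewrite mulr1 lD (lN lD) lZ -mulrA lZ [t * X]mulrC; ring.
have lY t : J (l (Y * t) * c ^+ 4 - D4 t X Y Z * l Y).
  apply: J_eq (hY t 1) _; rewrite mulr1 lD (lN lD) lZ -mulrA lZ [t * Y]mulrC; ring.
(* The functionals l(X t) and l(Y t) of t are proportional to one character, with factors l(X) and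
   l(Y). So l kills all multiples of l(X) Y - l(Y) X, which is then zero modulo J S; independence of
   X and Y concludes. *)
have [JlX JlY] : J (l X) /\ J (l Y).
  apply: JXY => t; apply: sat4.
  rewrite mulrBl lD (lN lD) -!mulrA !lZ.
  by apply: J_eq (JB (JM (l X) (lY t)) (JM (l Y) (lX t))) _; ring.
have JSY : JS Y.
  move=> t; apply: sat4.
  by apply: J_eq (JD (lY t) (JM (D4 t X Y Z) JlY)) _; ring.
by apply: sat4; apply: J_eq (JS_D2 X Z JSY) _; rewrite dXYZ mul1r.
Qed.

End Chart.
End Ideal.

(* In a chart, i.e. after inverting c = det(1, x, y, z), the previous lemma   *)
(* applies to the c-saturation of J.                                           *)
Lemma chart_pow (J : R -> Prop) x y z :
  (forall a b, J a -> J b -> J (a + b)) -> (forall a b, J b -> J (a * b)) ->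
  (forall x y, J (D x y (x * y))) -> exists n, J (D x y z ^+ n).
Proof.
move=> JD JM Jc.
suff [n Jn] : exists n, J (D x y z ^+ n * 1) by exists n; rewrite -[_ ^+ n]mulr1.
apply: (@chart_unit (fun r => exists n, J (D x y z ^+ n * r)) _ _ _ x y z).
- move=> a b [n Ja] [m Jb]; exists (n + m)%N; rewrite mulrDr exprD.
  by apply: JD; [rewrite [_ ^+ n * _]mulrC|]; rewrite -mulrA; apply: JM.
- by move=> a b [n Jb]; exists n; rewrite mulrCA; apply: JM.
- by move=> p q; exists 0%N; rewrite mul1r.
- by move=> r [n Jr]; exists n.+1; rewrite exprSr -mulrA.
Qed.

Definition radical (J : R -> Prop) r := exists n, J (r ^+ n).

Lemma radicalD (J : R -> Prop) a b :
  (forall a b, J a -> J b -> J (a + b)) -> (forall a b, J b -> J (a * b)) ->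
  radical J a -> radical J b -> radical J (a + b).
Proof.
move=> JD JM [n Ja] [m Jb]; exists (n + m)%N; rewrite exprDn.
have J0 : J 0 by rewrite -(mul0r (a ^+ n)); apply: JM.
apply: (big_ind J) => // i _; rewrite -mulr_natl; apply: (JM).
have [mi|im] := leqP m i; first by rewrite -(subnK mi) exprD mulrA; apply: JM.
have ni : (n <= n + m - i)%N by rewrite -addnBA ?leq_addr // ltnW.
by rewrite -(subnK ni) exprD mulrAC; apply: JM.
Qed.

Lemma radicalM (J : R -> Prop) a b :
  (forall a b, J b -> J (a * b)) -> radical J b -> radical J (a * b).
Proof. by move=> JM [n Jb]; exists n; rewrite exprMn; apply: JM. Qed.

(** The radical of J contains every det(1, x, y, z) by [chart_pow], hence the coordinates of 1 in
    the basis e, which up to sign are such determinants. Therefore it contains 1 = l(1 e_0 f_0). *)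
Lemma discriminants_unimodular (J : R -> Prop) :
  (forall a b, J a -> J b -> J (a + b)) -> (forall a b, J b -> J (a * b)) ->
  (forall x y, J (D x y (x * y))) -> J 1.
Proof.
move=> JD JM Jc; have h x y z : radical J (D x y z) by exact: chart_pow.
suff [n] : radical J 1 by rewrite expr1n.
have d1 : D4 (e i0) (e i1) (e i2) (e i3) = 1.
  rewrite -[RHS](dv_e lef); congr dv; apply: functional_extensionality_dep.
  by case=> [[|[|[|[|]]]]] // ?; congr e; apply: val_inj.
pose u i := l (1 * f i).
have E : 1 = iota (u i0) * e i0 + iota (u i1) * e i1 + iota (u i2) * e i2 +
    iota (u i3) * e i3.
  by rewrite [LHS](expand_e lD lZ e_basis lef) sum4.
have rN r : radical J r -> radical J (- r).
  by move=> hr; rewrite -mulN1r; apply: radicalM.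
have D00 p q r : D4 0 p q r = 0.
  by have := D4_D0 0 0 p q r; rewrite addr0 => /eqP;
    rewrite -subr_eq0 opprD addrA subrr add0r oppr_eq0 => /eqP.
have D0E p q r : D p q r = u i0 * D4 (e i0) p q r + u i1 * D4 (e i1) p q r +
    u i2 * D4 (e i2) p q r + u i3 * D4 (e i3) p q r.
  rewrite {1}E -!addrA !D4_lin0 -[iota (u i3) * _]addr0 D4_lin0 D00 addr0.
  by rewrite !addrA.
have h0 : radical J (u i0).
  have := h (e i1) (e i2) (e i3); rewrite D0E d1.
  by rewrite D4_alt01 D4_alt02 D4_alt03 !mulr0 !addr0 mulr1.
have h1 : radical J (u i1).
  have := rN _ (h (e i0) (e i2) (e i3)); rewrite D0E D4_alt01 D4_alt02 D4_alt03.
  by rewrite (D4_sw01 (e i0)) d1 !mulr0 !addr0 add0r mulrN mulr1 opprK.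
have h2 : radical J (u i2).
  have := h (e i0) (e i1) (e i3); rewrite D0E D4_alt01 D4_alt02 D4_alt03.
  rewrite (D4_sw01 (e i0)) (D4_sw12 (e i0) (e i1)) d1 !mulr0 !addr0 !add0r opprK.
  by rewrite mulr1.
have h3 : radical J (u i3).
  have := rN _ (h (e i0) (e i1) (e i2)); rewrite D0E D4_alt01 D4_alt02 D4_alt03.
  rewrite (D4_sw01 (e i0)) (D4_sw12 (e i0) (e i1)) (D4_sw23 (e i0) (e i1)) d1.
  by rewrite !mulr0 !add0r opprK mulrN mulr1 opprK.
have lg : l (1 * (e i0 * f i0)) = 1 by rewrite mul1r lef eqxx.
rewrite -lg E !mulrDl !lD -!mulrA !lZ ![u _ * _]mulrC.
by do 3 (apply: radicalD => //; last exact: radicalM); exact: radicalM.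
Qed.

(** The radical of the ideal generated by the N-th powers contains all discriminants, so it contains
    1, and then the ideal does too. *)
Lemma discriminants_pow (N : nat) :
  exists s : seq (R * (S * S)),
    \sum_(p <- s) p.1 * D p.2.1 p.2.2 (p.2.1 * p.2.2) ^+ N = 1.
Proof.
pose J k r := exists s : seq (R * (S * S)),
  \sum_(p <- s) p.1 * D p.2.1 p.2.2 (p.2.1 * p.2.2) ^+ k = r.
have JD k a b : J k a -> J k b -> J k (a + b).
  by move=> [s sa] [t tb]; exists (s ++ t); rewrite big_cat sa tb.
have JM k a b : J k b -> J k (a * b).
  move=> [s sb]; exists [seq (a * p.1, p.2) | p <- s]; rewrite big_map -sb mulr_sumr.
  by apply: eq_bigr => p _; rewrite mulrA.
suff [n] : radical (J N) 1 by rewrite expr1n.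
apply: (@discriminants_unimodular (radical (J N))).
- by move=> a b; apply: radicalD; [exact: JD|exact: JM].
- by move=> a b; apply: radicalM; exact: JM.
- by move=> x y; exists N, [:: (1, (x, y))]; rewrite big_seq1 mul1r.
Qed.
End Unimodular.

(** * The preprojective algebra *)

Section PreprojectiveAlgebra.
Variables (R S : comPzRingType) (iota : {rmorphism R -> S}) (n : nat).
Variables (e f : 'I_n -> S).

Local Notation B := (R * S)%type.
Definition arrows : bimodule B := bsum (bimM iota) (bimN iota).
Local Notation rel := (@preproj_rel R S iota n e f : set (talg arrows)).
Local Notation A := (preproj iota e f).

Definition vM (s : S) : arrows := ((s : bimM iota), (0 : bimN iota)).
Definition vN (s : S) : arrows := ((0 : bimM iota), (s : bimN iota)).

Lemma arrowE (v : arrows) : v = vM v.1 + vN v.2.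
Proof.
case: v => v w; rewrite -[LHS]/((v : bimM iota), (w : bimN iota)).
by apply/eqP; rewrite xpair_eqE /= addr0 add0r !eqxx.
Qed.

Lemma vMD s t : vM (s + t) = vM s + vM t.
Proof. by apply/eqP; rewrite xpair_eqE /= addr0 !eqxx. Qed.
Lemma vND s t : vN (s + t) = vN s + vN t.
Proof. by apply/eqP; rewrite xpair_eqE /= addr0 !eqxx. Qed.
Lemma vM_ract s b : ract (vM s) b = vM (s * b.2).
Proof. by apply/eqP; rewrite xpair_eqE /= /bimM_ract /bimN_ract mul0r !eqxx. Qed.
Lemma vN_ract s b : ract (vN s) b = vN (s * iota b.1).
Proof. by apply/eqP; rewrite xpair_eqE /= /bimM_ract /bimN_ract mul0r !eqxx. Qed.
Lemma vM_scale b s : b *: vM s = vM (iota b.1 * s).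
Proof. by apply/eqP; rewrite xpair_eqE /= scaler0 !eqxx. Qed.
Lemma vN_scale b s : b *: vN s = vN (b.2 * s).
Proof. by apply/eqP; rewrite xpair_eqE /= scaler0 !eqxx. Qed.

Definition qb (b : B) : A := jb rel b.
Definition qm (s : S) : A := jv rel (vM s).
Definition qn (s : S) : A := jv rel (vN s).
Lemma qmD s t : qm (s + t) = qm s + qm t.
Proof. by rewrite /qm vMD jvD. Qed.
Lemma qnD s t : qn (s + t) = qn s + qn t.
Proof. by rewrite /qn vND jvD. Qed.
Lemma qm_qb s b : qm s * qb b = qm (s * b.2).
Proof. by rewrite -[LHS]jv_ract vM_ract. Qed.
Lemma qn_qb s b : qn s * qb b = qn (s * iota b.1).
Proof. by rewrite -[LHS]jv_ract vN_ract. Qed.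
Lemma qb_qm b s : qb b * qm s = qm (iota b.1 * s).
Proof. by rewrite -[LHS]jvZ vM_scale. Qed.
Lemma qb_qn b s : qb b * qn s = qn (b.2 * s).
Proof. by rewrite -[LHS]jvZ vN_scale. Qed.

Lemma qm1_qn1 : qm 1 * qn 1 = 0.
Proof. by rewrite -[LHS]qpiM qpi_rel //; left. Qed.

Lemma qpi_sum I (r : seq I) (F : I -> talg arrows) :
  qpi rel (\sum_(i <- r) F i) = \sum_(i <- r) qpi rel (F i).
Proof. by apply: (big_morph (qpi rel)) => // x y; exact: qpiD. Qed.

Lemma casimir_q0 : \sum_i qn (e i) * qm (f i) = 0.
Proof.
rewrite -[RHS](@qpi_rel _ _ rel (\sum_i inN iota (e i) * inM iota (f i))); last by right.
by rewrite qpi_sum; apply: eq_bigr => i _; rewrite qpiM.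
Qed.

Lemma preproj_ind (P : A -> Prop) :
    (forall x y, P x -> P y -> P (x + y)) -> (forall b, P (qb b)) ->
    (forall s x, P x -> P (qm s * x)) -> (forall s x, P x -> P (qn s * x)) ->
  forall x, P x.
Proof.
move=> PD Pb Pm Pn; apply: quot_ind => // v x Px.
by rewrite [v]arrowE jvD mulrDl; apply: PD; [exact: Pm|exact: Pn].
Qed.

(** A [vact] of [arrows], given by its parts on M and on N. *)
Record mnact (Z : lmodType B) := MNAct {
  aM : S -> Z -> Z;
  aN : S -> Z -> Z;
  aMDl : forall s t z, aM (s + t) z = aM s z + aM t z;
  aNDl : forall s t z, aN (s + t) z = aN s z + aN t z;
  aMDr : forall s y z, aM s (y + z) = aM s y + aM s z;
  aNDr : forall s y z, aN s (y + z) = aN s y + aN s z;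
  aMA : forall s b z, aM (s * b.2) z = aM s (b *: z);
  aNA : forall s b z, aN (s * iota b.1) z = aN s (b *: z);
  aMZ : forall b s z, aM (iota b.1 * s) z = b *: aM s z;
  aNZ : forall b s z, aN (b.2 * s) z = b *: aN s z }.

Section MNAct.
Variables (Z : lmodType B) (al : mnact Z).

Definition mn_fun (v : arrows) (z : Z) : Z := aM al v.1 z + aN al v.2 z.
Lemma mn_Dl u v z : mn_fun (u + v) z = mn_fun u z + mn_fun v z.
Proof. by rewrite /mn_fun aMDl aNDl addrACA. Qed.
Lemma mn_Dr v y z : mn_fun v (y + z) = mn_fun v y + mn_fun v z.
Proof. by rewrite /mn_fun aMDr aNDr addrACA. Qed.
Lemma mn_A v b z : mn_fun (ract v b) z = mn_fun v (b *: z).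
Proof. by rewrite /mn_fun -aMA -aNA. Qed.
Lemma mn_Z b v z : mn_fun (b *: v) z = b *: mn_fun v z.
Proof. by rewrite /mn_fun scalerDr -aMZ -aNZ. Qed.
Definition mn_vact : vact arrows Z := VAct mn_Dl mn_Dr mn_A mn_Z.

Lemma aM0l z : aM al 0 z = 0.
Proof. by apply: (addrI (aM al 0 z)); rewrite -aMDl !addr0. Qed.
Lemma aN0l z : aN al 0 z = 0.
Proof. by apply: (addrI (aN al 0 z)); rewrite -aNDl !addr0. Qed.
Lemma mn_vM s z : mn_vact (vM s) z = aM al s z.
Proof. by rewrite /= /mn_fun /= aN0l addr0. Qed.
Lemma mn_vN s z : mn_vact (vN s) z = aN al s z.
Proof. by rewrite /= /mn_fun /= aM0l add0r. Qed.

Hypothesis al_rel1 : forall z, aM al 1 (aN al 1 z) = 0.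
Hypothesis al_rel2 : forall z, \sum_i aN al (e i) (aM al (f i) z) = 0.

Lemma mn_rel x : rel x -> forall z, tact mn_vact x z = 0.
Proof.
have E s z : tact mn_vact (inM iota s) z = aM al s z.
  by rewrite -mn_vM -tact_tinj1.
have E' s z : tact mn_vact (inN iota s) z = aN al s z.
  by rewrite -mn_vN -tact_tinj1.
case=> -> z; first by rewrite tactM E E'.
rewrite (big_morph (fun x => tact mn_vact x z) (fun x y => tactDl _ x y z) (tact0l _ z)).
by rewrite -[RHS](al_rel2 z); apply: eq_bigr => i _; rewrite tactM E E'.
Qed.

Definition mn_qmod : qmod rel Z := QMod mn_rel.

Definition acts (a : A) (z : Z) : Z := qact mn_qmod a z.

Lemma actsDl a b z : acts (a + b) z = acts a z + acts b z.
Proof. exact: qactDl. Qed.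
Lemma actsDr a y z : acts a (y + z) = acts a y + acts a z.
Proof. exact: qactDr. Qed.
Lemma actsM a b z : acts (a * b) z = acts a (acts b z).
Proof. exact: qactM. Qed.
Lemma acts_qb b z : acts (qb b) z = b *: z.
Proof. exact: qact_jb. Qed.
Lemma acts_qm s z : acts (qm s) z = aM al s z.
Proof. by rewrite -mn_vM; exact: qact_jv. Qed.
Lemma acts_qn s z : acts (qn s) z = aN al s z.
Proof. by rewrite -mn_vN; exact: qact_jv. Qed.
End MNAct.
End PreprojectiveAlgebra.

(** * Modules over the corner at R *)

Section EModules.
Variables (R S : comPzRingType) (iota : {rmorphism R -> S}) (n : nat).
Variables (l : S -> R) (e f : 'I_n -> S).
Hypothesis lD : forall x y, l (x + y) = l x + l y.
Hypothesis lZ : forall r x, l (iota r * x) = r * l x.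
Hypothesis e_basis : is_basis iota e.
Hypothesis f_basis : is_basis iota f.
Hypothesis lef : forall i j, l (e i * f j) = (i == j)%:R.

Local Notation B := (R * S)%type.
Local Notation A := (preproj iota e f).
Local Notation rel := (@preproj_rel R S iota n e f : set (talg (arrows iota))).
Local Notation qb := (qb iota e f).
Local Notation qm := (qm iota e f).
Local Notation qn := (qn iota e f).
(** An R-module with operators X(s) standing for m(s) n(1). The axioms [eX_1] and [eX_rel] are the
    two relations of A seen in the corner e_R A e_R. *)
Record emod (G : lmodType R) := EMod {
  eX :> S -> G -> G;
  eXDl : forall s t g, eX (s + t) g = eX s g + eX t g;
  eXDr : forall s g h, eX s (g + h) = eX s g + eX s h;
  eXZl : forall r s g, eX (iota r * s) g = r *: eX s g;
  eXZr : forall r s g, eX s (r *: g) = r *: eX s g;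
  eX_1 : forall g, eX 1 g = 0;
  eX_rel : forall t g, \sum_i eX (t * e i) (eX (f i) g) = 0 }.

Section EAct.
Variables (G : lmodType R) (X : emod G).

Lemma eX0r s : X s 0 = 0.
Proof. by apply: (addrI (X s 0)); rewrite -eXDr !addr0. Qed.
Lemma eX0l g : X 0 g = 0.
Proof. by apply: (addrI (X 0 g)); rewrite -eXDl !addr0. Qed.
Lemma eX_suml I (r : seq I) (F : I -> S) g :
  X (\sum_(i <- r) F i) g = \sum_(i <- r) X (F i) g.
Proof. exact: (big_morph (fun s => X s g) (fun s t => eXDl X s t g) (eX0l g)). Qed.
Lemma eX_sumr I (r : seq I) (F : I -> G) s :
  X s (\sum_(i <- r) F i) = \sum_(i <- r) X s (F i).
Proof. exact: (big_morph (X s) (eXDr X s) (eX0r s)). Qed.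

(* The S-component is S (x)_R G, in coordinates with respect to the e_i.      *)
Local Notation Gn := (G * {ffun 'I_n -> G})%type.
Definition ind_scale (b : B) (z : Gn) : Gn :=
  (b.1 *: z.1, [ffun k => \sum_i l (b.2 * e i * f k) *: z.2 i]).

Lemma l_mul s t : l (s * t) = \sum_i l (s * f i) * l (e i * t).
Proof.
rewrite {1}(expand_e lD lZ e_basis lef s) mulr_suml (l_sum lD).
by apply: eq_bigr => i _; rewrite -mulrA lZ.
Qed.

Lemma ind_scaleA b c z : ind_scale b (ind_scale c z) = ind_scale (b * c) z.
Proof.
congr (_, _); first by rewrite /= scalerA.
apply/ffunP => k; rewrite !ffunE /=.
under eq_bigr => i _ do rewrite ffunE scaler_sumr.
rewrite exchange_big; apply: eq_bigr => j _ /=.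
under eq_bigr => i _ do rewrite scalerA.
rewrite -scaler_suml; congr (_ *: _).
rewrite -(mulrA _ c.2) (mulrC b.2) -mulrA l_mul; apply: eq_bigr => i _.
by rewrite mulrC; congr (_ * l _); ring.
Qed.
Lemma ind_scale1 : left_id 1 ind_scale.
Proof.
move=> [g u]; congr (_, _); first exact: scale1r.
apply/ffunP => k; rewrite !ffunE /= (bigD1 k) //= mul1r lef eqxx scale1r.
by rewrite big1 ?addr0 // => i ik; rewrite mul1r lef (negPf ik) scale0r.
Qed.
Lemma ind_scaleDr : right_distributive ind_scale +%R.
Proof.
move=> b y z; congr (_, _); first exact: scalerDr.
apply/ffunP => k; rewrite !ffunE -big_split; apply: eq_bigr => i _.
by rewrite /= ffunE scalerDr.
Qed.
Lemma ind_scaleDl z : {morph ind_scale^~ z : b c / b + c}.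
Proof.
move=> b c; congr (_, _); first exact: scalerDl.
apply/ffunP => k; rewrite !ffunE -big_split; apply: eq_bigr => i _.
by rewrite /= !mulrDl lD scalerDl.
Qed.
Definition ind_sort : Type := Gn.
HB.instance Definition _ := GRing.Zmodule.on ind_sort.
Definition ind_mod : lmodType B := HB.pack_for (lmodType B) ind_sort
  (GRing.Zmodule_isLmodule.Build B ind_sort
    ind_scaleA ind_scale1 ind_scaleDr ind_scaleDl).

Definition ind_M (s : S) (z : ind_mod) : ind_mod :=
  (\sum_i X (s * e i) ((z : Gn).2 i), 0 : {ffun 'I_n -> G}).
Definition ind_N (s : S) (z : ind_mod) : ind_mod :=
  (0 : G, [ffun k => l (s * f k) *: (z : Gn).1]).

Lemma ind_MDl s t z : ind_M (s + t) z = ind_M s z + ind_M t z.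
Proof.
congr (_, _); last by rewrite /= addr0.
by rewrite -big_split; apply: eq_bigr => i _; rewrite mulrDl eXDl.
Qed.
Lemma ind_NDl s t z : ind_N (s + t) z = ind_N s z + ind_N t z.
Proof.
congr (_, _); first by rewrite /= addr0.
by apply/ffunP => k; rewrite !ffunE mulrDl lD scalerDl.
Qed.
Lemma ind_MDr s y z : ind_M s (y + z) = ind_M s y + ind_M s z.
Proof.
congr (_, _); last by rewrite /= addr0.
by rewrite -big_split; apply: eq_bigr => i _; rewrite /= ffunE eXDr.
Qed.
Lemma ind_NDr s y z : ind_N s (y + z) = ind_N s y + ind_N s z.
Proof.
congr (_, _); first by rewrite /= addr0.
by apply/ffunP => k; rewrite !ffunE scalerDr.
Qed.
Lemma ind_MA s b z : ind_M (s * b.2) z = ind_M s (b *: z).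
Proof.
congr (_, _) => /=.
under [RHS]eq_bigr => i _ do rewrite ffunE eX_sumr.
rewrite exchange_big; apply: eq_bigr => j _ /=.
rewrite -mulrA (expand_e lD lZ e_basis lef (b.2 * e j)) mulr_sumr eX_suml.
by apply: eq_bigr => i _; rewrite mulrCA eXZl eXZr -(expand_e lD lZ e_basis lef).
Qed.
Lemma ind_NA s b z : ind_N (s * iota b.1) z = ind_N s (b *: z).
Proof.
congr (_, _); apply/ffunP => k; rewrite !ffunE /= scalerA.
by rewrite mulrAC mulrC lZ mulrC.
Qed.
Lemma ind_MZ b s z : ind_M (iota b.1 * s) z = b *: ind_M s z.
Proof.
congr (_, _).
  by rewrite /= scaler_sumr; apply: eq_bigr => i _; rewrite -mulrA eXZl.
by apply/ffunP => k; rewrite !ffunE big1 // => i _; rewrite ffunE scaler0.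
Qed.
Lemma ind_NZ b s z : ind_N (b.2 * s) z = b *: ind_N s z.
Proof.
congr (_, _); first by rewrite /= scaler0.
apply/ffunP => k; rewrite !ffunE.
under eq_bigr => i _ do rewrite ffunE scalerA.
rewrite -scaler_suml; congr (_ *: _).
rewrite mulrAC (mulrC _ s) l_mul; apply: eq_bigr => i _; rewrite mulrC.
by congr (l _ * _); ring.
Qed.

Definition ind_act : mnact iota ind_mod :=
  MNAct ind_MDl ind_NDl ind_MDr ind_NDr ind_MA ind_NA ind_MZ ind_NZ.
Local Notation T z := (tact (mn_vact ind_act) z).

Lemma ind_MN s t z : ind_M s (ind_N t z) = (X (s * t) (z : Gn).1, 0 : {ffun 'I_n -> G}).
Proof.
congr (_, _); rewrite {2}(expand_e lD lZ e_basis lef t) mulr_sumr eX_suml.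
by apply: eq_bigr => i _; rewrite /= ffunE mulrCA eXZl eXZr.
Qed.

(** On G + S (x) G the relation sum_i n(e_i) m(f_i) need not act by zero, but its values lie in K,
    which all arrows kill. Instead of dividing by K, only R-components are read off, and these do
    not see K ([ind_ideal]). *)
Let K (z : ind_mod) := (z : Gn).1 = 0 /\ forall s, ind_M s z = 0.

Let K_stable x z : K z -> K (T x z).
Proof.
move=> Kz; elim/talg_ind: x => [x y [x1 x2] [y1 y2]|b|v x [x1 x2]].
- by rewrite tactDl; split=> [|s]; rewrite ?ind_MDr ?x2 ?y2 ?addr0 //= x1 y1 addr0.
- rewrite tact_tinj0; split=> [|s]; first by rewrite /= Kz.1 scaler0.
  by rewrite -ind_MA Kz.2.
- rewrite tactM tact_tinj1.
  suff -> : mn_vact ind_act v (T x z) = 0.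
    by split=> [//|s]; congr (_, _); rewrite big1 // => i _; rewrite ffunE eX0r.
  rewrite /= /mn_fun /= x2 add0r; congr (_, _).
  by apply/ffunP => k; rewrite !ffunE x1 scaler0.
Qed.

Lemma ind_ideal x z : ideal_gen rel x -> (T x z : Gn).1 = 0.
Proof.
pose I : set (talg (arrows iota)) := fun x => forall z, K (T x z).
suff [idI XI] : two_sided_ideal I /\ forall x, rel x -> I x.
  by move=> /(_ I idI XI) /(_ z) [].
have K0 : K 0.
  by split=> [//|s]; congr (_, _); rewrite big1 // => i _; rewrite ffunE eX0r.
split.
  split=> [u|y y' Iy Iy' u|a y Iy u|a y Iy u]; rewrite ?tact0l ?tactM //.
    rewrite tactDl; have [y1 y2] := Iy u; have [y1' y2'] := Iy' u.
    by split=> [|s]; rewrite ?ind_MDr ?y2 ?y2' ?addr0 //= y1 y1' addr0.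
  exact: K_stable.
have E s u : T (inM iota s) u = ind_M s u by rewrite -[RHS]/(aM ind_act s u) -mn_vM -tact_tinj1.
have E' s u : T (inN iota s) u = ind_N s u by rewrite -[RHS]/(aN ind_act s u) -mn_vN -tact_tinj1.
move=> y [] -> u; first by rewrite tactM E E' ind_MN mulr1 eX_1.
rewrite (big_morph (fun y => T y u) (fun y y' => tactDl _ y y' u) (tact0l _ u)).
pose w k := \sum_j X (f k * e j) ((u : Gn).2 j).
suff -> : \sum_i T (inN iota (e i) * inM iota (f i)) u =
    (0 : G, [ffun k => w k]) :> ind_mod.
  split=> // s; congr (_, _) => /=.
  under eq_bigr => i _ do rewrite ffunE /w eX_sumr.
  rewrite exchange_big big1 // => j _ /=.
  have := @casimir_shift _ _ _ _ _ _ _ lD lZ e_basis f_basis lef _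
    (fun x y => X (s * x) (X y ((u : Gn).2 j))) _ _ _ (e j) => H.
  transitivity (\sum_i X (s * e i) (X (e j * f i) ((u : Gn).2 j))).
    by apply: eq_bigr => i _; rewrite [f i * _]mulrC.
  rewrite -H.
  - rewrite -[RHS](eX_rel X (s * e j) ((u : Gn).2 j)).
    by apply: eq_bigr => i _; rewrite mulrA.
  - by move=> p q t; rewrite mulrDr eXDl.
  - by move=> p q t; rewrite eXDl eXDr.
  - by move=> r p q; rewrite mulrCA !eXZl eXZr.
transitivity (\sum_i ind_N (e i) (ind_M (f i) u)).
  by apply: eq_bigr => i _; rewrite tactM E E'.
have S2 (F : 'I_n -> ind_mod) : \sum_i F i = (\sum_i (F i : Gn).1, \sum_i (F i : Gn).2) :> Gn.
  by elim/big_rec3: _ => [|i p q t _ ->] //; case: (F i).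
rewrite [LHS]S2; congr (_, _); first by rewrite big1.
apply/ffunP => k; rewrite sum_ffunE ffunE (bigD1 k) //= ffunE lef eqxx scale1r.
by rewrite [X in _ + X]big1 ?addr0 // => i ik; rewrite ffunE lef (negPf ik) scale0r.
Qed.

(** The action of e_R a e_R on G, as the R-component of a applied to (g, 0). *)
Definition eact (a : A) (g : G) : G := (T (qrepr a) (g, 0 : {ffun 'I_n -> G}) : Gn).1.

Let eact_qpi x g : eact (qpi rel x) g = (T x (g, 0 : {ffun 'I_n -> G}) : Gn).1.
Proof.
apply/eqP; rewrite -subr_eq0; apply/eqP.
rewrite -(@ind_ideal _ (g, 0 : {ffun 'I_n -> G}) (@qrepr_qpi _ rel x)) tactDl.
rewrite -[RHS]/((_ : Gn).1 + (_ : Gn).1); congr (_ + _).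
apply: (addrI (T x (g, 0 : {ffun 'I_n -> G}) : Gn).1); rewrite subrr.
rewrite -[RHS]/((T x (g, 0 : {ffun 'I_n -> G}) + T (- x) (g, 0 : {ffun 'I_n -> G}) : Gn).1).
by rewrite -tactDl subrr tact0l.
Qed.

Lemma eactDl a b g : eact (a + b) g = eact a g + eact b g.
Proof. by rewrite -[a]qreprK -[b]qreprK -qpiD !eact_qpi tactDl. Qed.

Lemma eact_qbM b a g : eact (qb b * a) g = b.1 *: eact a g.
Proof.
rewrite -[a]qreprK -[qb b]/(qpi rel (tinj0 _ b)) -qpiM !eact_qpi tactM.
by rewrite tact_tinj0.
Qed.
Lemma eact_qnM s a g : eact (qn s * a) g = 0.
Proof.
rewrite -[a]qreprK -[qn s]/(qpi rel (tinj1 _)) -qpiM !eact_qpi tactM.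
by rewrite tact_tinj1 mn_vN.
Qed.
Lemma eact_qmnM s t a g : eact (qm s * qn t * a) g = X (s * t) (eact a g).
Proof.
rewrite -[a]qreprK -[qm s * qn t]/(qpi rel (tinj1 (vM iota s)) * qpi rel (tinj1 (vN iota t))).
rewrite -!qpiM !eact_qpi !tactM !tact_tinj1 mn_vM mn_vN.
by rewrite -[aM _ _ _]/(ind_M s (ind_N t _)) ind_MN.
Qed.
Lemma eact_Mqb a b g : eact (a * qb b) g = eact a (b.1 *: g).
Proof.
rewrite -[a]qreprK -[qb b]/(qpi rel (tinj0 _ b)) -qpiM !eact_qpi tactM.
rewrite tact_tinj0; congr (T _ _ : Gn).1; congr (_, _).
by apply/ffunP => k; rewrite !ffunE big1 // => i _; rewrite ffunE scaler0.
Qed.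
Lemma eact1 g : eact 1 g = g.
Proof. by rewrite -qpi1 eact_qpi tact1. Qed.
End EAct.
End EModules.

Section Interface.
Variables (R S : comPzRingType) (iota : {rmorphism R -> S}) (n : nat).
Variables (e f : 'I_n -> S).
Local Notation B := (R * S)%type.

(* Hides the construction of the preprojective algebra, which conversion      *)
(* would otherwise unfold.                                                    *)
Record pp_alg := PPAlg {
  pa :> pzRingType;
  ab : {rmorphism B -> pa};
  am : S -> pa;
  an : S -> pa;
  amD : forall s t, am (s + t) = am s + am t;
  anD : forall s t, an (s + t) = an s + an t;
  am_ab : forall s b, am s * ab b = am (s * b.2);
  an_ab : forall s b, an s * ab b = an (s * iota b.1);
  ab_am : forall b s, ab b * am s = am (iota b.1 * s);
  ab_an : forall b s, ab b * an s = an (b.2 * s);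
  am1_an1 : am 1 * an 1 = 0;
  casimir0 : \sum_i an (e i) * am (f i) = 0;
  A_ind : forall P : pa -> Prop,
    (forall x y, P x -> P y -> P (x + y)) -> (forall b, P (ab b)) ->
    (forall s x, P x -> P (am s * x)) -> (forall s x, P x -> P (an s * x)) ->
    forall x, P x;
  acts_ex : forall (Z : lmodType B) (al : mnact iota Z),
    (forall z, aM al 1 (aN al 1 z) = 0) ->
    (forall z, \sum_i aN al (e i) (aM al (f i) z) = 0) ->
    exists act : pa -> Z -> Z,
      [/\ forall a b z, act (a + b) z = act a z + act b z,
          forall a y z, act a (y + z) = act a y + act a z,
          forall a b z, act (a * b) z = act a (act b z),
          forall b z, act (ab b) z = b *: z &
          forall s z, act (am s) z = aM al s z /\ act (an s) z = aN al s z];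
  eact_ex : forall (G : lmodType R) (X : emod iota e f G),
    exists act : pa -> G -> G,
      [/\ forall a b g, act (a + b) g = act a g + act b g,
          forall b a g, act (ab b * a) g = b.1 *: act a g,
          forall s t a g, act (an s * a) g = 0 /\
            act (am s * an t * a) g = X (s * t) (act a g),
          forall a b g, act (a * ab b) g = act a (b.1 *: g) &
          forall g, act 1 g = g] }.
End Interface.

Section PreprojIsPP.
Variables (R S : comPzRingType) (iota : {rmorphism R -> S}) (n : nat).
Variables (l : S -> R) (e f : 'I_n -> S).
Hypothesis lD : forall x y, l (x + y) = l x + l y.
Hypothesis lZ : forall r x, l (iota r * x) = r * l x.
Hypothesis e_basis : is_basis iota e.
Hypothesis f_basis : is_basis iota f.
Hypothesis lef : forall i j, l (e i * f j) = (i == j)%:R.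

Lemma preproj_pp : exists A : pp_alg iota e f, pa A = preproj iota e f.
Proof.
unshelve eexists (@PPAlg _ _ _ _ _ _ (preproj iota e f)
  (jb (@preproj_rel _ _ iota n e f))
  (qm iota e f) (qn iota e f) _ _ _ _ _ _ _ _ _ _ _); last by [].
- exact: qmD.
- exact: qnD.
- exact: qm_qb.
- exact: qn_qb.
- exact: qb_qm.
- exact: qb_qn.
- exact: qm1_qn1.
- exact: casimir_q0.
- exact: preproj_ind.
- move=> Z al r1 r2; exists (acts r1 r2); split.
  + exact: actsDl.
  + exact: actsDr.
  + exact: actsM.
  + exact: acts_qb.
  + by move=> s z; split; [exact: acts_qm|exact: acts_qn].
- move=> G X; exists (eact lD lZ e_basis lef X); split.
  + exact: eactDl.
  + exact: eact_qbM.
  + by move=> s t a g; split; [exact: eact_qnM|exact: eact_qmnM].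
  + exact: eact_Mqb.
  + exact: eact1.
Qed.
End PreprojIsPP.

(** * Splitting the relation in rank 4 *)

Section RankFour.
Variables (R S : comPzRingType) (iota : {rmorphism R -> S}).
Variables (l : S -> R) (e f : 'I_4 -> S).
Hypothesis lD : forall x y, l (x + y) = l x + l y.
Hypothesis lZ : forall r x, l (iota r * x) = r * l x.
Hypothesis e_basis : is_basis iota e.
Hypothesis f_basis : is_basis iota f.
Hypothesis lef : forall i j, l (e i * f j) = (i == j)%:R.
Variable A : pp_alg iota e f.
Local Notation B := (R * S)%type.
Local Notation V := (arrows iota).
Local Notation D := (D4 l f 1).
Local Notation ab := (ab A).
Local Notation am := (am A).
Local Notation an := (an A).

Definition aS (s : S) : A := ab (0, s).
Definition aR (r : R) : A := ab (r, iota r).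
Definition eR : A := ab (1, 0).
(* Locked, so that rewriting with associativity does not look inside. *)
Definition aX (s : S) : A := locked (am s * an 1).

Lemma am0 : am 0 = 0.
Proof. by apply: (addrI (am 0)); rewrite -amD !addr0. Qed.
Lemma an0 : an 0 = 0.
Proof. by apply: (addrI (an 0)); rewrite -anD !addr0. Qed.
Lemma aSD s t : aS (s + t) = aS s + aS t.
Proof. by rewrite -(rmorphD ab); congr (ab _); apply/eqP; rewrite xpair_eqE /= addr0 !eqxx. Qed.
Lemma aSM s t : aS (s * t) = aS s * aS t.
Proof. by rewrite -(rmorphM ab); congr (ab _); apply/eqP; rewrite xpair_eqE /= mulr0 !eqxx. Qed.
Lemma aRD r s : aR (r + s) = aR r + aR s.
Proof. by rewrite /aR -(rmorphD ab) (rmorphD iota). Qed.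
Lemma aRM r s : aR (r * s) = aR r * aR s.
Proof. by rewrite /aR -(rmorphM ab) (rmorphM iota). Qed.
Lemma aR1 : aR 1 = 1.
Proof. by rewrite /aR (rmorph1 iota); exact: (rmorph1 ab). Qed.
Lemma aR0 : aR 0 = 0.
Proof. by rewrite /aR (rmorph0 iota); exact: (rmorph0 ab). Qed.
Lemma aRN r : aR (- r) = - aR r.
Proof. by apply: (addrI (aR r)); rewrite -aRD !subrr aR0. Qed.
Lemma eR_eS : eR + aS 1 = 1.
Proof.
rewrite -(rmorphD ab) -(rmorph1 ab); congr (ab _).
by apply/eqP; rewrite xpair_eqE /= addr0 add0r !eqxx.
Qed.
Lemma aR_aS r s : aR r * aS s = aS (iota r * s).
Proof. by rewrite -(rmorphM ab); congr (ab _); apply/eqP; rewrite xpair_eqE /= mulr0 !eqxx. Qed.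
Lemma ab_eR b : ab b * eR = aR b.1 * eR.
Proof.
rewrite -!(rmorphM ab); congr (ab _).
by apply/eqP; rewrite xpair_eqE /= !mulr1 !mulr0 !eqxx.
Qed.
Lemma eR_ab b : eR * ab b = aR b.1 * eR.
Proof. by rewrite -ab_eR -!(rmorphM ab) mulrC. Qed.
Lemma ab_aS b s : ab b * aS s = aS (b.2 * s).
Proof. by rewrite -(rmorphM ab); congr (ab _); apply/eqP; rewrite xpair_eqE /= mulr0 !eqxx. Qed.
Lemma aS_ab b s : aS s * ab b = aS (b.2 * s).
Proof. by rewrite -ab_aS -!(rmorphM ab) mulrC. Qed.
Lemma eR_eR : eR * eR = eR.
Proof. by rewrite eR_ab /= aR1 mul1r. Qed.
Lemma eR_aS s : eR * aS s = 0.
Proof. by rewrite ab_aS mul0r /aS rmorph0. Qed.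
Lemma aS_eR s : aS s * eR = 0.
Proof. by rewrite aS_ab mul0r /aS rmorph0. Qed.

Lemma aS_aS s t : aS s * aS t = aS (s * t).
Proof. by rewrite aSM. Qed.
Lemma am_aS s t : am s * aS t = am (s * t).
Proof. exact: am_ab. Qed.
Lemma aS_an s t : aS s * an t = an (s * t).
Proof. exact: ab_an. Qed.
Lemma aS_am s t : aS s * am t = 0.
Proof. by rewrite ab_am /= rmorph0 mul0r am0. Qed.
Lemma eR_am s : eR * am s = am s.
Proof. by rewrite ab_am /= rmorph1 mul1r. Qed.
Lemma an_eR s : an s * eR = an s.
Proof. by rewrite an_ab /= rmorph1 mulr1. Qed.
Lemma eR_an s : eR * an s = 0.
Proof. by rewrite ab_an /= mul0r an0. Qed.
Lemma am_eR s : am s * eR = 0.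
Proof. by rewrite am_ab /= mulr0 am0. Qed.
Lemma am_am s t : am s * am t = 0.
Proof. by rewrite -[s]mulr1 -am_aS -mulrA aS_am mulr0. Qed.
Lemma aR_comm r x : x * aR r = aR r * x.
Proof.
elim/(A_ind (p := A)): x => [x y hx hy|b|s x hx|s x hx].
- by rewrite mulrDl mulrDr hx hy.
- by rewrite -!(rmorphM ab) mulrC.
- by rewrite -mulrA hx !mulrA am_ab ab_am mulrC.
- by rewrite -mulrA hx !mulrA an_ab ab_an mulrC.
Qed.

Lemma aXE s t : am s * an t = aX (s * t).
Proof. by rewrite /aX -lock -am_aS -mulrA aS_an mulr1. Qed.
Lemma aX_def s : aX s = am s * an 1.
Proof. by rewrite aXE mulr1. Qed.
Lemma aXD s t : aX (s + t) = aX s + aX t.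
Proof. by rewrite !aX_def amD mulrDl. Qed.
Lemma aXZ r s : aX (iota r * s) = aR r * aX s.
Proof. by rewrite !aX_def mulrA ab_am. Qed.
Lemma aX0 : aX 0 = 0.
Proof. by rewrite aX_def am0 mul0r. Qed.
Lemma aX1 : aX 1 = 0. Proof. by rewrite aX_def am1_an1. Qed.
Lemma aX_rel t : \sum_i aX (t * e i) * aX (f i) = 0.
Proof.
transitivity (am t * (\sum_i an (e i) * am (f i)) * an 1).
  rewrite mulr_sumr mulr_suml; apply: eq_bigr => i _.
  by rewrite -aXE aX_def !mulrA.
by rewrite casimir0 mulr0 mul0r.
Qed.
Lemma eR_aX s : eR * aX s = aX s. Proof. by rewrite aX_def mulrA eR_am. Qed.
Lemma aX_eR s : aX s * eR = aX s. Proof. by rewrite aX_def -mulrA an_eR. Qed.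

(** Arrows alternate in a nonzero word, so a word from e_R to e_R is a product of elements m(s) n(t)
    = X(s t). *)
Lemma E_ind (P : A -> Prop) :
    (forall x y, P x -> P y -> P (x + y)) -> (forall r, P (aR r * eR)) ->
    (forall s y, P (eR * y * eR) -> P (aX s * (eR * y * eR))) ->
  forall y, P (eR * y * eR).
Proof.
move=> PD P1 PX y.
(* The second statement covers words that begin with some n(t) and still wait for an m(s) on their
   left. *)
suff [] : P (eR * y * eR) /\ forall s, P (am s * y * eR) by [].
have P0 : P 0 by have := P1 0; rewrite aR0 mul0r.
elim/(A_ind (p := A)): y => [x y [Ex Mx] [Ey My]|b|s y [Ey My]|s y [Ey My]].
- by split=> [|s]; rewrite mulrDr mulrDl; apply: PD.
- split=> [|s]; last by rewrite am_ab am_eR.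
  by rewrite eR_ab -mulrA eR_eR; exact: P1.
- by split=> [|t]; rewrite mulrA ?eR_am // am_am !mul0r.
- split=> [|t]; first by rewrite mulrA eR_an !mul0r.
  suff -> : am t * (an s * y) * eR = aX (t * s) * (eR * y * eR) by exact: PX.
  by rewrite !mulrA aXE aX_eR.
Qed.

Lemma aR_zmod_morphism : zmod_morphism aR.
Proof. by move=> r s; rewrite aRD aRN. Qed.
Lemma aR_monoid_morphism : monoid_morphism aR.
Proof. by split; [exact: aR1|move=> r s; exact: aRM]. Qed.
HB.instance Definition _ := GRing.isZmodMorphism.Build R A aR aR_zmod_morphism.
HB.instance Definition _ := GRing.isMonoidMorphism.Build R A aR aR_monoid_morphism.

Definition A_R : lmodType R := restr_scalars (aR : {rmorphism R -> A}) A^o.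
Definition A_B : lmodType B := restr_scalars ab A^o.
Lemma A_RE r (x : A_R) : r *: x = aR r * (x : A). Proof. by []. Qed.
Lemma A_BE b (x : A_B) : b *: x = ab b * (x : A). Proof. by []. Qed.

(** * Antiderivations of the corner *)

Record lform := LForm {
  lf :> S -> R;
  lfD : forall s t, lf (s + t) = lf s + lf t;
  lfZ : forall r s, lf (iota r * s) = r * lf s;
  lf1 : lf 1 = 0 }.

Section OneForm.
Variable phi : lform.

(** The triangular matrix with diagonal X(s), - X(s) and off-diagonal entry phi(s) encodes the rule
    d(X(s) y) = phi(s) y - X(s) d y. It respects X(1) = 0 since phi(1) = 0, and the other relation
    by the symmetry of the Casimir element. *)
Definition contr_X (s : S) (g : A_R * A_R) : A_R * A_R :=
  (aX s * g.1 : A, aR (phi s) * g.1 - aX s * g.2 : A).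

Lemma contr_XDl s t g : contr_X (s + t) g = contr_X s g + contr_X t g.
Proof.
congr (_, _); first by rewrite aXD mulrDl.
by rewrite aXD lfD aRD !mulrDl opprD addrACA.
Qed.
Lemma contr_XDr s g h : contr_X s (g + h) = contr_X s g + contr_X s h.
Proof.
congr (_, _); first exact: mulrDr.
by rewrite !mulrDr opprD addrACA.
Qed.
Lemma contr_XZl r s g : contr_X (iota r * s) g = r *: contr_X s g.
Proof.
congr (_, _); rewrite A_RE; first by rewrite aXZ -mulrA.
by rewrite aXZ lfZ aRM mulrBr !mulrA.
Qed.
Lemma contr_XZr r s g : contr_X s (r *: g) = r *: contr_X s g.
Proof.
congr (_, _); rewrite A_RE -[(r *: g).1]/(aR r * g.1) /contr_X /=.
  by rewrite mulrA (aR_comm r) -mulrA.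
rewrite A_RE mulrBr !mulrA.
by rewrite (aR_comm r (aX s)) (aR_comm r (aR (phi s))).
Qed.
Lemma contr_X1 g : contr_X 1 g = 0.
Proof.
congr (_, _); first by rewrite aX1 mul0r.
by rewrite aX1 lf1 aR0 !mul0r subr0.
Qed.

Let F x y := aR (phi x) * aX y.
Let FD1 x y z : F (x + y) z = F x z + F y z.
Proof. by rewrite /F lfD aRD mulrDl. Qed.
Let FD2 x y z : F x (y + z) = F x y + F x z.
Proof. by rewrite /F aXD mulrDr. Qed.
Let FZ r x y : F (iota r * x) y = F x (iota r * y).
Proof. by rewrite /F lfZ aXZ aRM mulrA (aR_comm r (aR (phi x))). Qed.

Lemma contr_X_rel t g : \sum_i contr_X (t * e i) (contr_X (f i) g) = 0.
Proof.
have S2 (H : 'I_4 -> A_R * A_R) : \sum_i H i = (\sum_i (H i).1, \sum_i (H i).2).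
  by elim/big_rec3: _ => [|i p q u _ ->] //; case: (H i).
rewrite S2; congr (_, _).
  transitivity ((\sum_i aX (t * e i) * aX (f i)) * g.1).
    by rewrite mulr_suml; apply: eq_bigr => i _; rewrite /= mulrA.
  by rewrite aX_rel mul0r.
transitivity ((\sum_i F (t * e i) (f i)) * g.1
  - (\sum_i F (f i) (t * e i)) * g.1
  + (\sum_i aX (t * e i) * aX (f i)) * g.2).
  rewrite !mulr_suml -sumrB -big_split; apply: eq_bigr => i _ /=.
  by rewrite /F mulrBr opprB !mulrA (aR_comm (phi (f i))) addrA addrAC.
rewrite aX_rel mul0r addr0.
rewrite (casimir_shift lD lZ e_basis f_basis lef FD1 FD2 FZ).
suff -> : \sum_i F (e i) (t * f i) = \sum_i F (f i) (t * e i) by rewrite subrr.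
apply: (@casimir_sym _ _ _ _ _ _ _ lD lZ e_basis lef _ (fun x y => F x (t * y))).
- by move=> x y z; rewrite FD1.
- by move=> x y z; rewrite mulrDr FD2.
- by move=> r x y; rewrite mulrCA FZ.
Qed.

Definition contr_emod : emod iota e f (A_R * A_R)%type :=
  EMod contr_XDl contr_XDr contr_XZl contr_XZr contr_X1 contr_X_rel.

(* Maps y in e_R A e_R to the pair (y, d y), d being the antiderivation that  *)
(* extends phi.                                                               *)
Lemma contr_pair : exists act : A -> A * A,
  [/\ forall x y, act (x + y) = act x + act y,
      forall b y, act (ab b * y) = (aR b.1 * (act y).1, aR b.1 * (act y).2),
      forall s y, act (an s * y) = 0,
      forall s y, act (aX s * y) =
        (aX s * (act y).1, aR (phi s) * (act y).1 - aX s * (act y).2) &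
      forall y, act (eR * y * eR) = act y /\ act eR = (eR, 0)].
Proof.
have [a [aD a_b a_an a_ba a1]] := eact_ex A contr_emod.
pose g : A_R * A_R := ((eR : A), (0 : A)).
exists (fun y => a y g); split=> [x y|b y|s y|s y|y].
- exact: aD.
- exact: a_b.
- by have [-> _] := a_an s 1 y g.
- by have [_] := a_an s 1 y g; rewrite aXE mulr1.
- split; first by rewrite a_ba a_b !scale1r.
  by have := a_b (1, 0) 1 g; rewrite mulr1 a1 scale1r.
Qed.

Let act := sval (cid contr_pair).
Let actP : [/\ forall x y, act (x + y) = act x + act y,
      forall b y, act (ab b * y) = (aR b.1 * (act y).1, aR b.1 * (act y).2),
      forall s y, act (an s * y) = 0,
      forall s y, act (aX s * y) =
        (aX s * (act y).1, aR (phi s) * (act y).1 - aX s * (act y).2) &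
      forall y, act (eR * y * eR) = act y /\ act eR = (eR, 0)].
Proof. exact: svalP (cid contr_pair). Qed.

Definition contr (y : A) : A := (act y).2.

Let act1 y : (act y).1 = eR * y * eR.
Proof.
have [actD act_b act_n act_X act_e] := actP.
rewrite -(act_e y).1.
apply: (E_ind (P := fun z => (act z).1 = z)) => {y} [x y hx hy|r|s y IH].
- by rewrite actD /= hx hy.
- by rewrite act_b /= (act_e 0).2.
- by rewrite act_X /= IH.
Qed.

Lemma contrD x y : contr (x + y) = contr x + contr y.
Proof. by have [actD _ _ _ _] := actP; rewrite /contr actD. Qed.
Lemma contr0 : contr 0 = 0.
Proof. by apply: (addrI (contr 0)); rewrite -contrD !addr0. Qed.
Lemma contrN x : contr (- x) = - contr x.
Proof. by apply: (addrI (contr x)); rewrite -contrD !subrr contr0. Qed.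
Lemma contr_ab b y : contr (ab b * y) = aR b.1 * contr y.
Proof. by have [_ act_b _ _ _] := actP; rewrite /contr act_b. Qed.
Lemma contrZ r y : contr (aR r * y) = aR r * contr y.
Proof. exact: contr_ab. Qed.
Lemma contr_eRE y : contr (eR * y * eR) = contr y.
Proof. by have [_ _ _ _ act_e] := actP; rewrite /contr (act_e y).1. Qed.
Lemma contr_aX s y :
  contr (aX s * y) = aR (phi s) * (eR * y * eR) - aX s * contr y.
Proof. by have [_ _ _ act_X _] := actP; rewrite /contr -act1 act_X. Qed.
Lemma contr_eR : contr eR = 0.
Proof. by have [_ _ _ _ act_e] := actP; rewrite /contr (act_e 0).2. Qed.
Lemma contr_E y : eR * contr y * eR = contr y.
Proof.
rewrite -contr_eRE; apply: (E_ind (P := fun z => eR * contr z * eR = contr z)) => {y} [x y hx hy|r|s y IH].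
- by rewrite contrD mulrDr mulrDl hx hy.
- by rewrite contrZ contr_eR !mulr0 mul0r.
- rewrite contr_aX mulrBr mulrBl; congr (_ - _).
    rewrite !mulrA (aR_comm _ eR) -!mulrA !(mulrA eR) !eR_eR -!mulrA.
    by rewrite (mulrA eR eR) eR_eR.
  by rewrite !mulrA eR_aX -[in RHS]IH !mulrA aX_eR.
Qed.

Lemma contr_contr y : contr (contr y) = 0.
Proof.
rewrite -[contr y]contr_eRE.
apply: (E_ind (P := fun z => contr (contr z) = 0)) => {y} [x y hx hy|r|s y IH].
- by rewrite !contrD hx hy addr0.
- by rewrite contrZ contr_eR mulr0 contr0.
- rewrite contr_aX contrD contrN contrZ contr_aX.
  by rewrite IH mulr0 subr0 contr_E contr_eRE subrr.
Qed.
End OneForm.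

Lemma contr_lin (phi psi chi : lform) r y : (forall s, chi s = r * phi s + psi s) ->
  contr chi y = aR r * contr phi y + contr psi y.
Proof.
move=> h; rewrite -(contr_eRE chi) -(contr_eRE phi) -(contr_eRE psi).
apply: (E_ind (P := fun z => contr chi z = aR r * contr phi z + contr psi z)) =>
  {y} [x y hx hy|a|s y IH].
- by rewrite !contrD hx hy mulrDr addrACA.
- by rewrite !contrZ !contr_eR !mulr0 addr0.
- rewrite !contr_aX h aRD aRM IH mulrDl [aX s * (_ + _)]mulrDr [aR r * (_ - _)]mulrBr.
  by rewrite !mulrA (aR_comm r (aX s)) opprD addrACA.
Qed.

(** * The grading *)

Definition shift (a : A) (g : nat -> A_B) : nat -> A_B :=
  fun k => if k is j.+1 then a * (g j : A) else 0.

Lemma shiftD a g h : shift a (g + h) = shift a g + shift a h.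
Proof. by apply/funext => -[|k]; [exact: esym (addr0 _)|exact: mulrDr]. Qed.
Lemma shiftDl a b g : shift (a + b) g = shift a g + shift b g.
Proof. by apply/funext => -[|k]; [exact: esym (addr0 _)|exact: mulrDl]. Qed.
Lemma shift_ab a b g : shift (a * ab b) g = shift a (b *: g).
Proof. by apply/funext => -[|k] //; exact: esym (mulrA _ _ _). Qed.
Lemma ab_shift a b g : shift (ab b * a) g = b *: shift a g.
Proof.
apply/funext => -[|k]; last exact: esym (mulrA _ _ _).
exact: esym (scaler0 _ b).
Qed.
Lemma shift_shift a b g : a * b = 0 -> shift a (shift b g) = 0.
Proof.
move=> ab0; apply/funext => -[|[|k]] //=; first exact: mulr0.
by rewrite mulrA ab0 mul0r.
Qed.

Definition grade_act : mnact iota (nat -> A_B).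
refine (@MNAct _ _ _ _ (fun s => shift (am s)) (fun s => shift (an s))
  _ _ _ _ _ _ _ _).
- by move=> s t z; rewrite amD shiftDl.
- by move=> s t z; rewrite anD shiftDl.
- by move=> s; exact: shiftD.
- by move=> s; exact: shiftD.
- by move=> s b z; rewrite -am_ab shift_ab.
- by move=> s b z; rewrite -an_ab shift_ab.
- by move=> b s z; rewrite -ab_am ab_shift.
- by move=> b s z; rewrite -ab_an ab_shift.
Defined.

(** Let an arrow act on sequences in A by multiplication followed by a move up one place. The
    relations are homogeneous, so A acts, and y applied to (1, 0, 0, ...) is the sequence of its
    homogeneous components. *)
Lemma grade_ex : exists p : nat -> A -> A,
  [/\ forall k x y, p k (x + y) = p k x + p k y,
      forall k b y, p k (ab b * y) = ab b * p k y,
      forall k b, p k (ab b) = if k is 0%N then ab b else 0,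
      forall s y, p 0%N (am s * y) = 0 /\ (forall k, p k.+1 (am s * y) = am s * p k y) &
      forall s y, p 0%N (an s * y) = 0 /\ (forall k, p k.+1 (an s * y) = an s * p k y)].
Proof.
have r1 z : aM grade_act 1 (aN grade_act 1 z) = 0.
  exact: shift_shift (am1_an1 A).
have r2 z : \sum_i aN grade_act (e i) (aM grade_act (f i) z) = 0.
  apply/funext => k; rewrite fct_sumE /=.
  case: k => [|[|k]] /=; first by rewrite big1.
    by rewrite big1 // => i _; exact: mulr0.
  under eq_bigr => i _ do rewrite mulrA.
  by rewrite -mulr_suml casimir0 mul0r.
have [act [actDl actDr actM act_b act_v]] := acts_ex A r1 r2.
pose g0 : nat -> A_B := fun k => if k is 0%N then (1 : A) else (0 : A).
exists (fun k y => act y g0 k); split=> [k x y|k b y|k b|s y|s y].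
- by rewrite actDl.
- by rewrite actM act_b.
- by rewrite act_b; case: k => [|k]; [exact: mulr1|exact: mulr0].
- by rewrite actM (act_v s _).1.
- by rewrite actM (act_v s _).2.
Qed.

Definition pg := sval (cid grade_ex).
Lemma pgP : [/\ forall k x y, pg k (x + y) = pg k x + pg k y,
      forall k b y, pg k (ab b * y) = ab b * pg k y,
      forall k b, pg k (ab b) = if k is 0%N then ab b else 0,
      forall s y, pg 0%N (am s * y) = 0 /\ (forall k, pg k.+1 (am s * y) = am s * pg k y) &
      forall s y, pg 0%N (an s * y) = 0 /\ (forall k, pg k.+1 (an s * y) = an s * pg k y)].
Proof. exact: svalP (cid grade_ex). Qed.

Lemma pgD k x y : pg k (x + y) = pg k x + pg k y. Proof. by case: pgP. Qed.
Lemma pg0r k : pg k 0 = 0.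
Proof. by apply: (addrI (pg k 0)); rewrite -pgD !addr0. Qed.
Lemma pg_sumr k I (r : seq I) (F : I -> A) :
  pg k (\sum_(i <- r) F i) = \sum_(i <- r) pg k (F i).
Proof. exact: (big_morph (pg k) (pgD k) (pg0r k)). Qed.
Lemma pg_abM k b y : pg k (ab b * y) = ab b * pg k y. Proof. by case: pgP. Qed.
Lemma pg_ab k b : pg k (ab b) = if k is 0%N then ab b else 0. Proof. by case: pgP. Qed.
Lemma pg0_am s y : pg 0 (am s * y) = 0. Proof. by have [_ _ _ /(_ s y)[]] := pgP. Qed.
Lemma pg0_an s y : pg 0 (an s * y) = 0. Proof. by have [_ _ _ _ /(_ s y)[]] := pgP. Qed.
Lemma pgS_am k s y : pg k.+1 (am s * y) = am s * pg k y.
Proof. by have [_ _ _ /(_ s y)[]] := pgP. Qed.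
Lemma pgS_an k s y : pg k.+1 (an s * y) = an s * pg k y.
Proof. by have [_ _ _ _ /(_ s y)[]] := pgP. Qed.
Lemma pg_aR k r y : pg k (aR r * y) = aR r * pg k y. Proof. exact: pg_abM. Qed.

Lemma pgSS_aX k s y : pg k.+2 (aX s * y) = aX s * pg k y.
Proof. by rewrite aX_def -!mulrA pgS_am pgS_an. Qed.
Lemma pg0_aX s y : pg 0 (aX s * y) = 0.
Proof. by rewrite aX_def -mulrA pg0_am. Qed.
Lemma pg1_aX s y : pg 1 (aX s * y) = 0.
Proof. by rewrite aX_def -mulrA pgS_am pg0_an mulr0. Qed.

Lemma pg_Mab k y b : pg k (y * ab b) = pg k y * ab b.
Proof.
elim/(A_ind (p := A)): y k => [x y hx hy|c|s y IH|s y IH] k.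
- by rewrite mulrDl !pgD hx hy mulrDl.
- by rewrite -rmorphM !pg_ab; case: k => [|k]; rewrite ?mul0r // rmorphM.
- by rewrite -mulrA; case: k => [|k]; rewrite ?pg0_am ?mul0r // !pgS_am IH mulrA.
- by rewrite -mulrA; case: k => [|k]; rewrite ?pg0_an ?mul0r // !pgS_an IH mulrA.
Qed.

Lemma pg_pg k m y : pg k (pg m y) = if k == m then pg m y else 0.
Proof.
elim/(A_ind (p := A)): y k m => [x y hx hy|c|s y IH|s y IH] k m.
- by rewrite pgD pgD hx hy; case: eqP => // _; rewrite addr0.
- rewrite !pg_ab; case: m => [|m]; last by rewrite pg0r if_same.
  by rewrite pg_ab; case: k.
- case: m => [|m]; first by rewrite pg0_am pg0r if_same.
  rewrite pgS_am; case: k => [|k]; first by rewrite pg0_am.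
  by rewrite pgS_am IH eqSS; case: eqP => // _; rewrite mulr0.
- case: m => [|m]; first by rewrite pg0_an pg0r if_same.
  rewrite pgS_an; case: k => [|k]; first by rewrite pg0_an.
  by rewrite pgS_an IH eqSS; case: eqP => // _; rewrite mulr0.
Qed.

Let pg_large y : exists N, forall M, (N <= M)%N ->
  pg M y = 0 /\ \sum_(k < M) pg k y = y.
Proof.
have step (T : S -> A) (T0 : forall s y, pg 0 (T s * y) = 0)
    (TS : forall k s y, pg k.+1 (T s * y) = T s * pg k y) s x :
    (exists N, forall M, (N <= M)%N -> pg M x = 0 /\ \sum_(k < M) pg k x = x) ->
    exists N, forall M, (N <= M)%N ->
      pg M (T s * x) = 0 /\ \sum_(k < M) pg k (T s * x) = T s * x.
  move=> [N h]; exists N.+1 => -[//|M]; rewrite ltnS => /h[M1 M2]; split.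
    by rewrite TS M1 mulr0.
  rewrite big_ord_recl T0 add0r -[in RHS]M2 mulr_sumr.
  by apply: eq_bigr => k _; rewrite TS.
elim/(A_ind (p := A)): y => [x y [N hN] [M hM]|b|s y|s y].
- exists (maxn N M) => k; rewrite geq_max => /andP[/hN[h1 h2] /hM[h3 h4]].
  split; first by rewrite pgD h1 h3 addr0.
  by rewrite -[RHS](congr2 +%R h2 h4) -big_split; apply: eq_bigr => i _; rewrite pgD.
- exists 1%N => -[//|M] _; split; first by rewrite pg_ab.
  by rewrite big_ord_recl pg_ab big1 ?addr0 // => i _; rewrite pg_ab.
- by apply: step; [exact: pg0_am|exact: pgS_am].
- by apply: step; [exact: pg0_an|exact: pgS_an].
Qed.

Lemma pg_bound y : exists N, forall k, (N <= k)%N -> pg k y = 0.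
Proof. by have [N h] := pg_large y; exists N => k /h[]. Qed.

Lemma pg_sum N y : (forall k, (N <= k)%N -> pg k y = 0) -> \sum_(k < N) pg k y = y.
Proof.
move=> h; have [M hM] := pg_large y.
rewrite -(sum_widen (leq_maxl N M) h).
by have [] := hM _ (leq_maxr N M).
Qed.

Definition gdeg y := sval (cid (pg_bound y)).
Lemma gdegP y k : (gdeg y <= k)%N -> pg k y = 0.
Proof. exact: (svalP (cid (pg_bound y))). Qed.

Section GradedSum.
Variables (W : zmodType) (F : nat -> A -> W).
Hypothesis FD : forall k x y, F k (x + y) = F k x + F k y.

Definition gsum y := \sum_(k < gdeg y) F k (pg k y).

Let F0 k : F k 0 = 0.
Proof. by apply: (addrI (F k 0)); rewrite -FD !addr0. Qed.

Lemma gsumE N y : (forall k, (N <= k)%N -> pg k y = 0) ->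
  gsum y = \sum_(k < N) F k (pg k y).
Proof.
move=> h; rewrite /gsum.
rewrite -(sum_widen (F := fun k => F k (pg k y)) (leq_maxl N (gdeg y))); last first.
  by move=> k /h ->.
rewrite (sum_widen (F := fun k => F k (pg k y)) (leq_maxr N (gdeg y))) //.
by move=> k /gdegP ->.
Qed.

Lemma gsumD x y : gsum (x + y) = gsum x + gsum y.
Proof.
pose N := maxn (gdeg x) (gdeg y).
have hx k : (N <= k)%N -> pg k x = 0 by rewrite geq_max => /andP[/gdegP].
have hy k : (N <= k)%N -> pg k y = 0 by rewrite geq_max => /andP[_ /gdegP].
rewrite (gsumE hx) (gsumE hy) (@gsumE N) => [|k Nk].
  by rewrite -big_split; apply: eq_bigr => k _; rewrite pgD FD.
by rewrite pgD hx // hy // addr0.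
Qed.
End GradedSum.

(** * The anti-involution exchanging m(s) and n(s) *)

Definition abc (b : B) : A^c := ab b.
Lemma abc_zmod_morphism : zmod_morphism abc.
Proof. by move=> b c; exact: (rmorphB ab). Qed.
Lemma abc_monoid_morphism : monoid_morphism abc.
Proof. by split=> [|b c]; [exact: (rmorph1 ab)|rewrite mulrC; exact: (rmorphM ab)]. Qed.
HB.instance Definition _ := GRing.isZmodMorphism.Build B A^c abc abc_zmod_morphism.
HB.instance Definition _ := GRing.isMonoidMorphism.Build B A^c abc abc_monoid_morphism.

Definition A_Bc : lmodType B := restr_scalars (abc : {rmorphism B -> A^c}) (A^c)^o.

(** A acts on itself by right multiplication with m and n exchanged, and [tau y] is y applied to 1.
    The second relation then holds in the order n(f_i) m(e_i), by the symmetry of the Casimir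
    element ([casimir_flip]). *)
Definition tau_mn : mnact iota A_Bc.
refine (@MNAct _ _ _ A_Bc (fun s (z : A) => (z * an s : A)) (fun s (z : A) => (z * am s : A))
  _ _ _ _ _ _ _ _).
- by move=> s t z; rewrite anD mulrDr.
- by move=> s t z; rewrite amD mulrDr.
- by move=> s y z; exact: (mulrDl (y : A) (z : A) (an s)).
- by move=> s y z; exact: (mulrDl (y : A) (z : A) (am s)).
- by move=> s b z; rewrite -[RHS]/((z : A) * ab b * an s) -mulrA ab_an mulrC.
- by move=> s b z; rewrite -[RHS]/((z : A) * ab b * am s) -mulrA ab_am mulrC.
- by move=> b s z; rewrite -[RHS]/((z : A) * an s * ab b) -mulrA an_ab mulrC.
- by move=> b s z; rewrite -[RHS]/((z : A) * am s * ab b) -mulrA am_ab mulrC.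
Defined.

Lemma casimir_flip : \sum_i an (f i) * am (e i) = 0.
Proof.
apply: etrans (casimir0 A); apply/esym.
apply: (casimir_sym lD lZ e_basis lef (F := fun s t => an s * am t)).
- by move=> x y z; rewrite anD mulrDl.
- by move=> x y z; rewrite amD mulrDr.
- by move=> r x y; rewrite mulrC -(an_ab _ _ (r, 0)) -(ab_am _ (r, 0)) mulrA.
Qed.

Lemma tau_ex : exists act : A -> A -> A,
  [/\ forall a b z, act (a + b) z = act a z + act b z,
      forall a b z, act (a * b) z = act a (act b z),
      forall b z, act (ab b) z = z * ab b,
      forall s z, act (am s) z = z * an s & forall s z, act (an s) z = z * am s].
Proof.
have r1 (z : A) : z * am 1 * an 1 = 0 by rewrite -mulrA am1_an1 mulr0.
have r2 (z : A) : \sum_i z * an (f i) * am (e i) = 0.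
  by under eq_bigr => i _ do rewrite -mulrA; rewrite -mulr_sumr casimir_flip mulr0.
have [act [aD _ aM a_b a_v]] := acts_ex A (al := tau_mn) r1 r2.
by exists act; split=> // s z; case: (a_v s z).
Qed.

Definition tau (y : A) : A := sval (cid tau_ex) y 1.

Lemma tauD x y : tau (x + y) = tau x + tau y.
Proof. by have [aD _ _ _ _] := svalP (cid tau_ex); exact: aD. Qed.
Lemma tau0 : tau 0 = 0.
Proof. by apply: (addrI (tau 0)); rewrite -tauD !addr0. Qed.
Lemma tauB x y : tau (x - y) = tau x - tau y.
Proof.
have h z : tau (- z) = - tau z by apply: (addrI (tau z)); rewrite -tauD !subrr tau0.
by rewrite tauD h.
Qed.
Lemma tau_sum I (r : seq I) (F : I -> A) : tau (\sum_(i <- r) F i) = \sum_(i <- r) tau (F i).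
Proof. exact: (big_morph tau tauD tau0). Qed.
Lemma tau_ab b : tau (ab b) = ab b.
Proof. by have [_ _ a_b _ _] := svalP (cid tau_ex); rewrite /tau a_b mul1r. Qed.
Lemma tau_am s : tau (am s) = an s.
Proof. by have [_ _ _ a_m _] := svalP (cid tau_ex); rewrite /tau a_m mul1r. Qed.
Lemma tau_an s : tau (an s) = am s.
Proof. by have [_ _ _ _ a_n] := svalP (cid tau_ex); rewrite /tau a_n mul1r. Qed.
Lemma tauM x y : tau (x * y) = tau y * tau x.
Proof.
have [aD aM a_b a_m a_n] := svalP (cid tau_ex).
rewrite /tau aM; move: (sval _ y 1) => z.
elim/(A_ind (p := A)): x z => [u v hu hv|b|s u IH|s u IH] z.
- by rewrite !aD hu hv mulrDr.
- by rewrite !a_b mul1r.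
- by rewrite !aM !a_m IH mulrA.
- by rewrite !aM !a_n IH mulrA.
Qed.
Lemma tauK : involutive tau.
Proof.
elim/(A_ind (p := A)) => [u v hu hv|b|s u IH|s u IH].
- by rewrite !tauD hu hv.
- by rewrite !tau_ab.
- by rewrite tauM tau_am tauM tau_an IH.
- by rewrite tauM tau_an tauM tau_am IH.
Qed.
Lemma tau_aS s : tau (aS s) = aS s. Proof. exact: tau_ab. Qed.
Lemma tau_aR r : tau (aR r) = aR r. Proof. exact: tau_ab. Qed.
Lemma tau_eR : tau eR = eR. Proof. exact: tau_ab. Qed.

Lemma pg_Mam k y s : pg k (y * am s) = if k is j.+1 then pg j y * am s else 0.
Proof.
elim/(A_ind (p := A)): y k => [x y hx hy|b|t y IH|t y IH] k.
- by rewrite mulrDl pgD hx hy; case: k => [|k]; rewrite ?addr0 // pgD mulrDl.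
- rewrite pg_abM -[am s]mulr1 -(rmorph1 ab); case: k => [|k]; rewrite ?pg0_am ?mulr0 //.
  by rewrite pgS_am !pg_ab; case: k => [|k]; rewrite ?mulr0 ?mul0r // rmorph1 mulr1.
- rewrite -mulrA; case: k => [|k]; first exact: pg0_am.
  rewrite pgS_am IH; case: k => [|k]; first by rewrite pg0_am mulr0 mul0r.
  by rewrite pgS_am mulrA.
- rewrite -mulrA; case: k => [|k]; first exact: pg0_an.
  rewrite pgS_an IH; case: k => [|k]; first by rewrite pg0_an mulr0 mul0r.
  by rewrite pgS_an mulrA.
Qed.
Lemma pg_Man k y s : pg k (y * an s) = if k is j.+1 then pg j y * an s else 0.
Proof.
elim/(A_ind (p := A)): y k => [x y hx hy|b|t y IH|t y IH] k.
- by rewrite mulrDl pgD hx hy; case: k => [|k]; rewrite ?addr0 // pgD mulrDl.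
- rewrite pg_abM -[an s]mulr1 -(rmorph1 ab); case: k => [|k]; rewrite ?pg0_an ?mulr0 //.
  by rewrite pgS_an !pg_ab; case: k => [|k]; rewrite ?mulr0 ?mul0r // rmorph1 mulr1.
- rewrite -mulrA; case: k => [|k]; first exact: pg0_am.
  rewrite pgS_am IH; case: k => [|k]; first by rewrite pg0_am mulr0 mul0r.
  by rewrite pgS_am mulrA.
- rewrite -mulrA; case: k => [|k]; first exact: pg0_an.
  rewrite pgS_an IH; case: k => [|k]; first by rewrite pg0_an mulr0 mul0r.
  by rewrite pgS_an mulrA.
Qed.

Lemma pg_tau k y : pg k (tau y) = tau (pg k y).
Proof.
elim/(A_ind (p := A)): y k => [x y hx hy|b|t y IH|t y IH] k.
- by rewrite tauD !pgD tauD hx hy.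
- by rewrite tau_ab pg_ab; case: k => [|k]; rewrite ?tau_ab ?tau0.
- rewrite tauM tau_am pg_Man; case: k => [|k]; first by rewrite pg0_am tau0.
  by rewrite IH pgS_am tauM tau_am.
- rewrite tauM tau_an pg_Mam; case: k => [|k]; first by rewrite pg0_an tau0.
  by rewrite IH pgS_an tauM tau_an.
Qed.

(** * Divided powers and division by X(x)^2 *)

Section Form.
Variable y : S.

(** At t = 1 the determinant has y twice, so the form extends to an antiderivation, written i_s
    below. Its value at s is the discriminant det(1, s, y, s y). *)
Definition disc_form (s : S) : lform.
refine (@LForm (fun t => D s y (t * y)) _ _ _).
- by move=> t u; rewrite mulrDl (D4_D3 f lD lZ).
- by move=> r t; rewrite -mulrA (D4_Z3 f lD lZ).
- by rewrite mul1r; exact: D4_alt23.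
Defined.
Local Notation i_ s := (contr (disc_form s)).

Lemma i_lin r s t z : i_ (iota r * s + t) z = aR r * i_ s z + i_ t z.
Proof. by apply: contr_lin => u; exact: (D4_lin1 f lD lZ). Qed.
Lemma i_D s t z : i_ (s + t) z = i_ s z + i_ t z.
Proof. by have := i_lin 1 s t z; rewrite rmorph1 mul1r aR1 mul1r. Qed.
Lemma i_0 z : i_ 0 z = 0.
Proof. by apply: (addrI (i_ 0 z)); rewrite -i_D !addr0. Qed.
Lemma i_Z r s z : i_ (iota r * s) z = aR r * i_ s z.
Proof. by have := i_lin r s 0 z; rewrite i_0 !addr0. Qed.
Lemma i_1 z : i_ 1 z = 0.
Proof.
rewrite -[RHS](i_0 z) -[RHS]add0r -[X in _ = X + _](mul0r (i_ 0 z)) -aR0.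
apply: contr_lin => s; rewrite mul0r add0r /= D4_alt01.
by apply: (addrI (D 0 y (s * y))); rewrite -(D4_D1 f lD lZ) !addr0.
Qed.

(** The action of X(s) + h i_s on power series in a variable h, coefficient by coefficient; [dpow k]
    is the coefficient of h^k in the resulting operator. *)
Definition dpow_X (s : S) (g : nat -> A_R) : nat -> A_R := fun k =>
  aX s * (g k : A) + (if k is j.+1 then i_ s (g j) else 0) : A.

Let prevD (T : A -> A) (TD : forall x z, T (x + z) = T x + T z) (g h : nat -> A_R) k :
  (if k is j.+1 then T ((g + h) j) else 0 : A) =
  (if k is j.+1 then T (g j) else 0) + (if k is j.+1 then T (h j) else 0).
Proof. by case: k => [|k]; [rewrite addr0|exact: TD]. Qed.

Lemma dpow_XDl s t g : dpow_X (s + t) g = dpow_X s g + dpow_X t g.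
Proof.
apply/funext => k; rewrite -[RHS]/((dpow_X s g k : A) + dpow_X t g k) /dpow_X.
rewrite aXD mulrDl addrACA; congr (_ + _).
by case: k => [|k]; [rewrite addr0|exact: i_D].
Qed.
Lemma dpow_XDr s g h : dpow_X s (g + h) = dpow_X s g + dpow_X s h.
Proof.
apply/funext => k; rewrite -[RHS]/((dpow_X s g k : A) + dpow_X s h k) /dpow_X.
rewrite (prevD (contrD _)) -[(g + h) k]/((g k : A) + h k) mulrDr addrACA.
by [].
Qed.
Lemma dpow_XZl r s g : dpow_X (iota r * s) g = r *: dpow_X s g.
Proof.
apply/funext => k; rewrite -[RHS]/(aR r * (dpow_X s g k : A)) /dpow_X.
rewrite aXZ mulrDr mulrA; congr (_ + _).
by case: k => [|k]; [rewrite mulr0|exact: i_Z].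
Qed.
Lemma dpow_XZr r s g : dpow_X s (r *: g) = r *: dpow_X s g.
Proof.
apply/funext => k; rewrite -[RHS]/(aR r * (dpow_X s g k : A)) /dpow_X.
rewrite -[(r *: g) k]/(aR r * (g k : A)) mulrA (aR_comm r) mulrDr -mulrA; congr (_ + _).
by case: k => [|k]; [rewrite mulr0|exact: contrZ].
Qed.
Lemma dpow_X1 g : dpow_X 1 g = 0.
Proof.
apply/funext => k; rewrite /dpow_X aX1 mul0r add0r.
by case: k => [|k] //; exact: i_1.
Qed.

Let alt (F : S -> S -> A) t :
  (forall x y z, F (x + y) z = F x z + F y z) ->
  (forall x y z, F x (y + z) = F x y + F x z) ->
  (forall r x y, F (iota r * x) y = F x (iota r * y)) ->
  (forall r x, F (iota r * x) x = 0) -> \sum_i F (t * e i) (f i) = 0.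
Proof. by move=> FD1 FD2 FZ F0; apply: (casimir_alt lD lZ e_basis lef). Qed.

Lemma i_i s z : i_ s (i_ s z) = 0. Proof. exact: contr_contr. Qed.

(** In degree 1 in h, moving i past X leaves a difference of two sums that agree by the symmetry of
    the Casimir element, and the sum of the det(1, t e_i, y, f_i y). After y is shifted from f_i to
    e_i, the latter is alternating and vanishes by [casimir_alt]. So does the degree 2 part, because
    i_s^2 = 0. *)
Lemma dpow_X_rel t g : \sum_i dpow_X (t * e i) (dpow_X (f i) g) = 0.
Proof.
apply/funext => k; rewrite fct_sumE.
transitivity (\sum_i (aX (t * e i) * aX (f i) * (g k : A) +
   (if k is j.+1 then (aX (t * e i) * i_ (f i) (g j) - aX (f i) * i_ (t * e i) (g j))
      + aR (D (t * e i) y (f i * y)) * (eR * (g j : A) * eR) +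
      (if j is j'.+1 then i_ (t * e i) (i_ (f i) (g j')) else 0)
    else 0)) : A).
  apply: eq_bigr => i _; rewrite /dpow_X mulrDr mulrA.
  case: k => [|k]; first by rewrite mulr0 !addr0.
  rewrite contrD contr_aX -[disc_form _ _]/(D (t * e i) y (f i * y)) -!addrA.
  congr (_ + (_ + _)); rewrite addrCA; congr (_ + (_ + _)).
  by case: k => [|k] //; exact: contr0.
rewrite big_split /= -mulr_suml aX_rel mul0r add0r.
case: k => [|j]; first by rewrite big1.
rewrite !big_split /= sumrN -mulr_suml.
have -> : \sum_(i < 4) aR (D (t * e i) y (f i * y)) = 0.
  rewrite -(big_morph aR aRD aR0) -[RHS]aR0; congr (aR _).
  transitivity (\sum_i (fun u v => D (t * u) y v) (e i) (y * f i)).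
    by apply: eq_bigr => i _; rewrite [f i * y]mulrC.
  transitivity (\sum_i (fun u v => D (t * u) y v) (y * e i) (f i)).
    apply/esym/(casimir_shift lD lZ e_basis f_basis lef (F := fun u v => D (t * u) y v)).
    - by move=> u v w; rewrite mulrDr (D4_D1 f lD lZ).
    - by move=> u v w; exact: (D4_D3 f lD lZ).
    - by move=> r u v; rewrite mulrCA (D4_Z1 f lD lZ) (D4_Z3 f lD lZ).
  transitivity (\sum_i D ((t * y) * e i) y (f i)).
    by apply: eq_bigr => i _; rewrite mulrA.
  apply: (casimir_alt lD lZ e_basis lef (F := fun u v => D u y v)).
  - by move=> u v w; exact: (D4_D1 f lD lZ).
  - by move=> u v w; exact: (D4_D3 f lD lZ).
  - by move=> r u v; rewrite (D4_Z1 f lD lZ) (D4_Z3 f lD lZ).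
  - by move=> r u; rewrite (D4_Z1 f lD lZ) D4_alt13 mulr0.
rewrite mul0r addr0.
have -> : \sum_(i < 4) (if j is j'.+1 then i_ (t * e i) (i_ (f i) (g j')) else 0) = 0.
  case: j => [|j]; first by rewrite big1.
  apply: (alt (F := fun u v => i_ u (i_ v (g j)))).
  - by move=> u v w; exact: i_D.
  - by move=> u v w; rewrite i_D contrD.
  - by move=> r u v; rewrite !i_Z contrZ.
  - by move=> r u; rewrite i_Z i_i mulr0.
rewrite addr0; apply/eqP; rewrite subr_eq0; apply/eqP.
pose F u v := aX u * i_ v (g j).
have FD1 u v w : F (u + v) w = F u w + F v w by rewrite /F aXD mulrDl.
have FD2 u v w : F u (v + w) = F u v + F u w by rewrite /F i_D mulrDr.
have FZ r u v : F (iota r * u) v = F u (iota r * v).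
  by rewrite /F aXZ i_Z mulrA (aR_comm r) .
rewrite -[LHS]/(\sum_i F (t * e i) (f i)) -[RHS]/(\sum_i F (f i) (t * e i)).
rewrite (casimir_shift lD lZ e_basis f_basis lef FD1 FD2 FZ).
apply: (casimir_sym lD lZ e_basis lef (F := fun u v => F u (t * v))).
- by move=> u v w; rewrite FD1.
- by move=> u v w; rewrite mulrDr FD2.
- by move=> r u v; rewrite mulrCA FZ.
Qed.

Definition dpow_emod : emod iota e f (nat -> A_R) :=
  EMod dpow_XDl dpow_XDr dpow_XZl dpow_XZr dpow_X1 dpow_X_rel.

Lemma dpow_ex : exists d : nat -> A -> A,
  [/\ forall k u v, d k (u + v) = d k u + d k v,
      forall k b u, d k (ab b * u) = aR b.1 * d k u,
      forall k s u, d k (aX s * u) = aX s * d k u + (if k is j.+1 then i_ s (d j u) else 0),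
      forall k u, d k (eR * u * eR) = d k u &
      forall k, d k eR = if k is 0%N then eR else 0].
Proof.
have [a [aD a_b a_an a_ba a1]] := eact_ex A dpow_emod.
pose g : nat -> A_R := fun k => if k is 0%N then eR else 0 : A.
exists (fun k u => a u g k); split=> [k u v|k b u|k s u|k u|k].
- by rewrite aD.
- by rewrite a_b.
- by have [_] := a_an s 1 u g; rewrite aXE mulr1 => ->.
- by rewrite a_ba a_b !scale1r.
- by have := a_b (1, 0) 1 g; rewrite mulr1 a1 scale1r => ->.
Qed.

Definition dpow := sval (cid dpow_ex).
Lemma dpowP : [/\ forall k u v, dpow k (u + v) = dpow k u + dpow k v,
  forall k b u, dpow k (ab b * u) = aR b.1 * dpow k u,
  forall k s u, dpow k (aX s * u) =
    aX s * dpow k u + (if k is j.+1 then i_ s (dpow j u) else 0),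
  forall k u, dpow k (eR * u * eR) = dpow k u &
  forall k, dpow k eR = if k is 0%N then eR else 0].
Proof. exact: svalP (cid dpow_ex). Qed.

Lemma dpowD k u v : dpow k (u + v) = dpow k u + dpow k v. Proof. by case: dpowP. Qed.
Lemma dpow0 k : dpow k 0 = 0.
Proof. by apply: (addrI (dpow k 0)); rewrite -dpowD !addr0. Qed.
Lemma dpowZ k r u : dpow k (aR r * u) = aR r * dpow k u.
Proof. by case: dpowP => _ /(_ k (r, iota r) u). Qed.
Lemma dpow_eRE k u : dpow k (eR * u * eR) = dpow k u. Proof. by case: dpowP. Qed.
Lemma dpow_eR k : dpow k eR = if k is 0%N then eR else 0. Proof. by case: dpowP. Qed.
Lemma dpow_aX0 s u : dpow 0 (aX s * u) = aX s * dpow 0 u.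
Proof. by case: dpowP => _ _ /(_ 0%N s u) -> _ _; rewrite addr0. Qed.
Lemma dpow_aXS k s u : dpow k.+1 (aX s * u) = aX s * dpow k.+1 u + i_ s (dpow k u).
Proof. by case: dpowP => _ _ /(_ k.+1 s u) -> _ _. Qed.

Lemma dpow_0E u : dpow 0 u = eR * u * eR.
Proof.
rewrite -dpow_eRE; apply: (E_ind (P := fun z => dpow 0 z = z)) => {u} [u v hu hv|r|s u IH].
- by rewrite dpowD hu hv.
- by rewrite dpowZ dpow_eR.
- by rewrite dpow_aX0 IH.
Qed.

Lemma dpow_E k u : eR * dpow k u * eR = dpow k u.
Proof.
rewrite -dpow_eRE.
apply: (E_ind (P := fun z => eR * dpow k z * eR = dpow k z)) => {u} [u v hu hv|r|s u IH].
- by rewrite dpowD mulrDr mulrDl hu hv.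
- rewrite dpowZ dpow_eR; case: k => [|k]; last by rewrite !mulr0 mul0r.
  by rewrite mulrA (aR_comm r) -!mulrA !eR_eR.
- have h : eR * (aX s * dpow k (eR * u * eR)) * eR = aX s * dpow k (eR * u * eR).
    by rewrite mulrA eR_aX -[in RHS]IH !mulrA aX_eR.
  case: k IH h => [|k] IH h; first by rewrite dpow_aX0.
  by rewrite dpow_aXS mulrDr mulrDl h contr_E.
Qed.

(** Since i_x X(x) + X(x) i_x = det(1, x, y, x y) and i_x^2 = 0, the square of X(x) + h i_x is
    X(x)^2 + h det(1, x, y, x y). *)
Lemma dpow_sq k x u : dpow k.+1 (aX x * (aX x * u)) =
  aX x * (aX x * dpow k.+1 u) + aR (D x y (x * y)) * dpow k u.
Proof.
have E j : i_ x (aX x * dpow j u) =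
    aR (D x y (x * y)) * dpow j u - aX x * i_ x (dpow j u).
  by rewrite contr_aX dpow_E.
rewrite !dpow_aXS; case: k => [|k].
  rewrite dpow_aX0 E mulrDr -addrA; congr (_ + _).
  by rewrite addrC subrK.
rewrite dpow_aXS contrD i_i addr0 E mulrDr -addrA; congr (_ + _).
by rewrite addrC subrK.
Qed.

(** Each X(s) has degree 2 and contributes at most one power of h. *)
Lemma dpow_pg k m u : (m < k)%N -> dpow k (pg m u) = 0.
Proof.
rewrite -dpow_eRE.
have -> : eR * pg m u * eR = pg m (eR * u * eR) by rewrite pg_Mab pg_abM.
move: k m.
apply: (E_ind (P := fun z => forall k m, (m < k)%N -> dpow k (pg m z) = 0))
  => {u} [u v hu hv|r|s u IH] k m mk.
- by rewrite pgD dpowD hu // hv // addr0.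
- rewrite pg_aR dpowZ pg_ab; case: m mk => [|m] mk; last by rewrite dpow0 mulr0.
  by rewrite dpow_eR; case: k mk => // k _; rewrite mulr0.
- case: m mk => [|[|m]] mk; rewrite ?pg0_aX ?pg1_aX ?dpow0 // pgSS_aX.
  case: k mk => // k mk; rewrite dpow_aXS !IH ?mulr0 ?contr0 ?addr0 //.
  + by rewrite -ltnS; exact: ltn_trans mk.
  + by do 2 apply: ltnW.
Qed.

(* A left inverse of multiplication by aX x ^+ 2, up to a power of            *)
(* det(1, x, y, x y).                                                         *)
Definition sqdiv x N u : A := \sum_(i < N) (-1) ^+ i *
  (aR (D x y (x * y) ^+ (N - i.+1)) * ((aX x * aX x) ^+ i * dpow i.+1 u)).

Lemma sqdivD x N u v : sqdiv x N (u + v) = sqdiv x N u + sqdiv x N v.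
Proof. by rewrite -big_split; apply: eq_bigr => i _; rewrite dpowD !mulrDr. Qed.
Lemma sqdivZ x N r u : sqdiv x N (aR r * u) = aR r * sqdiv x N u.
Proof.
rewrite mulr_sumr; apply: eq_bigr => i _.
by rewrite dpowZ !mulrA (aR_comm r) !mulrA.
Qed.
Lemma sqdiv_eRE x N u : sqdiv x N (eR * u * eR) = sqdiv x N u.
Proof. by apply: eq_bigr => i _; rewrite dpow_eRE. Qed.

Lemma sqdivK x N u : dpow N u = 0 ->
  sqdiv x N (aX x * (aX x * u)) = aR (D x y (x * y) ^+ N) * (eR * u * eR).
Proof.
move=> dN; set c := D x y (x * y).
(* By [dpow_sq] the i-th term of [sqdiv] is F i - F (i + 1). The sum telescopes to F 0 - F N, and F
   N = 0. *)
pose F i : A := (-1) ^+ i * (aR (c ^+ (N - i)) * ((aX x * aX x) ^+ i * dpow i u)).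
have F0 : F 0%N = aR (c ^+ N) * (eR * u * eR).
  by rewrite /F !expr0 subn0 !mul1r dpow_0E.
have FN : F N = 0 by rewrite /F dN !mulr0.
rewrite -F0 -[RHS]subr0 -FN -[RHS]opprB -telescope_sumr // big_mkord -sumrN.
apply: eq_bigr => i _; rewrite opprB /F dpow_sq -/c.
rewrite [aX x * (_ * _)]mulrA !mulrDr addrC; congr (_ + _).
  congr (_ * _); rewrite -[(N - i)%N](@subnSK i N) ?ltn_ord // exprSr aRM -mulrA.
  by congr (_ * _); rewrite mulrA (aR_comm c) -mulrA.
by rewrite [_ ^+ i * (_ * _)]mulrA -exprSr [(-1) ^+ i.+1]exprS mulN1r mulNr opprK.
Qed.

End Form.

(** * Recovering y from the family of the X(t) y *)

Let disc_seq m := sval (cid (discriminants_pow lD lZ e_basis lef m.+1)).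
Let disc_seqP m : \sum_(p <- disc_seq m) p.1 * D p.2.1 p.2.2 (p.2.1 * p.2.2) ^+ m.+1 = 1.
Proof. exact: svalP (cid (discriminants_pow lD lZ e_basis lef m.+1)). Qed.

(* Picks from the family t |-> aX t * y the combinations aX x * (aX x * y),    *)
(* divides by aX x ^+ 2, and adds up with coefficients given by               *)
(* discriminants_pow in each degree.                                          *)
Definition soc_term (k : 'I_4) (m : nat) (u : A) : A :=
  if m is j.+2 then pg j (\sum_(p <- disc_seq j)
    aR p.1 * sqdiv p.2.2 p.2.1 j.+1 (aX p.2.1 * (aR (l (p.2.1 * f k)) * u)))
  else 0.

Lemma soc_termD k m u v : soc_term k m (u + v) = soc_term k m u + soc_term k m v.
Proof.
case: m => [|[|j]] /=; rewrite ?addr0 // -pgD -big_split; congr (pg _).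
by apply: eq_bigr => p _; rewrite !mulrDr sqdivD mulrDr.
Qed.
Lemma soc_termZ k m r u : soc_term k m (aR r * u) = aR r * soc_term k m u.
Proof.
case: m => [|[|j]] /=; rewrite ?mulr0 // -pg_aR mulr_sumr; congr (pg _).
apply: eq_bigr => p _; rewrite [aR _ * (aR r * u)]mulrA (aR_comm r) -mulrA.
by rewrite [aX _ * _]mulrA (aR_comm r) -mulrA sqdivZ !mulrA (aR_comm r).
Qed.
Lemma soc_term_eR k m u : soc_term k m (u * eR) = soc_term k m u.
Proof.
case: m => [|[|j]] //=; congr (pg _); apply: eq_bigr => p _; congr (_ * _).
by rewrite -[RHS]sqdiv_eRE !mulrA eR_aX.
Qed.

Let sqdiv0 y x N : sqdiv y x N 0 = 0.
Proof. by apply: (addrI (sqdiv y x N 0)); rewrite -sqdivD !addr0. Qed.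

Lemma gsum_hom (W W' : zmodType) (F : nat -> A -> W) (F' : nat -> A -> W')
    (T : A -> A) (T' : W -> W') u :
  (forall k x, pg k (T x) = T (pg k x)) -> T 0 = 0 ->
  (forall x y, T' (x + y) = T' x + T' y) ->
  (forall k x y, F' k (x + y) = F' k x + F' k y) ->
  (forall k x, F' k (T x) = T' (F k x)) -> gsum F' (T u) = T' (gsum F u).
Proof.
move=> pT T0 TD FD' FT.
have T'0 : T' 0 = 0 by apply: (addrI (T' 0)); rewrite -TD !addr0.
rewrite (gsumE FD' (N := gdeg u)); last by move=> k /gdegP uk; rewrite pT uk.
by rewrite /gsum (big_morph _ TD T'0); apply: eq_bigr => k _; rewrite pT FT.
Qed.

Implicit Types (z : S -> A) (x y u : A).

(** Defined on all families z, of which it uses the values at the e_k. It is a retraction onto the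
    families t |-> X(t) y with y in e_R A e_R ([rhoE_aX]). *)
Definition rhoE z : A := eR * (\sum_k gsum (soc_term k) (z (e k))) * eR.

Lemma rhoE_ext z z' : z =1 z' -> rhoE z = rhoE z'.
Proof. by move=> h; rewrite /rhoE; under eq_bigr => k _ do rewrite h. Qed.
Lemma rhoED z z' : rhoE (fun t => z t + z' t) = rhoE z + rhoE z'.
Proof.
rewrite -mulrDl -mulrDr -big_split; congr (_ * _ * _).
by apply: eq_bigr => k _; rewrite gsumD //; exact: soc_termD.
Qed.
Lemma rhoEZ r z : rhoE (fun t => aR r * z t) = aR r * rhoE z.
Proof.
rewrite /rhoE [RHS]mulrA [aR r * _]mulrA -(aR_comm r) -[eR * aR r * _]mulrA.
congr (_ * _ * _); rewrite mulr_sumr; apply: eq_bigr => k _.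
apply: (gsum_hom (T' := fun u => aR r * u)).
- by move=> j x; exact: pg_aR.
- exact: mulr0.
- by move=> x y; exact: mulrDr.
- exact: soc_termD.
- by move=> j x; exact: soc_termZ.
Qed.
Lemma rhoE_eR z : rhoE (fun t => z t * eR) = rhoE z.
Proof.
congr (_ * _ * _); apply: eq_bigr => k _.
apply: (gsum_hom (T := fun u => u * eR) (T' := id)) => //.
- by move=> j x; exact: pg_Mab.
- exact: mul0r.
- exact: soc_termD.
- by move=> j x; exact: soc_term_eR.
Qed.
Lemma rhoE0 : rhoE (fun=> 0) = 0.
Proof. by apply: (addrI (rhoE (fun=> 0))); rewrite -rhoED !addr0. Qed.
Lemma rhoE_aS z s : rhoE (fun t => z t * aS s) = 0.
Proof.
rewrite -rhoE_eR -[RHS]rhoE0; apply: rhoE_ext => t.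
by rewrite -mulrA aS_eR mulr0.
Qed.
Lemma eR_rhoE z : eR * rhoE z = rhoE z.
Proof. by rewrite /rhoE !mulrA eR_eR. Qed.
Lemma rhoE_MaS z s : rhoE z * aS s = 0.
Proof. by rewrite /rhoE -mulrA eR_aS mulr0. Qed.

Lemma rhoE_aX y : rhoE (fun t => aX t * y) = eR * y * eR.
Proof.
suff h : \sum_k gsum (soc_term k) (aX (e k) * y) = eR * y * eR.
  by rewrite /rhoE h !mulrA eR_eR -!mulrA eR_eR.
have bound k j : (gdeg y + 2 <= j)%N -> pg j (aX (e k) * y) = 0.
  case: j => [|[|j]]; rewrite ?addn2 // !ltnS => h.
  by rewrite pgSS_aX gdegP // mulr0.
(* X(e_k) has degree 2, so the range is longer by two than that of y. The terms j = 0, 1 vanish and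
   the others are indexed by the degree in y. *)
transitivity (\sum_(k < 4) \sum_(j < (gdeg y).+2) soc_term k j (pg j (aX (e k) * y))).
  apply: eq_bigr => k _; apply: (gsumE (soc_termD k)) => j.
  by rewrite -addn2; exact: bound.
rewrite exchange_big /= [LHS]big_ord_recl /= [X in _ + X]big_ord_recl /= big1 // !add0r.
have <- : \sum_(j < gdeg y) eR * pg j y * eR = eR * y * eR.
  by rewrite -mulr_suml -mulr_sumr pg_sum //; exact: gdegP.
apply: eq_bigr => j _ /=.
rewrite -pg_sumr exchange_big /=.
rewrite (_ : \sum_(p <- _) _ = eR * pg j y * eR); last first.
  transitivity (\sum_(p <- disc_seq j) aR (p.1 * D p.2.1 p.2.2 (p.2.1 * p.2.2) ^+ j.+1)
    * (eR * pg j y * eR)); last by rewrite -mulr_suml -(big_morph aR aRD aR0) disc_seqP aR1 mul1r.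
  apply: eq_bigr => p _; rewrite -mulr_sumr aRM -mulrA; congr (_ * _).
  rewrite -sqdivK; last exact: dpow_pg.
  rewrite -(big_morph (sqdiv p.2.2 p.2.1 j.+1)
    (sqdivD _ _ _) (sqdiv0 _ _ _)); congr (sqdiv _ _ _ _).
  rewrite -mulr_sumr; congr (_ * _).
  transitivity ((\sum_i aX (iota (l (p.2.1 * f i)) * e i)) * pg j y).
    by rewrite mulr_suml; apply: eq_bigr => i _; rewrite pgSS_aX aXZ -mulrA.
  by rewrite -(big_morph aX aXD aX0) -(expand_e lD lZ e_basis lef).
by rewrite -[eR]/(ab (1, 0)) -pg_abM -pg_Mab pg_pg eqxx ?pg_Mab ?pg_abM.
Qed.

(** * Transfer to the remaining corners *)

Definition scaled_form w (lw : l w = 0) : lform.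
refine (@LForm (fun t => l (w * t)) _ _ _).
- by move=> s t; rewrite mulrDr lD.
- by move=> r s; rewrite mulrCA lZ.
- by rewrite mulr1.
Defined.

(* With g = e_0 f_0, the elements 1 - l(1) g, e_0 f_0 - e_1 f_1 and e_1 f_0    *)
(* of the kernel of l generate the unit ideal.                                *)
Lemma form_partition : exists q : seq (S * lform), forall s,
  \sum_(p <- q) \sum_i e i * p.1 * iota (p.2 (f i * s)) = s.
Proof.
pose g := e ord0 * f ord0; pose c := iota (l 1).
pose o1 : 'I_4 := lift ord0 ord0.
have lN (x : S) : l (- x) = - l x.
  have l0 : l 0 = 0 by apply: (addrI (l 0)); rewrite -lD !addr0.
  by apply: (addrI (l x)); rewrite -lD !subrr l0.
have w1 : l (1 - c * g) = 0 by rewrite lD lN lZ lef eqxx mulr1 subrr.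
have w2 : l (e ord0 * f ord0 - e o1 * f o1) = 0 by rewrite lD lN !lef subrr.
have w3 : l (e o1 * f ord0) = 0 by rewrite lef.
(* The coefficients come from (1 + c g)(1 - c g) + c^2 g (g - e_1 f_1) + c^2 (e_0 f_1)(e_1 f_0) = 1,
   where g = e_0 f_0. *)
exists [:: (1 + c * g, scaled_form w1); (c ^+ 2 * g, scaled_form w2);
  (c ^+ 2 * (e ord0 * f o1), scaled_form w3)] => s.
have E v w (lw : l w = 0) : \sum_i e i * v * iota (scaled_form lw (f i * s)) = v * w * s.
  rewrite -[RHS]mulrA [w * s](expand_e lD lZ e_basis lef) mulr_sumr.
  apply: eq_bigr => i _ /=.
  rewrite (_ : w * (f i * s) = w * s * f i); last by rewrite mulrA mulrAC.
  by rewrite [LHS]mulrC [e i * v]mulrC mulrCA.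
rewrite !big_cons big_nil /= !E // /g.
by move: (c) (e ord0) (f ord0) (e o1) (f o1) => c0 e0 f0 e1 f1; ring.
Qed.

Definition parts := sval (cid form_partition).
Lemma partsP s : \sum_(p <- parts) \sum_i e i * p.1 * iota (p.2 (f i * s)) = s.
Proof. exact: svalP (cid form_partition) s. Qed.

(** Removes an m from the left: antiderivations strip X(f_i s) = m(f_i) n(s) off a word, and [parts]
    rebuilds n(s) from the values phi(f_i s). *)
Definition retE y := \sum_(p <- parts) an p.1 * contr p.2 y.

Lemma retED x y : retE (x + y) = retE x + retE y.
Proof. by rewrite -big_split; apply: eq_bigr => p _; rewrite contrD mulrDr. Qed.
Lemma retE0 : retE 0 = 0.
Proof. by apply: (addrI (retE 0)); rewrite -retED !addr0. Qed.
Lemma retE_ab b y : retE (ab b * y) = aR b.1 * retE y.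
Proof.
by rewrite mulr_sumr; apply: eq_bigr => p _; rewrite contr_ab mulrA (aR_comm b.1) mulrA.
Qed.
Lemma retE_eRE y : retE (eR * y * eR) = retE y.
Proof. by apply: eq_bigr => p _; rewrite contr_eRE. Qed.
Lemma retE_eR y : retE (y * eR) = retE y.
Proof. by rewrite -retE_eRE -[RHS]retE_eRE; congr retE; rewrite -!mulrA eR_eR. Qed.
Lemma retE_Mab y b : retE (y * ab b) = aR b.1 * retE y.
Proof.
by rewrite -retE_eR -mulrA ab_eR mulrA (aR_comm b.1) -mulrA (retE_ab (_, _)) retE_eR.
Qed.
Lemma retE_E y : retE y * eR = retE y.
Proof.
rewrite mulr_suml; apply: eq_bigr => p _.
by rewrite -contr_E !mulrA -!mulrA eR_eR.
Qed.
Lemma aS_retE y : aS 1 * retE y = retE y.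
Proof. by rewrite mulr_sumr; apply: eq_bigr => p _; rewrite mulrA aS_an mul1r. Qed.

(** Only x = n(s) y matters. There [contr] gives phi(f_i s) y - X(f_i s) d y; the first part adds up
    to n(s) y by [partsP], and the second contains the Casimir relation as a factor. *)
Lemma retE_am x : \sum_i aS (e i) * retE (am (f i) * x) = aS 1 * x * eR.
Proof.
elim/(A_ind (p := A)): x => [x y hx hy|b|s y _|s y _].
- rewrite mulrDr mulrDl -hx -hy -big_split; apply: eq_bigr => i _ /=.
  by rewrite mulrDr retED mulrDr.
- rewrite aS_ab aS_eR big1 // => i _.
  by rewrite am_ab -retE_eR am_eR retE0 mulr0.
- rewrite mulrA aS_am !mul0r big1 // => i _.
  by rewrite mulrA am_am mul0r retE0 mulr0.
rewrite mulrA aS_an mul1r.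
transitivity (\sum_(p <- parts) \sum_i
   (an (e i * p.1 * iota (p.2 (f i * s))) * y * eR
    - an (p.1 * e i) * am (f i) * (aS s * an 1 * contr p.2 y))).
  rewrite exchange_big; apply: eq_bigr => i _ /=; rewrite mulr_sumr.
  apply: eq_bigr => p _; rewrite [am _ * _]mulrA aXE contr_aX !mulrBr !mulrA aS_an.
  congr (_ - _).
    rewrite -(an_ab A _ (p.2 (f i * s), iota (p.2 (f i * s)))) -/(aR _).
    by rewrite !(aR_comm _ (an _)) -[_ * an _ * eR]mulrA an_eR.
  by rewrite aX_def -am_aS [e i * _]mulrC !mulrA.
under eq_bigr => p _ do rewrite big_split sumrN -!mulr_suml.
rewrite sumrB.
have -> : \sum_(p <- parts) (\sum_i an (p.1 * e i) * am (f i)) * (aS s * an 1 * contr p.2 y) = 0.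
  rewrite big1 // => p _; rewrite (_ : \sum_i _ = 0) ?mul0r //.
  under eq_bigr => i _ do rewrite -aS_an -mulrA.
  by rewrite -mulr_sumr casimir0 mulr0.
rewrite subr0 -!mulr_suml -[in RHS](partsP s); congr (_ * _ * _).
rewrite (big_morph an (anD A) an0); apply: eq_bigr => p _.
by rewrite (big_morph an (anD A) an0).
Qed.

Definition retF y := tau (retE (tau y)).

Lemma retFD x y : retF (x + y) = retF x + retF y.
Proof. by rewrite /retF tauD retED tauD. Qed.
Lemma retF_ab b y : retF (ab b * y) = aR b.1 * retF y.
Proof. by rewrite /retF tauM tau_ab retE_Mab tauM tau_aR (aR_comm b.1). Qed.
Lemma retF_eRE y : retF (eR * y * eR) = retF y.
Proof. by rewrite /retF !tauM tau_eR mulrA retE_eRE. Qed.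
Lemma retF_E y : eR * retF y = retF y.
Proof. by rewrite /retF -[in RHS]retE_E tauM tau_eR. Qed.
Lemma retF_an y : \sum_i retF (y * an (f i)) * aS (e i) = eR * y * aS 1.
Proof.
rewrite -[y in RHS]tauK -[eR](tau_eR) -(tau_aS).
rewrite -!tauM mulrA -retE_am tau_sum.
by apply: eq_bigr => i _; rewrite tauM tau_aS /retF tauM tau_an.
Qed.

(** The analogue of [rhoE] for e_R A e_S: multiply by n(f_k) on the right to enter e_R A e_R, apply
    [rhoE] there, and remove the n(f_k) by [retF], the mirror image of [retE]. *)
Definition rhoH z := \sum_k retF (rhoE (fun t => z t * an (f k))) * aS (e k).

Lemma rhoH_ext z z' : z =1 z' -> rhoH z = rhoH z'.
Proof.
move=> h; apply: eq_bigr => k _; congr (retF _ * _).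
by apply: rhoE_ext => t; rewrite h.
Qed.
Lemma rhoHD z z' : rhoH (fun t => z t + z' t) = rhoH z + rhoH z'.
Proof.
rewrite -big_split; apply: eq_bigr => k _ /=; rewrite -mulrDl -retFD -rhoED.
by congr (retF _ * _); apply: rhoE_ext => t; rewrite mulrDl.
Qed.
Lemma rhoHZ r z : rhoH (fun t => aR r * z t) = aR r * rhoH z.
Proof.
rewrite mulr_sumr; apply: eq_bigr => k _.
rewrite mulrA -(retF_ab (r, iota r)) -/(aR r) -rhoEZ.
by congr (retF _ * _); apply: rhoE_ext => t; rewrite mulrA.
Qed.
Lemma rhoH_aX y : rhoH (fun t => aX t * y) = eR * y * aS 1.
Proof.
rewrite -retF_an; apply: eq_bigr => k _; congr (_ * _).
rewrite -[RHS]retF_eRE -(rhoE_aX); congr (retF _).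
by apply: rhoE_ext => t; rewrite mulrA.
Qed.
Lemma rhoH_aS z s : rhoH (fun t => z t * aS s) = rhoH z * aS s.
Proof.
pose F (u v : S) := retF (rhoE (fun t => z t * an v)) * aS u.
transitivity (\sum_k F (e k) (s * f k)).
  apply: eq_bigr => k _; congr (retF _ * _).
  by apply: rhoE_ext => t; rewrite -mulrA aS_an.
rewrite -(casimir_shift lD lZ e_basis f_basis lef).
- by rewrite mulr_suml; apply: eq_bigr => k _; rewrite /F -mulrA -aSM [s * _]mulrC.
- by move=> x y v; rewrite /F aSD mulrDr.
- move=> x y v; rewrite /F -mulrDl -retFD -rhoED; congr (retF _ * _).
  by apply: rhoE_ext => t; rewrite anD mulrDr.
- move=> r x y; rewrite /F -aR_aS mulrA (aR_comm r) -(retF_ab (r, iota r)) -/(aR r).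
  rewrite -rhoEZ; congr (retF _ * _); apply: rhoE_ext => t.
  by rewrite mulrA -(aR_comm r) -mulrA ab_an.
Qed.
Lemma rhoH_E z : eR * rhoH z = rhoH z.
Proof. by rewrite mulr_sumr; apply: eq_bigr => k _; rewrite mulrA retF_E. Qed.

Definition rho z := rhoE z + rhoH z.

Lemma rho_ext z z' : z =1 z' -> rho z = rho z'.
Proof. by move=> h; rewrite /rho (rhoE_ext h) (rhoH_ext h). Qed.
Lemma rhoD z z' : rho (fun t => z t + z' t) = rho z + rho z'.
Proof. by rewrite /rho rhoED rhoHD addrACA. Qed.
Lemma rhoZ r z : rho (fun t => aR r * z t) = aR r * rho z.
Proof. by rewrite /rho rhoEZ rhoHZ mulrDr. Qed.
Lemma rho_aX y : rho (fun t => aX t * y) = eR * y.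
Proof. by rewrite /rho rhoE_aX rhoH_aX -mulrDr eR_eS mulr1. Qed.
Lemma rho_E z : eR * rho z = rho z.
Proof. by rewrite mulrDr rhoH_E eR_rhoE. Qed.
Lemma rho_aS z s : rho (fun t => z t * aS s) = rho z * aS s.
Proof.
by rewrite /rho rhoE_aS add0r rhoH_aS mulrDl rhoE_MaS add0r.
Qed.
Lemma rho_ab b z : ab b * rho z = rho (fun t => aR b.1 * z t).
Proof. by rewrite rhoZ -rho_E mulrA ab_eR mulrA. Qed.

Definition rho_am u := rho (fun t => am t * u).

Lemma rho_amD x y : rho_am (x + y) = rho_am x + rho_am y.
Proof. by rewrite /rho_am -rhoD; apply: rho_ext => t; rewrite mulrDr. Qed.
Lemma rho_amZ r y : rho_am (aR r * y) = aR r * rho_am y.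
Proof.
by rewrite /rho_am -rhoZ; apply: rho_ext => t; rewrite mulrA (aR_comm r) mulrA.
Qed.
Lemma rho_am_aS y s : rho_am (y * aS s) = rho_am y * aS s.
Proof. by rewrite /rho_am -rho_aS; apply: rho_ext => t; rewrite mulrA. Qed.
Lemma rho_am_an y : rho_am (an 1 * y) = eR * y.
Proof.
rewrite -(rho_aX); apply: rho_ext => t.
by rewrite mulrA aXE mulr1.
Qed.

(* The projection of aS 1 * A to a complement of an 1 * A.                    *)
Definition comp_an x := aS 1 * x - an 1 * rho_am x.

Lemma comp_anD x y : comp_an (x + y) = comp_an x + comp_an y.
Proof. by rewrite /comp_an rho_amD !mulrDr opprD addrACA. Qed.
Lemma comp_anZ r y : comp_an (aR r * y) = aR r * comp_an y.
Proof.
by rewrite /comp_an rho_amZ mulrBr !mulrA (aR_comm r (aS 1)) (aR_comm r (an 1)).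
Qed.
Lemma comp_an_aS y s : comp_an (y * aS s) = comp_an y * aS s.
Proof. by rewrite /comp_an rho_am_aS mulrBl !mulrA. Qed.
Lemma comp_an_an y : comp_an (an 1 * y) = 0.
Proof. by rewrite /comp_an rho_am_an !mulrA aS_an mul1r an_eR subrr. Qed.
Lemma am_comp_an y : am 1 * comp_an y = am 1 * y.
Proof. by rewrite /comp_an mulrBr !mulrA am_aS mulr1 am1_an1 mul0r subr0. Qed.

Definition aR_fst (b : B) : A := aR b.1.
Lemma aR_fst_zmod_morphism : zmod_morphism aR_fst.
Proof. by move=> b c; rewrite /aR_fst aRD aRN. Qed.
Lemma aR_fst_monoid_morphism : monoid_morphism aR_fst.
Proof. by split=> [|b c]; [exact: aR1|exact: aRM]. Qed.
HB.instance Definition _ := GRing.isZmodMorphism.Build B A aR_fst aR_fst_zmod_morphism.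
HB.instance Definition _ := GRing.isMonoidMorphism.Build B A aR_fst aR_fst_monoid_morphism.

Definition A_fst : lmodType B := restr_scalars (aR_fst : {rmorphism B -> A}) A^o.

Definition sig_mn : mnact iota (A_fst * A_B)%type.
refine (@MNAct _ _ _ (A_fst * A_B)%type
  (fun s g => (comp_an (aS s * (g.2 : A)) : A, 0))
  (fun s g => (0, an s * am 1 * (g.1 : A) : A)) _ _ _ _ _ _ _ _).
- by move=> s t g; congr (_, _); rewrite ?addr0 // aSD mulrDl comp_anD.
- by move=> s t g; congr (_, _); rewrite ?addr0 // anD !mulrDl.
- by move=> s g h; congr (_, _); rewrite ?addr0 // mulrDr comp_anD.
- by move=> s g h; congr (_, _); rewrite ?addr0 // mulrDr.
- by move=> s b g; congr (_, _); rewrite -[(b *: g).2]/(ab b * (g.2 : A)) mulrA aS_ab mulrC.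
- move=> s b g; congr (_, _); rewrite -an_ab -[(b *: g).1]/(aR b.1 * (g.1 : A)).
  rewrite -[an s * ab b * am 1]mulrA ab_am -(ab_am A (b.1, iota b.1)) -/(aR b.1).
  by rewrite -(aR_comm b.1 (am 1)) !mulrA.
- move=> b s g; congr (_, _); last by rewrite scaler0.
  by rewrite -aR_aS -mulrA comp_anZ.
- move=> b s g; congr (_, _); first by rewrite scaler0.
  by rewrite A_BE -ab_an !mulrA.
Defined.

(** Recovers [comp_an x] from m(1) x, for x in e_S A e_S. The action [sig_mn] satisfies the
    relations because [comp_an] kills n(1) A, and because x and [comp_an x] have the same product
    with m(1). *)
Lemma sig_ex : exists sig : A -> A,
  [/\ forall x y, sig (x + y) = sig x + sig y,
      forall r y, sig (aR r * y) = aR r * sig y,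
      forall s y, sig (am s * y) = comp_an (aS s * y * aS 1) &
      forall y s, sig (y * aS s) = sig y * aS s].
Proof.
have r1 (g : (A_fst * A_B)%type) : aM sig_mn 1 (aN sig_mn 1 g) = 0.
  congr (_, _). rewrite /= !mulrA aS_an mul1r -mulrA. exact: comp_an_an.
have r2 (g : (A_fst * A_B)%type) :
    \sum_i aN sig_mn (e i) (aM sig_mn (f i) g) = 0.
  have S2 (H : 'I_4 -> (A_fst * A_B)%type) : \sum_i H i = (\sum_i (H i).1, \sum_i (H i).2).
    by elim/big_rec3: _ => [|i p q u _ ->] //; case: (H i).
  rewrite S2; congr (_, _); first by rewrite big1.
  transitivity ((\sum_i an (e i) * am (f i)) * (g.2 : A)); last by rewrite casimir0 mul0r.
  rewrite mulr_suml; apply: eq_bigr => i _ /=.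
  by rewrite -mulrA am_comp_an [am 1 * _]mulrA am_aS mul1r mulrA.
have [act [actDl actDr actM act_b act_v]] := acts_ex A r1 r2.
pose g0 : (A_fst * A_B)%type := (0, aS 1 : A).
(* The invariant of the action: the second component is e_S y e_S, and the first is a quotient of
   e_R y e_S by m(1) on the left. *)
have actE y : ((act y g0).2 : A) = aS 1 * y * aS 1 /\
    am 1 * ((act y g0).1 : A) = eR * y * aS 1.
  elim/(A_ind (p := A)): y => [x y [hx1 hx2] [hy1 hy2]|b|s y [h1 h2]|s y [h1 h2]].
  - by rewrite actDl /= !mulrDr !mulrDl hx1 hy1 hx2 hy2.
  - rewrite act_b; split.
      by rewrite -[LHS]/(ab b * aS 1) ab_aS aS_ab aS_aS !mulr1.
    rewrite -[LHS]/(am 1 * (aR b.1 * 0)) !mulr0 eR_ab -mulrA.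
    by rewrite eR_aS mulr0.
  - rewrite actM (act_v s _).1 /= h1; split; first by rewrite mulrA aS_am !mul0r.
    by rewrite am_comp_an !mulrA am_aS mul1r eR_am am_aS mulr1.
  - rewrite actM (act_v s _).2 /= -mulrA h2; split; last by rewrite mulr0 mulrA eR_an !mul0r.
    by rewrite !mulrA an_eR aS_an mul1r.
exists (fun y => (act y g0).1 : A); split=> [x y|r y|s y|y s].
- by rewrite actDl.
- by rewrite actM act_b.
- by rewrite actM (act_v s _).1 /= (actE y).1 !mulrA aS_aS mulr1.
elim/(A_ind (p := A)): y => [x y hx hy|b|t y _|t y _].
- by rewrite mulrDl !actDl /= mulrDl hx hy.
- rewrite -rmorphM !act_b -[LHS]/(aR (b * (0, s)).1 * 0) -[RHS]/(aR b.1 * 0 * aS s).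
  by rewrite !mulr0 mul0r.
- rewrite -mulrA !(actM (am t)) !(act_v t _).1 /= !(actE _).1 -comp_an_aS; congr comp_an.
  by rewrite -!mulrA !aS_aS mulr1 mul1r.
- by rewrite -mulrA !(actM (an t)) !(act_v t _).2 /= mul0r.
Qed.

Definition sig := sval (cid sig_ex).
Lemma sigD x y : sig (x + y) = sig x + sig y.
Proof. by have [h _ _ _] := svalP (cid sig_ex); exact: h. Qed.
Lemma sig_am s y : sig (am s * y) = comp_an (aS s * y * aS 1).
Proof. by have [_ _ h _] := svalP (cid sig_ex); exact: h. Qed.
Lemma sig_aS y s : sig (y * aS s) = sig y * aS s.
Proof. by have [_ _ _ h] := svalP (cid sig_ex); exact: h. Qed.

(** For the family z t = m(t) x with x in e_S A e_S, the two terms are the component of x along n(1)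
    A and its complement [comp_an x]. *)
Definition retL z := an 1 * rhoH z + sig (z 1).

Lemma retL_ext z z' : z =1 z' -> retL z = retL z'.
Proof. by move=> h; rewrite /retL h (rhoH_ext h). Qed.
Lemma retLD z z' : retL (fun t => z t + z' t) = retL z + retL z'.
Proof. by rewrite /retL rhoHD mulrDr sigD addrACA. Qed.
Lemma retL_aS z s : retL (fun t => z t * aS s) = retL z * aS s.
Proof. by rewrite /retL rhoH_aS sig_aS mulrDl mulrA. Qed.
Lemma retL_am u : retL (fun t => am t * (aS 1 * u * aS 1)) = aS 1 * u * aS 1.
Proof.
set x := aS 1 * u * aS 1.
have x1 : aS 1 * x = x by rewrite /x !mulrA aS_aS mulr1.
have xr : x * aS 1 = x by rewrite /x -mulrA aS_aS mulr1.
have h : rhoE (fun t => am t * x) = 0.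
  rewrite -[RHS](rhoE_aS (fun t => am t * x) 1).
  by apply: rhoE_ext => t; rewrite -mulrA xr.
rewrite /retL sig_am x1 xr /comp_an -[in RHS]x1 -[rhoH _]add0r -h.
by rewrite -[_ + rhoH _]/(rho_am x) addrC subrK.
Qed.

Definition retR z := tau (retL (fun t => tau (z t))).

Lemma retR_ext z z' : z =1 z' -> retR z = retR z'.
Proof. by move=> h; congr tau; apply: retL_ext => t; rewrite h. Qed.
Lemma retRD z z' : retR (fun t => z t + z' t) = retR z + retR z'.
Proof. by rewrite /retR -tauD -retLD; congr tau; apply: retL_ext => t; rewrite tauD. Qed.
Lemma retR0 : retR (fun=> 0) = 0.
Proof. by apply: (addrI (retR (fun=> 0))); rewrite -retRD !addr0. Qed.
Lemma retR_sum I (r : seq I) (G : I -> S -> A) :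
  retR (fun t => \sum_(i <- r) G i t) = \sum_(i <- r) retR (G i).
Proof.
elim: r => [|i r IH].
  by rewrite big_nil -[RHS]retR0; apply: retR_ext => t; rewrite big_nil.
by rewrite big_cons -IH -retRD; apply: retR_ext => t; rewrite big_cons.
Qed.
Lemma retR_aS z s : retR (fun t => aS s * z t) = aS s * retR z.
Proof.
rewrite -[X in X * _](tau_aS) -tauM -retL_aS.
by congr tau; apply: retL_ext => t; rewrite tauM tau_aS.
Qed.
Lemma retR_an u : retR (fun t => aS 1 * u * aS 1 * an t) = aS 1 * u * aS 1.
Proof.
have E : aS 1 * u * aS 1 = tau (aS 1 * tau u * aS 1).
  by rewrite !tauM tauK tau_aS mulrA.
rewrite {2}E -[in RHS]retL_am; congr tau; apply: retL_ext => t.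
by rewrite tauM tau_an E tauK.
Qed.

(** The part of [retN] for e_S A e_S: right multiplication by n(t) leads to e_S A e_R, where [retE]
    removes m(f_i); then [retR] removes the n(t). *)
Definition retG y := retR (fun t => retE (y * an t)).

Lemma retGD x y : retG (x + y) = retG x + retG y.
Proof. by rewrite -retRD; apply: retR_ext => t; rewrite mulrDl retED. Qed.
Lemma aS_retG y s : retR (fun t => aS s * retE (y * an t)) = aS s * retG y.
Proof. exact: retR_aS. Qed.
Lemma retG_ab b y : retG (ab b * y) = aR b.1 * retG y.
Proof.
have h : retG y = aS 1 * retG y.
  by rewrite -aS_retG; apply: retR_ext => t; rewrite aS_retE.
rewrite h mulrA aR_aS -aS_retG; apply: retR_ext => t.
by rewrite -[in LHS]mulrA retE_ab -aR_aS -[RHS]mulrA aS_retE.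
Qed.
Lemma retG_am x : \sum_i aS (e i) * retG (am (f i) * x) = aS 1 * x * aS 1.
Proof.
rewrite -retR_an.
under eq_bigr => i _ do rewrite -aS_retG.
rewrite -retR_sum; apply: retR_ext => t.
under eq_bigr => i _ do rewrite -mulrA.
by rewrite retE_am -!mulrA an_eR aS_an mul1r.
Qed.

Definition retN y := retE y + retG y.

Lemma retND x y : retN (x + y) = retN x + retN y.
Proof. by rewrite /retN retED retGD addrACA. Qed.
Lemma retN_ab b y : retN (ab b * y) = aR b.1 * retN y.
Proof. by rewrite /retN retE_ab retG_ab mulrDr. Qed.
Lemma retN_am x : \sum_i aS (e i) * retN (am (f i) * x) = aS 1 * x.
Proof.
under eq_bigr => i _ do rewrite mulrDr.
by rewrite big_split /= retE_am retG_am -mulrDr eR_eS mulr1.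
Qed.

(* The two components of a B-linear retraction of y |-> w y, where w is the   *)
(* relation 1 (x) 1 + sum_i e_i (x) f_i.                                      *)
Lemma retraction_ex : exists rM rN : S -> A -> A,
  [/\ [/\ forall s t y, rM (s + t) y = rM s y + rM t y,
          forall s x y, rM s (x + y) = rM s x + rM s y,
          forall s b y, rM (s * b.2) y = rM s (ab b * y) &
          forall b s y, rM (iota b.1 * s) y = ab b * rM s y],
      [/\ forall s t y, rN (s + t) y = rN s y + rN t y,
          forall s x y, rN s (x + y) = rN s x + rN s y,
          forall s b y, rN (s * iota b.1) y = rN s (ab b * y) &
          forall b s y, rN (b.2 * s) y = ab b * rN s y] &
      forall y, rM 1 (an 1 * y) + \sum_i rN (e i) (am (f i) * y) = y].
Proof.
exists (fun s y => rho (fun t => am (t * s) * y)), (fun s y => aS s * retN y).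
split; first split.
- by move=> s t y; rewrite -rhoD; apply: rho_ext => u; rewrite mulrDr amD mulrDl.
- by move=> s x y; rewrite -rhoD; apply: rho_ext => u; rewrite mulrDr.
- by move=> s b y; apply: rho_ext => u; rewrite [RHS]mulrA am_ab mulrA.
- move=> b s y; rewrite rho_ab; apply: rho_ext => u.
  by rewrite [RHS]mulrA -[aR b.1]/(ab (b.1, iota b.1)) ab_am mulrCA.
- split.
  + by move=> s t y; rewrite aSD mulrDl.
  + by move=> s x y; rewrite retND mulrDr.
  + by move=> s b y; rewrite retN_ab mulrA (aR_comm b.1) aR_aS mulrC.
  + by move=> b s y; rewrite mulrA ab_aS.
- move=> y; rewrite retN_am.
  have -> : rho (fun t => am (t * 1) * (an 1 * y)) = eR * y.
    rewrite -(rho_aX); apply: rho_ext => t.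
    by rewrite mulrA aXE !mulr1.
  by rewrite -mulrDl eR_eS mul1r.
Qed.

(** Keeps only the part of degree -1 of the retraction. As arrows have degree 1, comparing degrees
    in the retraction identity shows that it still holds. *)
Lemma graded_retraction : exists rr : arrows iota -> A -> A,
  [/\ [/\ forall w v y, rr (w + v) y = rr w y + rr v y,
          forall v x y, rr v (x + y) = rr v x + rr v y,
          forall v b y, rr (ract v b) y = rr v (ab b * y) &
          forall b v y, rr (b *: v) y = ab b * rr v y],
      forall y, rr (vM iota 1) (an 1 * y) + \sum_i rr (vN iota (e i)) (am (f i) * y) = y &
      forall k v y, rr v (pg k.+1 y) = pg k (rr v y)].
Proof.
have [rM [rN [[MDl MDr MA MZ] [NDl NDr NA NZ] rE]]] :=
  retraction_ex.
pose r (v : arrows iota) y := rM v.1 y + rN v.2 y.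
have rDl w v y : r (w + v) y = r w y + r v y by rewrite /r MDl NDl addrACA.
have rDr v x y : r v (x + y) = r v x + r v y by rewrite /r MDr NDr addrACA.
have r0 v : r v 0 = 0 by apply: (addrI (r v 0)); rewrite -rDr !addr0.
have rA v b y : r (ract v b) y = r v (ab b * y) by rewrite /r MA NA.
have rZ b v y : r (b *: v) y = ab b * r v y by rewrite /r MZ NZ mulrDr.
have rM0 y : rM 0 y = 0 by apply: (addrI (rM 0 y)); rewrite -MDl !addr0.
have rN0 y : rN 0 y = 0 by apply: (addrI (rN 0 y)); rewrite -NDl !addr0.
pose F v k y := if k is j.+1 then pg j (r v y) else 0.
have FD v k x y : F v k (x + y) = F v k x + F v k y.
  by case: k => [|k]; rewrite ?addr0 // /F rDr pgD.
have F0 v k : F v k 0 = 0 by apply: (addrI (F v k 0)); rewrite -FD !addr0.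
have Fshift v (T : A -> A) y : (forall k, pg k.+1 (T y) = T (pg k y)) -> T 0 = 0 ->
    gsum (F v) (T y) = \sum_(k < gdeg y) pg k (r v (T (pg k y))).
  move=> TS T0; rewrite (@gsumE _ (F v) (FD v) (gdeg y).+1).
    by rewrite big_ord_recl add0r; apply: eq_bigr => k _; rewrite TS.
  by case=> // k; rewrite ltnS => /gdegP yk; rewrite TS yk T0.
exists (fun v y => gsum (F v) y); split; first split.
- move=> w v y; rewrite -big_split; apply: eq_bigr => -[[|k] hk] _ /=; rewrite ?addr0 //.
  by rewrite rDl pgD.
- by move=> v; exact: gsumD.
- move=> v b y.
  rewrite (@gsumE _ (F v) (FD v) (gdeg y)).
    by apply: eq_bigr => -[[|k] hk] _ //=; rewrite pg_abM rA.
  by move=> k /gdegP yk; rewrite pg_abM yk mulr0.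
- move=> b v y; rewrite mulr_sumr; apply: eq_bigr => -[[|k] hk] _ /=; rewrite ?mulr0 //.
  by rewrite rZ pg_abM.
- move=> y; rewrite (Fshift _ (fun x => an 1 * x)) ?mulr0 //; last by move=> k; exact: pgS_an.
  transitivity (\sum_(k < gdeg y) pg k (rM 1 (an 1 * pg k y)) +
     \sum_i \sum_(k < gdeg y) pg k (rN (e i) (am (f i) * pg k y))).
    congr (_ + _); first by apply: eq_bigr => k _; rewrite /r rN0 addr0.
    apply: eq_bigr => i _.
    rewrite (Fshift _ (fun x => am (f i) * x)) ?mulr0 //; last by move=> k; exact: pgS_am.
    by apply: eq_bigr => k _; rewrite /r rM0 add0r.
  rewrite exchange_big -big_split -[RHS](pg_sum (@gdegP y)).
  by apply: eq_bigr => k _; rewrite /= -pg_sumr -pgD rE pg_pg eqxx.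
- move=> k v y; pose N := maxn (gdeg y) k.+2.
  rewrite (@gsumE _ (F v) (FD v) k.+2) => [|j kj]; last first.
    by rewrite pg_pg gtn_eqF.
  rewrite [RHS](_ : _ = pg k (\sum_(j < N) F v j (pg j y))); last first.
    by congr pg; apply: (gsumE (FD v)) => j; rewrite geq_max => /andP[/gdegP].
  have kN : (k.+1 < N)%N by rewrite leq_max ltnSn orbT.
  rewrite big_ord_recr /= big1 ?add0r ?pg_pg ?eqxx; last first.
    by case=> [[|j] hj] _ //=; rewrite pg_pg ltn_eqF // r0 pg0r.
  rewrite pg_sumr [RHS](bigD1 (Ordinal kN)) //= [X in _ = _ + X]big1 ?addr0 ?pg_pg ?eqxx //.
  case=> [[|j] hj] /= jk; first by rewrite pg0r.
  by rewrite pg_pg; case: eqP => // kj; move: jk; rewrite -val_eqE /= kj eqxx.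
Qed.

(** M is a sum of copies of (R, 0) with basis the e_i, and N is a copy of (0, S) generated by 1. So
    a lift is determined by lifts of these generators. *)
Lemma arrows_projective : projective V.
Proof.
move=> M N g u gs.
pose p i := sval (cid (gs (u (vM iota (e i))))).
have pE i : g (p i) = u (vM iota (e i)) by exact: (svalP (cid (gs _))).
have [q qE] := gs (u (vN iota 1)).
pose h (v : V) : M :=
  \sum_i ((l (v.1 * f i), 0) : B) *: p i + ((0, v.2 : S) : B) *: q.
have hl : linear h.
  move=> b v w; rewrite /h scalerDr addrACA scaler_sumr -big_split; congr (_ + _).
    apply: eq_bigr => i _; rewrite /= scalerA -scalerDl; congr (_ *: _).
    apply/eqP; rewrite xpair_eqE /= mulr0 addr0 eqxx andbT.
    by rewrite -lZ -lD mulrA -mulrDl.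
  rewrite scalerA -scalerDl; congr (_ *: _).
  by apply/eqP; rewrite xpair_eqE /= mulr0 addr0 !eqxx.
exists (mklin hl) => v; rewrite -[mklin hl v]/(h v) linearD linear_sum.
rewrite (linearZ_LR g) qE -(linearZ_LR u) vN_scale mulr1.
rewrite [in RHS](arrowE v) linearD; congr (_ + _).
rewrite [v.1 in RHS](expand_e lD lZ e_basis lef).
rewrite (big_morph (fun s => u (vM iota s)) (id1 := 0) (op1 := +%R)) => [|s t|]; last first.
- by rewrite -[RHS](linear0 u); congr (u _).
- by rewrite vMD linearD.
by apply: eq_bigr => i _; rewrite (linearZ_LR g) pE -(linearZ_LR u) vM_scale.
Qed.

(** * The preprojective algebra as a quadratic algebra with split relation *)

Definition arr (v : V) : A := am v.1 + an v.2.
Lemma arr_vM s : arr (vM iota s) = am s.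
Proof. by rewrite /arr [an _]an0 addr0. Qed.
Lemma arr_vN s : arr (vN iota s) = an s.
Proof. by rewrite /arr [am _]am0 add0r. Qed.

Definition casimir_word : seq (V * V) :=
  (vM iota 1, vN iota 1) :: [seq (vN iota (e i), vM iota (f i)) | i <- enum 'I_4].
Lemma sum_casimir_word (T : nmodType) (F : V -> V -> T) :
  \sum_(p <- casimir_word) F p.1 p.2 =
  F (vM iota 1) (vN iota 1) + \sum_i F (vN iota (e i)) (vM iota (f i)).
Proof. by rewrite big_cons big_map big_enum. Qed.

Definition flip (v : V) : V := vM iota v.2 + vN iota v.1.
Lemma flip_vM s : flip (vM iota s) = vN iota s.
Proof. by apply/eqP; rewrite xpair_eqE /= !(addr0, add0r) !eqxx. Qed.
Lemma flip_vN s : flip (vN iota s) = vM iota s.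
Proof. by apply/eqP; rewrite xpair_eqE /= !(addr0, add0r) !eqxx. Qed.
Lemma flipD w v : flip (w + v) = flip w + flip v.
Proof. by rewrite /flip vMD vND addrACA. Qed.
Lemma flip_ract v b : flip (ract v b) = b *: flip v.
Proof.
by rewrite /flip scalerDr vM_scale vN_scale; congr (vM _ _ + vN _ _); exact: mulrC.
Qed.
Lemma flipZ b v : flip (b *: v) = ract (flip v) b.
Proof.
by rewrite /flip ractDl vM_ract vN_ract; congr (vM _ _ + vN _ _); exact: mulrC.
Qed.
Lemma tau_arr v : tau (arr v) = arr (flip v).
Proof.
by rewrite /arr tauD tau_am tau_an addrC /flip /= !(addr0, add0r).
Qed.

Lemma pp_quad_alg : exists Q : quad_alg V, ka Q = A.
Proof.
have [rr [[rDl rDr rA rZ] rE rg]] := graded_retraction.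
(* The left inverse on the right side is the mirror image of the one on the left side. *)
pose kr y v := tau (rr (flip v) (tau y)).
unshelve eexists (@QuadAlg B V A ab arr casimir_word _ _ _ _ _ _ _
  pg _ _ _ _ _ _ _ _ rr rDl rDr rA rZ _ kr _ _ _ _ _ _); last by [].
- by move=> w v; rewrite /arr amD anD addrACA.
- by move=> v b; rewrite /arr mulrDl am_ab an_ab.
- by move=> b v; rewrite /arr mulrDr ab_am ab_an.
- rewrite (sum_casimir_word (fun w v => arr w * arr v)) arr_vM arr_vN am1_an1 add0r.
  rewrite -[RHS](casimir0 A).
  by apply: eq_bigr => i _; rewrite arr_vM arr_vN.
- move=> T F FDl FDr FA b.
  rewrite (sum_casimir_word (fun w v => F (b *: w) v)).
  rewrite (sum_casimir_word (fun w v => F w (ract v b))); congr (_ + _).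
    rewrite vM_scale vN_ract -[iota b.1 * 1]mulrC -(vM_ract iota 1 (0, iota b.1)) FA.
    by rewrite vN_scale /= mulrC.
  transitivity (\sum_i (fun s t => F (vN iota s) (vM iota t)) (b.2 * e i) (f i)).
    by apply: eq_bigr => i _; rewrite vN_scale.
  rewrite (casimir_shift lD lZ e_basis f_basis lef
    (F := fun s t => F (vN iota s) (vM iota t))).
  + by apply: eq_bigr => i _; rewrite vM_ract mulrC.
  + by move=> x y z; rewrite vND FDl.
  + by move=> x y z; rewrite vMD FDr.
  + by move=> r x y; rewrite mulrC -(vN_ract iota x (r, 0)) FA vM_scale.
- move=> P PD Pj Pv x; apply: A_ind => // s y Py.
    by rewrite -arr_vM; exact: Pv.
  by rewrite -arr_vN; exact: Pv.
- move=> Z al al0.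
  have MA s b (z : Z) : al (vM iota (s * b.2)) z = al (vM iota s) (b *: z).
    by rewrite -vM_ract vactA.
  have NA s b (z : Z) : al (vN iota (s * iota b.1)) z = al (vN iota s) (b *: z).
    by rewrite -vN_ract vactA.
  have MZ b s (z : Z) : al (vM iota (iota b.1 * s)) z = b *: al (vM iota s) z.
    by rewrite -vM_scale vactZ.
  have NZ b s (z : Z) : al (vN iota (b.2 * s)) z = b *: al (vN iota s) z.
    by rewrite -vN_scale vactZ.
  have MD s t (z : Z) : al (vM iota (s + t)) z = al (vM iota s) z + al (vM iota t) z.
    by rewrite vMD vactDl.
  have ND s t (z : Z) : al (vN iota (s + t)) z = al (vN iota s) z + al (vN iota t) z.
    by rewrite vND vactDl.
  pose mn := @MNAct _ _ iota Z (fun s => al (vM iota s)) (fun s => al (vN iota s))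
    MD ND (fun s => vactDr al (vM iota s)) (fun s => vactDr al (vN iota s)) MA NA MZ NZ.
  have r1 (z : Z) : aM mn 1 (aN mn 1 z) + \sum_i aN mn (e i) (aM mn (f i) z) = 0.
    by have := al0 z; rewrite (sum_casimir_word (fun w v => al w (al v z))).
  (* The idempotent (1, 0) of B separates the single relation w into the two defining relations. *)
  have [p [pM pS]] : exists p : B, p.1 = 1 /\ p.2 = 0 by exists (1, 0).
  have r2 (z : Z) : aM mn 1 (aN mn 1 z) = 0.
    have := congr1 (GRing.scale p) (r1 z); rewrite scaler0 scalerDr scaler_sumr.
    rewrite -[p *: _](aMZ mn) pM rmorph1 mul1r big1 ?addr0 // => i _.
    by rewrite -(aNZ mn) pS mul0r; exact: aN0l.
  have r3 (z : Z) : \sum_i aN mn (e i) (aM mn (f i) z) = 0.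
    by have := r1 z; rewrite r2 add0r.
  have [act [actDl actDr actM act_b act_v]] := acts_ex A r2 r3.
  exists act; split=> // v z; rewrite actDl (act_v _ _).1 (act_v _ _).2 /=.
  by rewrite -vactDl -arrowE.
- exact: pgD.
- exact: pg_abM.
- exact: pg_Mab.
- exact: pg_ab.
- by move=> v y; rewrite mulrDl pgD pg0_am pg0_an addr0.
- by move=> k v y; rewrite mulrDl pgD pgS_am pgS_an -mulrDl.
- exact: pg_bound.
- exact: pg_sum.
- move=> y; rewrite (sum_casimir_word (fun w v => rr w (arr v * y))) arr_vN -[RHS]rE.
  by congr (_ + _); apply: eq_bigr => i _; rewrite arr_vM.
- by move=> x y v; rewrite /kr tauD rDr tauD.
- by move=> y w v; rewrite /kr flipD rDl tauD.
- by move=> y v b; rewrite /kr flip_ract rZ tauM tau_ab.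
- by move=> y b v; rewrite /kr tauM tau_ab -rA -flipZ.
- move=> y; rewrite -[RHS](tauK) -[X in _ = tau X]rE.
  rewrite (sum_casimir_word (fun w v => kr (y * arr w) v)) tauD tau_sum; congr (_ + _).
    by rewrite /kr tauM tau_arr flip_vM flip_vN arr_vN.
  transitivity (\sum_i (fun s t => tau (rr (vN iota t) (am s * tau y))) (e i) (f i)).
    by apply: eq_bigr => i _; rewrite /kr tauM tau_arr flip_vM flip_vN arr_vM.
  rewrite (casimir_sym lD lZ e_basis lef
    (F := fun s t => tau (rr (vN iota t) (am s * tau y)))) //.
  + by move=> s t w; rewrite amD mulrDl rDr tauD.
  + by move=> s t w; rewrite vND rDl tauD.
  + move=> r s t; rewrite [iota r * t]mulrC -(vN_ract iota t (r, 0)) rA.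
    by rewrite mulrA ab_am.
- by move=> k y v; rewrite /kr -pg_tau rg pg_tau.
Qed.

Definition tau_to (x : A) : A^c := tau x.
Definition tau_from (x : A^c) : A := tau x.
Lemma tau1 : tau 1 = 1. Proof. by rewrite -(rmorph1 ab) tau_ab. Qed.
Lemma tau_to_zmod_morphism : zmod_morphism tau_to.
Proof. exact: tauB. Qed.
Lemma tau_to_monoid_morphism : monoid_morphism tau_to.
Proof. by split; [exact: tau1|exact: tauM]. Qed.
Lemma tau_from_zmod_morphism : zmod_morphism tau_from.
Proof. exact: tauB. Qed.
Lemma tau_from_monoid_morphism : monoid_morphism tau_from.
Proof. by split; [exact: tau1|move=> x y; exact: tauM]. Qed.
HB.instance Definition _ := GRing.isZmodMorphism.Build A A^c tau_to tau_to_zmod_morphism.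
HB.instance Definition _ := GRing.isMonoidMorphism.Build A A^c tau_to tau_to_monoid_morphism.
HB.instance Definition _ := GRing.isZmodMorphism.Build A^c A tau_from tau_from_zmod_morphism.
HB.instance Definition _ := GRing.isMonoidMorphism.Build A^c A tau_from tau_from_monoid_morphism.

(** Modules over [A^c] are covered because [tau] is an isomorphism from A to its opposite. *)
Lemma pp_alg_pdex n : (forall M : lmodType R, pdex n M) ->
  (forall M : lmodType S, pdex n M) ->
  (forall M : lmodType A, pdex n.+2 M) /\ (forall M : lmodType A^c, pdex n.+2 M).
Proof.
move=> hR hS.
have h : forall M : lmodType A, pdex n.+2 M.
  have [Q <-] := pp_quad_alg.
  by apply: quad_alg_pdex (prod_ring_pdex hR hS); exact: (arrows_projective).
split=> //; apply: (iso_pdex (phi := tau_to) (psi := tau_from)) h; exact: tauK.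
Qed.
End RankFour.

(** * The bound on the global dimension *)

Lemma gldim_cases (A : pzRingType) :
  gldim A = +oo%E \/ exists n, gldim A = n%:Z%:E.
Proof.
rewrite /gldim /least; case: pselect => h; last by left.
by right; exists (ex_minn h).
Qed.

Lemma gldim_le_max (R S A : pzRingType) :
  (forall n, (forall M : lmodType R, pdex n M) -> (forall M : lmodType S, pdex n M) ->
     forall M : lmodType A, pdex n.+2 M) ->
  (gldim A <= maxe (gldim R) (gldim S) + 2%:E)%E.
Proof.
move=> h; case: (gldim_cases R) => [->|[m hm]]; first by rewrite maxye leey.
case: (gldim_cases S) => [->|[n hn]]; first by rewrite maxey leey.
have [hR hS] : (forall M : lmodType R, pdex m M) /\ (forall M : lmodType S, pdex n M).
  by split; apply/gldim_leP; rewrite ?hm ?hn.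
rewrite hm hn; have -> : (maxe m%:Z%:E n%:Z%:E + 2%:E = (maxn m n).+2%:Z%:E)%E.
  rewrite -EFin_max -EFinD -[(maxn m n).+2]addn2 PoszD; congr ((_ + _)%:E).
  case: (leqP m n) => mn; first by rewrite Order.POrderTheory.max_r.
  by rewrite Order.POrderTheory.max_l // lez_nat ltnW.
apply/gldim_leP; apply: h => M.
  by apply: pdexW (hR M); exact: leq_maxl.
by apply: pdexW (hS M); exact: leq_maxr.
Qed.

Theorem theorem6p1 (R S : comPzRingType) (iota : {rmorphism R -> S})
    (l : S -> R) (e f : 'I_4 -> S) :
  noetherian R ->
  relative_frobenius iota 4 ->
  is_generator iota l ->
  is_basis iota e ->
  is_basis iota f ->
  (forall i j, l (e i * f j) = (i == j)%:R) ->
  (gldim (preproj iota e f) <= maxe (gldim R) (gldim S) + 2%:E)%E /\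
  (gldim (preproj iota e f)^c <= maxe (gldim R) (gldim S) + 2%:E)%E.
Proof.
move=> _ _ [[lD lZ] _] e_basis f_basis lef.
have [A <-] := preproj_pp lD lZ e_basis f_basis lef.
by split; apply: gldim_le_max => n hR hS;
  have [] := pp_alg_pdex lD lZ e_basis f_basis lef A hR hS.
Qed.
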